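(* Let $(\mathsf X,\mathcal X)$ and $(\Theta,\mathcal T)$ be measurable spaces and let $\{P_\theta,\theta\in\Theta\}$ be a family of Markov transition kernels on $(\mathsf X,\mathcal X)$ such that for every $A\in\mathcal X$ the map $(x,\theta)\mapsto P_\theta(x,A)$ is measurable. Let $\{(X_n,\theta_n)\}_{n\ge 0}$ be an $\mathsf X\times\Theta$-valued process on a filtered probability space $(\Omega,\mathcal A,\{\mathcal F_n,n\ge0\},\mathbb P)$. Assume: (A1) $\{(X_n,\theta_n)\}_{n\ge0}$ is $(\mathcal F_n)$-adapted and, for every bounded measurable $h:\mathsf X\to\mathbb R$ and every $n\ge 0$, $\mathbb E[h(X_{n+1})\mid\mathcal F_n]=P_{\theta_n}h(X_n)$. (A2) There is a function $V:\mathsf X\to[1,+\infty)$ such that, for every $\theta\in\Theta$, $P_\theta$ is phi-irreducible and aperiodic, there exist constants $b_\theta\in(1,+\infty)$ and $\lambda_\theta\in(0,1)$ with $P_\theta V\le\lambda_\theta V+b_\theta$, and for every $d\ge1$ the level set $\{V\le d\}$ is $1$-small for $P_\theta$. (A3) There exist $\alpha\in(0,1/2)$ and a subset $\mathcal M_{V^\alpha}\subseteq\mathcal L_{V^\alpha}$ such that (a) for every $f\in\mathcal M_{V^\alpha}$, $$n^{-1/2}\sum_{k=1}^n\big|P_{\theta_k}\Lambda_{\theta_k}f-P_{\theta_{k-1}}\Lambda_{\theta_{k-1}}f\big|_{V^\alpha}\,V^\alpha(X_k)\to0\quad\text{in probability};$$ (b) $n^{-1/(2\alpha)}\sum_{k=0}^{n-1}L_{\theta_k}^{2/\alpha}\,P_{\theta_k}V(X_k)\to0$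 in probability, where $L_\theta=C_\theta\vee(1-\rho_\theta)^{-1}$. (A4) For every $f\in\mathcal M_{V^\alpha}$, $n^{-1}\sum_{k=0}^{n-1}F_{\theta_k}(X_k)\to\sigma^2(f)$ in probability, where $F_\theta= P_\theta(\Lambda_\theta f)^2-[P_\theta\Lambda_\theta f]^2$ and $\sigma^2(f)$ is a deterministic constant. Then for every $f\in\mathcal M_{V^\alpha}$, $$\frac1{\sqrt n}\sum_{k=1}^n\{f(X_k)-\pi_{\theta_{k-1}}(f)\}$$ converges in distribution, as $n\to\infty$, to $\mathcal N(0,\sigma^2(f))$.
   Context: Notation. $Pf(x)=\int P(x,dy)f(y)$. For $W:\mathsf X\to[1,\infty)$ and $f:\mathsf X\to\mathbb R$, $|f|_W=\sup_x|f(x)|/W(x)$; $\mathcal L_W$ is the set of measurable $f$ with $|f|_W<\infty$. For a signed measure $\mu$, $\|\mu\|_W=\sup\{|\mu(f)|: |f|_W\le1\}$; for kernels $P_1,P_2$, $\|P_1-P_2\|_W=\sup_x W(x)^{-1}\|P_1(x,\cdot)-P_2(x,\cdot)\|_W$ (a probability measure $\pi$ being viewed as the kernel $x\mapsto\pi$). A set $C\in\mathcal X$ is $1$-small for $P$ if there are $\delta>0$ and a probability measure $\nu$ with $P(x,A)\ge\delta\nu(A)$ for all $x\in C$, $A\in\mathcal X$. Under (A2), every $P_\theta$ has a unique invariant probability measure $\pi_\theta$, $\pi_\theta(V)<\infty$, and for each $\alpha\in(0,1]$ the following property P[$\alpha$] holds: for every $\theta\in\Theta$ there exist $C_\theta<\infty$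 and $\rho_\theta\in(0,1)$ such that $\|P_\theta^n-\pi_\theta\|_{V^\gamma}\le C_\theta\rho_\theta^n$ for all $n\ge 0$ and all $\gamma\in[\alpha,1]$. In (A3), $C_\theta,\rho_\theta$ are constants as in P[$\alpha$] for the $\alpha$ of (A3). It is implicit that the quantities in (A3) are random variables. For $f\in\mathcal L_{V^\alpha}$, $\Lambda_\theta f=\sum_{n\ge0}\big(P_\theta^nf-\pi_\theta(f)\big)\in\mathcal L_{V^\alpha}$; it solves the Poisson equation $\Lambda_\theta f-P_\theta\Lambda_\theta f=f-\pi_\theta(f)$. *)

(* Defs.v *)
From HB Require Import structures.
From mathcomp Require Import all_boot all_order all_algebra.
From mathcomp Require Import all_classical all_reals all_analysis.
From mathcomp Require Import measurable_realfun.

Set Implicit Arguments.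
Unset Strict Implicit.
Unset Printing Implicit Defensive.
Import Order.TTheory GRing.Theory Num.Theory.
Import numFieldNormedType.Exports.
Local Open Scope classical_set_scope.
Local Open Scope ring_scope.

Section weighted_norms.
Context d (X : measurableType d) (R : realType).
Implicit Types (W f : X -> R).

Definition wnorm W f : \bar R := ereal_sup [set (`|f x| / W x)%:E | x in setT].

Definition wspace W : set (X -> R) :=
  [set f | measurable_fun setT f /\ (wnorm W f < +oo)%E].

(* The W-norm of the signed measure mu1 - mu2. Integrals are extended-real
   valued, so that a finite distance forces W to be integrable. *)
Definition wdist_measure W (mu1 mu2 : {measure set X -> \bar R}) : \bar R :=
  ereal_sup [set `| \int[mu1]_x (f x)%:E - \int[mu2]_x (f x)%:E |%E |
    f in [set f | measurable_fun setT f /\ (wnorm W f <= 1)%E]].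

Definition wdist_kernel W (K1 K2 : X -> {measure set X -> \bar R}) : \bar R :=
  ereal_sup [set ((W x)^-1%:E * wdist_measure W (K1 x) (K2 x))%E | x in setT].

End weighted_norms.

Section markov_kernels.
Context d (X : measurableType d) (R : realType).
Implicit Types (K : R.-pker X ~> X) (f : X -> R).

(* Real-valued: meant for f integrable with respect to every K x (otherwise
   Rintegral returns 0). *)
Definition markov_op (K : X -> {measure set X -> \bar R}) f : X -> R :=
  fun x => \int[K x]_y f y.

Fixpoint kiter K (n : nat) : R.-spker X ~> X :=
  if n is m.+1 then mkcomp_noparam K (kiter K m)
  else kdirac (@measurable_id _ X setT).

Definition invariant_measure K (pi : probability X R) :=
  forall A, measurable A -> (pi A = \int[pi]_x K x A)%E.

Definition one_small K (C : set X) :=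
  measurable C /\
  exists (delta : R) (nu : probability X R), 0 < delta /\
    forall x A, C x -> measurable A -> (delta%:E * nu A <= K x A)%E.

(* Irreducibility, maximal irreducibility measures and cycles are those of
   Meyn and Tweedie. *)
Definition irreducibility_measure K
    (phi : {sigma_finite_measure set X -> \bar R}) :=
  (0 < phi setT)%E /\
  forall A, measurable A -> (0 < phi A)%E ->
    forall x, exists2 n : nat, (0 < n)%N & (0 < kiter K n x A)%E.

Definition phi_irreducible K := exists phi, irreducibility_measure K phi.

Definition maximal_irreducibility_measure K
    (psi : {sigma_finite_measure set X -> \bar R}) :=
  irreducibility_measure K psi /\
  forall phi : {sigma_finite_measure set X -> \bar R},
    irreducibility_measure K phi ->
    forall A, measurable A -> psi A = 0%E -> phi A = 0%E.

Definition is_cycle K (psi : set X -> \bar R) (p : nat) (D : nat -> set X) :=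
  [/\ forall i, (i < p)%N -> measurable (D i),
      trivIset `I_p D,
      forall i x, (i < p)%N -> D i x -> K x (D (i.+1 %% p)%N) = 1%E &
      psi (~` \bigcup_(i in `I_p) D i) = 0%E].

(* The largest p for which a p-cycle exists is 1. The choice of psi does not
   matter, since two maximal irreducibility measures have the same null sets. *)
Definition aperiodic K :=
  exists psi, maximal_irreducibility_measure K psi /\
    forall p D, (0 < p)%N -> is_cycle K psi p D -> p = 1%N.

(* The solution Lambda f of the Poisson equation. *)
Definition poisson_sol K (pi : probability X R) f : X -> R :=
  fun x => limn (series (fun n => markov_op (kiter K n) f x - \int[pi]_y f y)).

End markov_kernels.

Section random_sequences.
Context d (Omega : measurableType d) (R : realType) (Pr : probability Omega R).

Definition is_filtration (F : nat -> set (set Omega)) :=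
  [/\ forall n, sigma_algebra setT (F n),
      forall n, F n `<=` measurable &
      forall m n, (m <= n)%N -> F m `<=` F n].

Definition submeasurable (G : set (set Omega)) d' (T : measurableType d')
    (f : Omega -> T) := forall B, measurable B -> G (f @^-1` B).

(* Z is a version of the conditional expectation of Y given G. *)
Definition is_cond_exp (G : set (set Omega)) (Y Z : Omega -> R) :=
  [/\ Pr.-integrable setT (EFin \o Y), Pr.-integrable setT (EFin \o Z),
      submeasurable G Z &
      forall A, G A ->
        (\int[Pr]_(w in A) (Z w)%:E = \int[Pr]_(w in A) (Y w)%:E)%E].

(* Both modes of convergence include the measurability of the terms. *)
Definition cvg_in_probability (Y : nat -> Omega -> R) (c : R) :=
  (forall n, measurable_fun setT (Y n)) /\
  forall eps : R, 0 < eps ->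
    Pr [set w | eps <= `|Y n w - c|] @[n --> \oo] --> 0%E.

Definition cvg_in_distribution (Y : nat -> Omega -> R)
    (mu : probability (measurableTypeR R) R) :=
  (forall n, measurable_fun setT (Y n)) /\
  forall g : R -> R, continuous g -> (exists M : R, forall x, `|g x| <= M) ->
    (\int[Pr]_w (g (Y n w))%:E)%E @[n --> \oo] --> (\int[mu]_x (g x)%:E)%E.

End random_sequences.

(* N(0, v) for a variance v >= 0: the library's normal_prob takes a standard
   deviation, and normal_prob m 0 is not a Dirac mass. *)
Definition centered_normal (R : realType) (v : R) :
    probability (measurableTypeR R) R :=
  if v == 0 then (dirac (0 : measurableTypeR R) : probability _ _)
  else (normal_prob 0 (Num.sqrt v) : probability _ _).

(* Main.v *)
(* With g_th = Lambda_th f, the Poisson equation turns f(X_{k+1}) - pi_{th_k}(f)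
   into the martingale increment g_{th_k}(X_{k+1}) - P_{th_k} g_{th_k}(X_k) plus
   a telescoping term and the term P_{th_{k+1}} g_{th_{k+1}} - P_{th_k} g_{th_k}
   at X_{k+1}, which (A3a) makes negligible. The conditional variances are those
   of (A4); as |g_th| is at most a constant times L_th^2 V^alpha, the conditional
   Lindeberg sums and the boundary terms are controlled by (A3b).

   The central limit theorem for the martingale is proved with characteristic
   functions. The increments are multiplied by predictable indicators that keep
   the quadratic variation <M> and the Lindeberg sum bounded, after which
   E[exp(t^2 <M>_n / 2) cos(t M_n + phi)] is close to cos phi. To pass from the
   means of cos(t Y + phi) to those of a bounded continuous function g, use
   tightness and replace g(y) on [-K, K] by g(sin(c y) / c) with c small, hence
   by a Bernstein polynomial in sin(c y), which is a trigonometric polynomial. *)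
Require Import Defs.
From HB Require Import structures.
From mathcomp Require Import all_boot all_order all_algebra.
From mathcomp Require Import all_classical all_reals all_analysis.
From mathcomp Require Import measurable_realfun.
From mathcomp Require Import ring lra.

Set Implicit Arguments.
Unset Strict Implicit.
Unset Printing Implicit Defensive.
Import Order.TTheory GRing.Theory Num.Theory.
Import numFieldNormedType.Exports.
Local Open Scope classical_set_scope.
Local Open Scope ring_scope.

(** The increments need not have moments under [Pr]: only their integrals against P_theta(x, .) are
    known to be finite, and (A1) speaks of bounded functions of X_{n+1} alone. So the conditional
    law of X_{k+1} is carried as a kernel [K k] from Omega equipped with F_k, a conditional
    expectation is an integral against [K k w] for every w, and disintegration brings it back to
    [Pr] for nonnegative or bounded functions of w and X_{k+1}.

    Since <M> is random, a step multiplies the conditional mean of the cosine by about 1 - t^2/2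
    d<M>, a random factor. The weight exp(t^2 <M> / 2) turns it into 1 up to second order, so errors
    merely add up. As <M>_{k+1} is F_k-measurable, the weight comes out of the integral against
    [K k w].

    The phase phi covers sines as well as cosines, and everything stays real.

    The exponents come from p = 1/alpha >= 2: the p-th powers of the Poisson solution are bounded by
    multiples of L^(2/alpha) V, and n^(-1/(2 alpha)) is the p-th power of n^(-1/2). Hence (A3b) is a
    Lyapunov condition of order p. *)

Section trigonometric_bounds.
Context {R : realType}.
Implicit Types (A x M : R).

(** Mean value theorem from the base point 0. Applied to a remainder, it deduces each Taylor bound
    below from the bound one order lower. *)
Lemma norm_le_derive (f df : R -> R) x M :
  (forall y, is_derive y (1 : R) f (df y)) -> f 0 = 0 ->
  (forall y, `|y| <= `|x| -> `|df y| <= M) -> `|f x| <= M * `|x|.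
Proof.
move=> fdf f0 dfM.
have cf a b : {within `[a, b], continuous f}.
  apply: continuous_subspaceT => y; apply: differentiable_continuous.
  exact/derivable1_diffP.
have [x0|x0|->] := ltgtP x 0; last by rewrite f0 !normr0 mulr0.
- have [c /[!in_itv]/= /andP[xc c0]] := MVT x0 (fun y _ => fdf y) (cf _ _).
  rewrite f0 sub0r sub0r => /(congr1 Num.norm); rewrite normrN normrM normrN => ->.
  by rewrite ler_wpM2r// dfM// !ltr0_norm// lerN2 ltW.
- have [c /[!in_itv]/= /andP[xc c0]] := MVT x0 (fun y _ => fdf y) (cf _ _).
  rewrite f0 !subr0 => ->; rewrite normrM.
  by rewrite ler_wpM2r// dfM// !gtr0_norm// ltW.
Qed.

(** Two integrations of |cos A - cos (A + x)| <= min(2, |x|). The minimum keeps both regimes in one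
    estimate: cubic for small increments, quadratic for those counted in the Lindeberg sum. *)
Lemma cos_taylor2 A x :
  `|cos (A + x) - cos A + x * sin A + x ^+ 2 / 2 * cos A|
    <= Num.min 2 `|x| * x ^+ 2.
Proof.
have h2 y : `|cos A - cos (A + y)| <= Num.min 2 `|y|.
  rewrite le_min; apply/andP; split.
    rewrite (le_trans (ler_normB _ _))// -[leRHS]/(1 + 1) lerD//; exact: cos_max.
  rewrite -[leRHS]mul1r.
  apply: (@norm_le_derive (fun y => cos A - cos (A + y)) (fun y => sin (A + y))).
  - move=> z; apply: is_derive_eq; rewrite /GRing.scale/=; ring.
  - by rewrite addr0 subrr.
  - by move=> z _; exact: sin_max.
have min_le y z : `|y| <= `|z| -> Num.min 2 `|y| <= Num.min 2 `|z| :> R.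
  by move=> yz; rewrite le_min !ge_min lexx/= yz orbT.
have h1 y : `|sin A - sin (A + y) + y * cos A| <= Num.min 2 `|y| * `|y|.
  apply: (@norm_le_derive (fun y => sin A - sin (A + y) + y * cos A)
     (fun y => cos A - cos (A + y))).
  - move=> z; apply: is_derive_eq; rewrite /GRing.scale/=; ring.
  - by rewrite addr0 subrr add0r mul0r.
  - by move=> z zy; rewrite (le_trans (h2 z))// min_le.
rewrite -[in leRHS]real_normK ?num_real// [in leRHS]expr2 mulrA.
apply: (@norm_le_derive
  (fun y => cos (A + y) - cos A + y * sin A + y ^+ 2 / 2 * cos A)
  (fun y => sin A - sin (A + y) + y * cos A)).
- move=> z; apply: is_derive_eq; rewrite /GRing.scale/=; by field.
- by rewrite addr0; field.
- by move=> z zy; rewrite (le_trans (h1 z))// ler_pM// min_le.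
Qed.

(** [cos_taylor2] at the base point -pi/2, where the quadratic coefficient vanishes. *)
Lemma sin_taylor1 x : `|sin x - x| <= `|x| ^+ 3.
Proof.
have := cos_taylor2 (- (pi / 2)) x.
rewrite [- _ + _]addrC cosBpihalf cosN cos_pihalf sinN sin_pihalf subr0 mulr0 addr0 mulrN1.
move=> /le_trans; apply.
by rewrite -[in leLHS]real_normK ?num_real// exprS ler_wpM2r ?exprn_ge0// ge_min lexx orbT.
Qed.

(** With [a] equal to t^2/2 times a conditional variance, exp(a) (1 - a) is the factor that one step
    applies to the compensated cosine. The upper side is 1 - a <= exp(-a). *)
Lemma expR_taylor1 (a : R) : 0 <= a -> `|expR a * (1 - a) - 1| <= a ^+ 2 * expR a.
Proof.
move=> a0; have ea := expR_gt0 a.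
rewrite ler_norml; apply/andP; split; last first.
  rewrite (@le_trans _ _ 0)//; last by rewrite mulr_ge0 ?sqr_ge0 ?ltW.
  rewrite subr_le0 -ler_pdivlMl// mulr1 -expRN; exact: expR_ge1Dx.
have := expR_ge1Dx a; set e := expR a in ea * => h.
have -> : e * (1 - a) - 1 = - (a ^+ 2 * e) + ((1 - a + a ^+ 2) * e - 1) by ring.
rewrite lerDl subr_ge0.
(* This product equals 1 + a^3. *)
apply: (@le_trans _ _ ((1 - a + a ^+ 2) * (1 + a))); first nra.
rewrite ler_wpM2l//; nra.
Qed.

Lemma norm_cosB_le (x y : R) : `|cos x - cos y| <= `|x - y|.
Proof.
have := @norm_le_derive (fun z => cos (y + z) - cos y) (fun z => - sin (y + z)) (x - y) 1.
rewrite /= [y + (x - y)]addrC subrK mul1r; apply.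
- by move=> z; apply: is_derive_eq; rewrite /GRing.scale/=; ring.
- by rewrite addr0 subrr.
- by move=> z _; rewrite normrN sin_max.
Qed.

Lemma norm_expRB_le (x y M : R) : x <= M -> y <= M ->
  `|expR x - expR y| <= expR M * `|x - y|.
Proof.
wlog xy : x y / x <= y => [H xM yM|_ yM].
  have [|/ltW yx] := leP x y; first by move/H; apply.
  by rewrite distrC [`|x - y|]distrC H.
rewrite distrC ger0_norm ?subr_ge0 ?ler_expR// distrC ger0_norm ?subr_ge0//.
rewrite (@le_trans _ _ (expR y * (y - x)))//; last first.
  by rewrite ler_wpM2r ?subr_ge0 ?ler_expR.
have -> : expR x = expR y * expR (x - y) by rewrite -expRD addrC subrK.
rewrite -[X in X - _]mulr1 -mulrBr ler_wpM2l ?expR_ge0//.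
by have := expR_ge1Dx (x - y); lra.
Qed.

End trigonometric_bounds.

Section bounded_integrals.
Context d (T : measurableType d) (R : realType).

Lemma bounded_integrable (mu : {finite_measure set T -> \bar R}) (h : T -> R) M :
  measurable_fun setT h -> (forall x, `|h x| <= M) ->
  mu.-integrable setT (EFin \o h).
Proof.
move=> mh hM; apply: measurable_bounded_integrable => //.
  exact: fin_num_fun_lty.
exists M; split; first exact: num_real.
by move=> N MN x _; apply: le_trans (hM x) _; exact: ltW.
Qed.

End bounded_integrals.

(** * Characteristic function of the centred normal law *)

Section normal_characteristic_function.
Context {R : realType}.
Variables (s : R) (s_gt0 : 0 < s).
Local Notation mu := (@lebesgue_measure R).
Local Notation q := (normal_pdf 0 s).

Let s0 : s != 0. Proof. by rewrite gt_eqF. Qed.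

Lemma is_derive_normal_pdf (x : R) :
  is_derive x (1 : R) q (- (x / s ^+ 2) * q x).
Proof.
rewrite (normal_pdfE 0 s0) /normal_fun.
by apply: is_derive_eq; rewrite /GRing.scale/=; field.
Qed.

(** Domination by a multiple of the density with standard deviation 2s. With u = y/s, exp(-u^2/2) =
    exp(-u^2/8) exp(-3u^2/8), and the last factor absorbs |u| since |u| <= 2 exp(3u^2/8). *)
Lemma integrable_mul_normal_pdf :
  mu.-integrable setT (EFin \o (fun x => `|x| * q x)).
Proof.
pose c := 2 * s * (normal_peak s / normal_peak (2 * s)).
have s20 : 2 * s != 0 by rewrite mulf_neq0.
have c0 : 0 <= c by rewrite mulr_ge0 ?divr_ge0 ?normal_peak_ge0// mulr_ge0 ?(ltW s_gt0).
apply: (@le_integrable _ _ _ mu setT measurableT _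
  (fun x => (c * normal_pdf 0 (2 * s) x)%:E)) => //.
- apply/measurable_EFinP/measurable_funM; first exact: normr_measurable.
  exact: measurable_normal_pdf.
- move=> y _; rewrite lee_fin (ger0_norm (mulr_ge0 (normr_ge0 y) (normal_pdf_ge0 0 s y))).
  rewrite (ger0_norm (mulr_ge0 c0 (normal_pdf_ge0 0 (2 * s) y))).
  rewrite !normal_pdfE// /normal_fun subr0.
  have cE e : c * (normal_peak (2 * s) * e) = normal_peak s * (2 * s * e).
    by rewrite /c; field; rewrite gt_eqF// normal_peak_gt0.
  rewrite cE mulrCA ler_wpM2l ?normal_peak_ge0//.
  set u := y / s.
  have -> : - y ^+ 2 / (s ^+ 2 *+ 2) = - u ^+ 2 / 8 + - (u ^+ 2 * (3 / 8)).
    by rewrite /u; field.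
  have -> : - y ^+ 2 / ((2 * s) ^+ 2 *+ 2) = - u ^+ 2 / 8 by rewrite /u; field.
  rewrite expRD mulrCA [leRHS]mulrC ler_wpM2l ?expR_ge0// expRN.
  rewrite ler_pdivrMr ?expR_gt0//.
  have := expR_ge1Dx (u ^+ 2 * (3 / 8)).
  have -> : `|y| = `|u| * s by rewrite /u normrM normfV (gtr0_norm s_gt0) divfK.
  rewrite -[u ^+ 2]real_normK ?num_real//.
  set v := `|u|; set e := expR _ => ev; rewrite mulrAC ler_wpM2r ?(ltW s_gt0)//.
  by have := sqr_ge0 (v - 1); move: ev; nra.
- exact: (integrableZl measurableT c (integrable_normal_pdf 0 (2 * s))).
Qed.

(** The Radon-Nikodym derivative of [normal_prob] agrees almost everywhere with the density, because
    both have the same integral over every measurable set. *)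
Lemma integral_normal_prob (h : R -> R) (M : R) :
  measurable_fun setT h -> (forall x, `|h x| <= M) ->
  (\int[normal_prob 0 s]_x (h x)%:E = \int[mu]_x (h x * q x)%:E)%E.
Proof.
move=> mh hM; have dom := @normal_prob_dominates R 0 s.
rewrite -(Radon_Nikodym_change_of_variables dom)//=; last first.
  exact: (@bounded_integrable _ _ _ (normal_prob 0 s) h M).
have mh' : measurable_fun setT (EFin \o h) by exact/measurable_EFinP.
under [RHS]eq_integral do rewrite EFinM.
apply: ae_eq_integral => //.
- exact: emeasurable_funM.
- apply: emeasurable_funM => //.
  by apply/measurable_EFinP; exact: measurable_normal_pdf.
- apply: (@ae_eqe_mul2l _ _ _ mu setT _ _ (EFin \o h)).
  rewrite Radon_NikodymE//=.
  case: cid => /= k [k1 k2 k3].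
  apply: integral_ae_eq => //=.
  + by apply/measurable_EFinP; exact: measurable_normal_pdf.
  + by move=> E _ mE; rewrite -k3.
Qed.

Lemma integrable_bounded_normal_pdf (h : R -> R) (M : R) :
  measurable_fun setT h -> (forall x, `|h x| <= M) ->
  mu.-integrable setT (EFin \o (fun x => h x * q x)).
Proof.
move=> mh hM.
apply: (@le_integrable _ _ _ mu setT measurableT _
  (fun x => (M * normal_pdf 0 s x)%:E)).
- apply/measurable_EFinP/measurable_funM => //; exact: measurable_normal_pdf.
- move=> x _; rewrite lee_fin !normrM ler_wpM2r//.
  by rewrite (le_trans (hM x))// ler_norm.
- exact: (integrableZl measurableT M (integrable_normal_pdf 0 s)).
Qed.

(** Gaussian integration by parts: H = sin(t x + phi) q has derivative [h] and vanishes at infinity,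
    so [h] integrates to 0. The improper integral is reached by dominated convergence over growing
    intervals. *)
Lemma integral_sin_normal_pdf (t phi : R) :
  \int[mu]_x (x * sin (t * x + phi) * q x)
  = s ^+ 2 * t * \int[mu]_x (cos (t * x + phi) * q x).
Proof.
pose H x := sin (t * x + phi) * q x.
pose h x := t * (cos (t * x + phi) * q x) - (x * sin (t * x + phi) * q x) / s ^+ 2.
have dH x : is_derive x (1 : R) H (h x).
  have ? := is_derive_normal_pdf.
  by apply: is_derive_eq; rewrite /h /GRing.scale/=; field.
have mt : measurable_fun setT (fun x : R => t * x + phi).
  by apply: measurable_funD => //; exact: measurable_funM.
have mcos : measurable_fun setT (fun x : R => cos (t * x + phi)).
  by apply: measurableT_comp mt; exact: continuous_measurable_fun (@continuous_cos R).
have msin : measurable_fun setT (fun x : R => sin (t * x + phi)).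
  by apply: measurableT_comp mt; exact: continuous_measurable_fun (@continuous_sin R).
have mq := @measurable_normal_pdf R 0 s.
have icos : mu.-integrable setT (EFin \o (fun x => cos (t * x + phi) * q x)).
  by apply: integrable_bounded_normal_pdf => // x; exact: cos_max.
have isin : mu.-integrable setT (EFin \o (fun x => x * sin (t * x + phi) * q x)).
  apply: le_integrable integrable_mul_normal_pdf => //.
  - by apply/measurable_EFinP; apply: measurable_funM => //; exact: measurable_funM.
  - move=> x _; rewrite lee_fin !normrM normr_id.
    by rewrite ler_wpM2r// ler_piMr// sin_max.
have ih : mu.-integrable setT (EFin \o h).
  apply: (@integrableB _ _ _ mu setT _ (fun x => (t * (cos (t * x + phi) * q x))%:E)
    (fun x => (x * sin (t * x + phi) * q x / s ^+ 2)%:E)) => //.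
  - exact: (integrableZl measurableT t icos).
  - exact: (integrableZr measurableT (s ^+ 2)^-1 isin).
(* With n + 1 instead of n, the interval is nondegenerate already for n = 0. *)
pose I n : set R := `[- n.+1%:R, n.+1%:R]%classic.
have cvgh : (\int[mu]_(x in I n) (h x)%:E @[n --> \oo] -->
    \int[mu]_x (h x)%:E)%E.
  under eq_fun do rewrite integral_mkcond.
  apply: (@dominated_cvg _ _ _ mu setT measurableT _ _ (fun x => `|h x|%:E)) => //.
  - move=> n; apply/(measurable_restrictT _ _).1; first exact: measurable_itv.
    by apply: measurable_funTS; exact: (measurable_int _ ih).
  - move=> x _; apply: cvg_near_cst; near=> n.
    rewrite patchE mem_set// /I/= in_itv/= -ler_norml (@le_trans _ _ n%:R) ?ler_nat//.
    by near: n; exact: nbhs_infty_ger.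
  - exact: integrable_norm.
  - move=> n x _; rewrite patchE; case: ifPn => _; first by rewrite abse_EFin.
    by rewrite abse0 lee_fin.
have cvg0 : (\int[mu]_(x in I n) (h x)%:E @[n --> \oo] --> 0)%E.
  have FTC n : (\int[mu]_(x in I n) (h x)%:E = (H n.+1%:R - H (- n.+1%:R))%:E)%E.
    have cH (x : R) : {for x, continuous H}.
      by apply: differentiable_continuous; exact/derivable1_diffP.
    apply: continuous_FTC2.
    - by rewrite gtrN.
    - apply: continuous_subspaceT => x.
      apply: differentiable_continuous; apply/derivable1_diffP.
      have ? := is_derive_normal_pdf.
      exact: ex_derive.
    - split => //.
      + exact: cvg_at_right_filter (cH _).
      + exact: cvg_at_left_filter (cH _).
    - by move=> x _; rewrite derive1E; have [_ ->] := dH x.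
  under eq_fun do rewrite FTC.
  apply: cvg_EFin; first exact: nearW.
  (* The boundary values at distance N = n + 1 are O(1/N), from exp(N^2/(2s^2)) >= N^2/(2s^2) >=
     N/(2s^2). *)
  have qn n : `|H n.+1%:R - H (- n.+1%:R)| <= 4 * normal_peak s * s ^+ 2 * n.+1%:R^-1.
    have qn (x : R) : `|x| = n.+1%:R -> `|H x| <= 2 * normal_peak s * s ^+ 2 * n.+1%:R^-1.
      move=> xn; rewrite /H normrM.
      rewrite (@le_trans _ _ (q x))//.
        by rewrite (ger0_norm (normal_pdf_ge0 _ _ _)) ler_piMl ?normal_pdf_ge0 ?sin_max.
      rewrite normal_pdfE// /normal_fun subr0 mulNr expRN -[x ^+ 2]real_normK ?num_real// xn.
      rewrite [2 * _]mulrC -!(mulrA (normal_peak s)) ler_wpM2l ?normal_peak_ge0//.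
      set N := n.+1%:R; have N1 : 1 <= N :> R by rewrite ler1n.
      have -> : 2 * s ^+ 2 / N = (N / (s ^+ 2 *+ 2))^-1.
        by field; rewrite s0 gt_eqF.
      have sp : 0 < s ^+ 2 *+ 2 by rewrite pmulrn_lgt0// exprn_gt0.
      rewrite lef_pV2 ?posrE ?expR_gt0 ?divr_gt0//.
      apply: (@le_trans _ _ (N ^+ 2 / (s ^+ 2 *+ 2))).
        by rewrite ler_pM2r ?invr_gt0// expr2 ler_peMr// ltW.
      by rewrite (le_trans _ (expR_ge1Dx _))// lerDr.
    have -> : 4 * normal_peak s * s ^+ 2 * n.+1%:R^-1 =
      2 * normal_peak s * s ^+ 2 * n.+1%:R^-1 + 2 * normal_peak s * s ^+ 2 * n.+1%:R^-1 by ring.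
    by rewrite (le_trans (ler_normB _ _))// lerD// qn ?normrN ?normr_nat.
  apply: norm_cvg0; apply: (@squeeze_cvgr _ _ _ _ (cst 0)
    (fun n => 4 * normal_peak s * s ^+ 2 * n.+1%:R^-1)).
  - by apply: nearW => n /=; rewrite normr_ge0/=.
  - exact: cvg_cst.
  rewrite -[X in _ --> X](mulr0 (4 * normal_peak s * s ^+ 2)).
  by apply: cvgM; [exact: cvg_cst|exact: cvg_harmonic].
have h0 : \int[mu]_x h x = 0.
  by rewrite /Rintegral -(cvg_lim _ cvgh)// (cvg_lim _ cvg0).
move: h0; rewrite /h RintegralB//; last 2 first.
  - exact: (integrableZl measurableT t icos).
  - exact: (integrableZr measurableT (s ^+ 2)^-1 isin).
rewrite RintegralZl// RintegralZr// => /eqP; rewrite subr_eq0 => /eqP E.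
by rewrite -mulrA E mulrC divfK// sqrf_eq0.
Unshelve. all: end_near. Qed.

Let F phi t := \int[mu]_x (cos (t * x + phi) * q x).

(** Differentiation under the integral, dominated by |x| q, followed by the integration by parts
    above: [F phi] solves a linear differential equation. *)
Let is_derive_F phi (t : R) : is_derive t (1 : R) (F phi) (- (s ^+ 2 * t * F phi t)).
Proof.
pose f (t x : R) := cos (t * x + phi) * q x.
have df t' x : is_derive t' (1 : R) (f ^~ x) (- (x * sin (t' * x + phi) * q x)).
  by apply: is_derive_eq; rewrite /GRing.scale/=; ring.
have mc (t' : R) : measurable_fun setT (fun x : R => cos (t' * x + phi)).
  apply: (@measurableT_comp _ _ _ _ _ _ (@cos R)).
    exact: continuous_measurable_fun (@continuous_cos R).
  by apply: measurable_funD => //; exact: measurable_funM.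
have I_t : `]t - 1, t + 1[%classic t by rewrite /= in_itv/= ltrBlDr ltrDl ltr01.
have f_int t' : `]t - 1, t + 1[%classic t' -> mu.-integrable setT (EFin \o f t').
  by move=> _; apply: integrable_bounded_normal_pdf => // x; exact: cos_max.
have f_der t' x : `]t - 1, t + 1[%classic t' -> setT x -> derivable (f ^~ x) t' 1.
  by move=> _ _; exact: ex_derive.
have G_ge0 (x : R) : 0 <= `|x| * q x by rewrite mulr_ge0 ?normal_pdf_ge0.
have G_ub t' x : `]t - 1, t + 1[%classic t' -> setT x ->
    `|partial1of2 f t' x| <= `|x| * q x.
  move=> _ _; rewrite partial1of2E derive_val normrN !normrM.
  by rewrite (ger0_norm (normal_pdf_ge0 _ _ _)) ler_wpM2r ?normal_pdf_ge0// ler_piMr// sin_max.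
have D := derivable_under_integral measurableT I_t f_int f_der G_ge0
  integrable_mul_normal_pdf G_ub.
have E := differentiation_under_integral measurableT I_t f_int f_der G_ge0
  integrable_mul_normal_pdf G_ub.
apply: DeriveDef => //; rewrite -derive1E E -integral_sin_normal_pdf.
rewrite -mulN1r -RintegralZl//.
  by apply: eq_Rintegral => x _; rewrite -/(partial1of2 f t x) partial1of2E derive_val mulN1r.
apply: (@le_integrable _ _ _ mu setT measurableT _ _ _ _ integrable_mul_normal_pdf).
  apply/measurable_EFinP/measurable_funM; last exact: measurable_normal_pdf.
  apply: measurable_funM => //.
  apply: (@measurableT_comp _ _ _ _ _ _ (@sin R)).
    exact: continuous_measurable_fun (@continuous_sin R).
  by apply: measurable_funD => //; exact: measurable_funM.
move=> x _; rewrite lee_fin !normrM normr_id.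
by rewrite ler_wpM2r// ler_piMr// sin_max.
Qed.

(** F times exp(t^2 s^2 / 2) has zero derivative, and its value at t = 0 is cos phi. *)
Lemma Rintegral_cos_normal_prob t phi :
  \int[normal_prob 0 s]_x cos (t * x + phi) = expR (- (t ^+ 2 * s ^+ 2 / 2)) * cos phi.
Proof.
have -> : \int[normal_prob 0 s]_x cos (t * x + phi) = F phi t.
  congr fine; apply: (@integral_normal_prob (fun x => cos (t * x + phi)) 1).
    apply: (@measurableT_comp _ _ _ _ _ _ (@cos R)).
      exact: continuous_measurable_fun (@continuous_cos R).
    by apply: measurable_funD => //; exact: measurable_funM.
  by move=> x; exact: cos_max.
pose g (t : R) := F phi t * expR (t ^+ 2 * s ^+ 2 / 2).
have dg (t' : R) : is_derive t' (1 : R) g 0.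
  have ? := is_derive_F phi t'.
  by apply: is_derive_eq; rewrite /GRing.scale/=; field.
have : g t = g 0 by exact: is_derive_0_is_cst.
rewrite /g expr0n/= !mul0r expR0 mulr1 => gE.
have <- : F phi 0 = cos phi.
  rewrite /F; under eq_Rintegral do rewrite mul0r add0r.
  rewrite RintegralZl//; last exact: integrable_normal_pdf.
  by rewrite /Rintegral integral_normal_pdf mulr1.
by rewrite -gE expRN mulrC mulfK// gt_eqF ?expR_gt0.
Qed.

End normal_characteristic_function.

Lemma Rintegral_cos_centered_normal (R : realType) (v t phi : R) : 0 <= v ->
  \int[centered_normal v]_x cos (t * x + phi) = expR (- (t ^+ 2 * v / 2)) * cos phi.
Proof.
rewrite /centered_normal; have [->|v0 v_ge0] := eqVneq v 0.
  rewrite /Rintegral integral_dirac//.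
    by rewrite diracT mul1e/= mulr0 mulr0 mul0r oppr0 expR0 mul1r add0r.
  apply/measurable_EFinP; apply: (@measurableT_comp _ _ _ _ _ _ (@cos R)).
    exact: continuous_measurable_fun (@continuous_cos R).
  by apply: measurable_funD => //; exact: measurable_funM.
by rewrite Rintegral_cos_normal_prob ?sqrtr_gt0 ?lt_def ?v0// sqr_sqrtr.
Qed.

(** * Uniform approximation by Bernstein polynomials *)

Section bernstein.
Context {R : realType}.
Implicit Types (phi psi : nat -> R) (u c : R).

(* The Bernstein sum [\sum_k phi k * 'C(N, k) * u ^+ k * (1 - u) ^+ (N - k)],
   in a form suited to induction on [N]. *)
Fixpoint bernstein (N : nat) phi u : R :=
  if N is N'.+1 then
    u * bernstein N' (phi \o S) u + (1 - u) * bernstein N' phi u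
  else phi 0%N.

Lemma le_bernstein N phi psi u : 0 <= u -> u <= 1 ->
  (forall k, (k <= N)%N -> phi k <= psi k) -> bernstein N phi u <= bernstein N psi u.
Proof.
move=> u0 u1; elim: N phi psi => [|N IH] phi psi le_phi_psi /=; first exact: le_phi_psi.
by rewrite lerD// ler_wpM2l ?subr_ge0 ?IH// => k kN; apply: le_phi_psi => //; exact: leqW.
Qed.

(** N u and N u (1 - u) are the mean and the variance of the binomial law. In the induction,
    composing with [S] amounts to moving the centre from c to c - 1. *)
Lemma bernstein_quadratic N (a b c u : R) :
  bernstein N (fun k => a + b * (k%:R - c) ^+ 2) u
  = a + b * (N%:R * (u * (1 - u)) + (N%:R * u - c) ^+ 2).
Proof.
elim: N c => [|N IH] c /=; first by ring.
rewrite (_ : _ \o S = fun k => a + b * (k%:R - (c - 1)) ^+ 2).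
  by rewrite !IH -natr1; ring.
by apply/funext => k /=; rewrite -natr1; congr (_ + _ * _ ^+ 2); ring.
Qed.

(** Heine's theorem by compactness. Only the first point is confined to the segment, which spares a
    membership check for the second one at each use. *)
Lemma unif_continuous_itv (g : R -> R) (a b e : R) : continuous g -> 0 < e ->
  exists2 d : R, 0 < d & forall x y, a <= x <= b -> `|x - y| < d -> `|g x - g y| < e.
Proof.
move=> cg e0; have /compact_near_coveringP := @segment_compact R a b.
move=> /(_ R 0^'+ (fun d x => forall y, `|x - y| < d -> `|g x - g y| < e)) [].
  move=> x xab; have e20 : 0 < e / 2 by rewrite divr_gt0.
  have /cvgrPdist_lt/(_ _ e20)[r /= r0 xr] := cg x.
  exists ([set z | `|x - z| < r / 2], [set d | d < r / 2]) => /=.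
    split; first by exists (r / 2) => //=; rewrite divr_gt0.
    exists (r / 2) => /=; first by rewrite divr_gt0.
    by move=> z /=; rewrite sub0r normrN => /ltr_normlW + _.
  move=> [z d] /= [xz dr] y zy.
  have xy : `|x - y| < r.
    rewrite (_ : x - y = (x - z) + (z - y)); last by ring.
    rewrite (le_lt_trans (ler_normD _ _))// [r]splitr ltrD//.
    exact: lt_trans zy dr.
  rewrite (_ : g z - g y = - (g x - g z) + (g x - g y)); last by ring.
  rewrite (le_lt_trans (ler_normD _ _))// normrN [e]splitr ltrD//; last exact: xr.
  by apply: xr => /=; rewrite (lt_trans xz)// ltr_pdivrMr// ltr_pMr// ltr1n.
move=> d /= d0 Hd; exists (d / 2); first by rewrite divr_gt0.
move=> x y xab xy.
have : `|x - y| < d / 2 by [].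
apply: (Hd (d / 2)) => //=.
- by rewrite sub0r normrN gtr0_norm ?divr_gt0// ltr_pdivrMr// ltr_pMr// ltr1n.
- by rewrite divr_gt0.
Qed.

(** Chebyshev's argument: where |u - k/N| >= d, the trivial bound 2M is at most 2M (|u - k/N| /
    d)^2. Thus g(k/N) lies between two quadratics in k, whose Bernstein sums are explicit, and
    monotonicity carries the sandwich over to the sums. *)
Lemma bernstein_approx (g : R -> R) (M e : R) :
  continuous g -> (forall x, `|g x| <= M) -> 0 < e ->
  exists N, forall u, 0 <= u -> u <= 1 ->
    `|g u - bernstein N (fun k => g (k%:R / N%:R)) u| <= e.
Proof.
move=> cg gM e0; have e20 : 0 < e / 2 by rewrite divr_gt0.
have [d d0 gd] := unif_continuous_itv 0 1 cg e20.
have M0 : 0 <= M by rewrite (le_trans _ (gM 0)).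
pose B := 2 * M / d ^+ 2.
have B0 : 0 <= B by rewrite divr_ge0 ?mulr_ge0 ?exprn_ge0// ltW.
(* This N makes the variance term at most B / N <= e / 2, uniformly in u. *)
exists (Num.truncn (B / (e / 2))).+1; set N := _.+1 => u u0 u1.
have N0 : 0 < N%:R :> R by rewrite ltr0n.
have NB : B / N%:R <= e / 2.
  rewrite ler_pdivrMr// mulrC -ler_pdivrMr//.
  have : 0 <= B / (e / 2) by rewrite divr_ge0// ltW.
  by move/truncn_itv => /andP[_ /ltW].
have main k : (k <= N)%N ->
    `|g u - g (k%:R / N%:R)| <= e / 2 + B / N%:R ^+ 2 * (k%:R - N%:R * u) ^+ 2.
  move=> kN.
  have -> : B / N%:R ^+ 2 * (k%:R - N%:R * u) ^+ 2
      = 2 * M * (`|u - k%:R / N%:R| / d) ^+ 2.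
    rewrite exprMn real_normK ?num_real// /B; field.
    by rewrite (gt_eqF d0) (gt_eqF N0).
  have [ud|du] := ltP `|u - k%:R / N%:R| d.
    rewrite (le_trans (ltW (gd _ _ _ ud))) ?u0 ?u1// lerDl.
    by rewrite mulr_ge0 ?sqr_ge0// mulr_ge0.
  rewrite (@le_trans _ _ (2 * M))//.
    by rewrite (le_trans (ler_normB _ _))// (_ : 2 * M = M + M) ?lerD//; ring.
  rewrite (@le_trans _ _ (2 * M * (`|u - k%:R / N%:R| / d) ^+ 2))//; last first.
    by rewrite lerDr ltW.
  by rewrite ler_peMr ?mulr_ge0// expr_ge1// ?divr_ge0 ?(ltW d0)// ler_pdivlMr ?mul1r.
(* [s] will be 1 for the upper quadratic and -1 for the lower one. Centring at N u removes the bias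
   and leaves only the binomial variance. *)
have bq s : bernstein N (fun k =>
    g u + s * (e / 2) + s * (B / N%:R ^+ 2) * (k%:R - N%:R * u) ^+ 2) u
    = g u + s * (e / 2 + B / N%:R * (u * (1 - u))).
  by rewrite bernstein_quadratic; field; rewrite gt_eqF.
have le_e : e / 2 + B / N%:R * (u * (1 - u)) <= e.
  have uu : u * (1 - u) <= 1 by nra.
  by rewrite [leRHS]splitr lerD2l (le_trans _ NB)// ler_piMr// divr_ge0// ltW.
rewrite ler_distlC; apply/andP; split.
  rewrite (@le_trans _ _ (g u + (-1) * (e / 2 + B / N%:R * (u * (1 - u)))))//.
    by rewrite mulN1r lerD2l lerN2.
  rewrite -bq le_bernstein// => k /main; rewrite ler_norml => /andP[_].
  rewrite !mulN1r mulNr; set X := B / _ * _; lra.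
rewrite (@le_trans _ _ (g u + 1 * (e / 2 + B / N%:R * (u * (1 - u)))))//; last first.
  by rewrite mul1r lerD2l.
rewrite -bq le_bernstein// => k /main; rewrite ler_norml => /andP[+ _].
by rewrite !mul1r; set X := B / _ * _; lra.
Qed.

End bernstein.

Section real_expectations.
Context d (T : measurableType d) (R : realType) (Pr : probability T R).
Implicit Types (h : T -> R) (A : set T).

(** Splits an expectation at an event: [a] is the accuracy off [A], and [b] is what is lost on [A],
    to be multiplied by a small probability. *)
Lemma norm_Rintegral_le h A (a b : R) : measurable_fun setT h -> measurable A ->
  0 <= b -> (forall x, `|h x| <= a + b * \1_A x) ->
  `|\int[Pr]_x h x| <= a + b * fine (Pr A).
Proof.
move=> mh mA b0 hab.
have hb x : `|h x| <= a + b.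
  by rewrite (le_trans (hab x))// lerD2l ler_piMr// indicE lern1 leq_b1.
have ih := bounded_integrable Pr mh hb.
rewrite (le_trans (le_normr_Rintegral _ ih))//.
have ib : Pr.-integrable setT (EFin \o (fun x => b * \1_A x)).
  apply: (@bounded_integrable _ _ _ Pr _ b); first exact: measurable_funM.
  by move=> x; rewrite normrM !ger0_norm// ler_piMr// indicE lern1 leq_b1.
have ia : Pr.-integrable setT (EFin \o (fun=> a)).
  by apply: (@bounded_integrable _ _ _ Pr _ `|a|).
have iA : Pr.-integrable setT (EFin \o (\1_A : T -> R)).
  apply: (@bounded_integrable _ _ _ Pr _ 1) => // x.
  by rewrite ger0_norm// indicE lern1 leq_b1.
apply: le_trans (le_Rintegral (f2 := fun x => a + b * \1_A x) _ _ _ _) _ => //.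
- exact: integrable_norm.
- exact: (@integrableD _ _ _ Pr setT _ (EFin \o (fun=> a)) (EFin \o (fun x => b * \1_A x))).
- rewrite RintegralD// Rintegral_cst// RintegralZl//.
  have -> : fine (Pr setT) = 1 by have -> := @probability_setT _ _ _ Pr.
  by rewrite mulr1 /Rintegral integral_indic// setIT.
Qed.

End real_expectations.

(** * From convergence of cosine means to convergence in distribution *)

Section levy_continuity.
Context d (Omega : measurableType d) (R : realType) (Pr : probability Omega R).
Variables (Y : nat -> Omega -> R) (mu : probability (measurableTypeR R) R).
Hypothesis mY : forall n, measurable_fun setT (Y n).
Hypothesis cvg_cos : forall t phi : R,
  \int[Pr]_w cos (t * Y n w + phi) @[n --> \oo] --> \int[mu]_x cos (t * x + phi).
Hypothesis tightY : forall e : R, 0 < e -> exists K : R,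
  \forall n \near \oo, fine (Pr [set w | K < `|Y n w|]) <= e.

Let mcos (t phi : R) : measurable_fun setT (fun x : R => cos (t * x + phi)).
Proof.
apply: (@measurableT_comp _ _ _ _ _ _ (@cos R)).
  exact: continuous_measurable_fun (@continuous_cos R).
by apply: measurable_funD => //; exact: measurable_funM.
Qed.

(** Requiring convergence against every cosine, and not only of the means of [h], makes the class
    stable under multiplication by sin(c x). Trigonometric polynomials are then reached by
    induction, without writing out their coefficients. *)
Definition cvg_against_cos (h : R -> R) :=
  [/\ measurable_fun setT h, exists M, forall x, `|h x| <= M &
    forall t phi, \int[Pr]_w (h (Y n w) * cos (t * Y n w + phi)) @[n --> \oo]
      --> \int[mu]_x (h x * cos (t * x + phi))].

Let bnd_int d' (T : measurableType d') (P : probability T R) (Z : T -> R) (h : R -> R)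
    (t phi : R) : measurable_fun setT Z -> measurable_fun setT h ->
  (exists M, forall x, `|h x| <= M) ->
  P.-integrable setT (EFin \o (fun w => h (Z w) * cos (t * Z w + phi))).
Proof.
move=> mZ mh [M hM].
apply: (@bounded_integrable _ _ _ P _ M).
  apply: (measurableT_comp (f := fun x => h x * cos (t * x + phi))) => //.
  exact: measurable_funM.
by move=> w; rewrite normrM (le_trans _ (hM (Z w)))// ler_piMr// cos_max.
Qed.

Lemma cvg_against_cosD h1 h2 : cvg_against_cos h1 -> cvg_against_cos h2 ->
  cvg_against_cos (fun x => h1 x + h2 x).
Proof.
move=> [m1 b1 c1] [m2 b2 c2]; split.
- exact: measurable_funD.
- case: b1 b2 => [M1 hM1] [M2 hM2]; exists (M1 + M2) => x.
  by rewrite (le_trans (ler_normD _ _))// lerD.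
- move=> t phi.
  have E d' (T : measurableType d') (P : probability T R) (Z : T -> R) :
      measurable_fun setT Z ->
      \int[P]_w ((h1 (Z w) + h2 (Z w)) * cos (t * Z w + phi)) =
      \int[P]_w (h1 (Z w) * cos (t * Z w + phi)) +
      \int[P]_w (h2 (Z w) * cos (t * Z w + phi)).
    move=> mZ; rewrite -RintegralD//; [|exact: bnd_int..].
    by apply: eq_Rintegral => w _; rewrite mulrDl.
  under eq_fun do rewrite E//.
  by rewrite (E _ _ mu id)//; exact: cvgD.
Qed.

Lemma cvg_against_cosZ a h : cvg_against_cos h -> cvg_against_cos (fun x => a * h x).
Proof.
move=> [m1 b1 c1]; split.
- exact: measurable_funM.
- case: b1 => [M hM]; exists (`|a| * M) => x.
  by rewrite normrM ler_wpM2l.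
- move=> t phi.
  have E d' (T : measurableType d') (P : probability T R) (Z : T -> R) :
      measurable_fun setT Z ->
      \int[P]_w (a * h (Z w) * cos (t * Z w + phi)) =
      a * \int[P]_w (h (Z w) * cos (t * Z w + phi)).
    move=> mZ; rewrite -RintegralZl//; last exact: bnd_int.
    by apply: eq_Rintegral => w _; rewrite mulrA.
  under eq_fun do rewrite E//.
  rewrite (E _ _ mu id)//.
  by apply: cvgM => //; exact: cvg_cst.
Qed.

(** Product-to-sum formula: sin(c x) cos(t x + phi) is half the sum of two sines, of frequencies c +
    t and c - t, each rewritten as a cosine with phase shifted by pi/2. *)
Lemma cvg_against_cos_sin c h : cvg_against_cos h ->
  cvg_against_cos (fun x => sin (c * x) * h x).
Proof.
move=> [m1 b1 c1].
have sinE x : sin (c * x) = cos (c * x + - (pi / 2)) by rewrite cosBpihalf.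
split.
- apply: measurable_funM => //; rewrite (_ : (fun x => _) = fun x => cos (c * x + - (pi / 2)))//.
  exact/funext.
- case: b1 => [M hM]; exists M => x.
  by rewrite normrM (le_trans _ (hM x))// ler_piMl// sin_max.
- move=> t phi.
  have E x : sin (c * x) * h x * cos (t * x + phi) =
      2^-1 * (h x * cos ((c + t) * x + (phi - pi / 2))) +
      2^-1 * (h x * cos ((c - t) * x + (- phi - pi / 2))).
    rewrite !addrA !cosBpihalf mulrDl mulrBl -addrA.
    have -> : c * x - t * x - phi = c * x - (t * x + phi) by ring.
    by rewrite sinD sinB; field.
  have {}E d' (T : measurableType d') (P : probability T R) (Z : T -> R) :
      measurable_fun setT Z ->
      \int[P]_w (sin (c * Z w) * h (Z w) * cos (t * Z w + phi)) =
      2^-1 * \int[P]_w (h (Z w) * cos ((c + t) * Z w + (phi - pi / 2))) +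
      2^-1 * \int[P]_w (h (Z w) * cos ((c - t) * Z w + (- phi - pi / 2))).
    move=> mZ.
    have i1 := bnd_int P (c + t) (phi - pi / 2) mZ m1 b1.
    have i2 := bnd_int P (c - t) (- phi - pi / 2) mZ m1 b1.
    rewrite -!RintegralZl// -RintegralD//; first last.
    - exact: (integrableZl measurableT 2^-1 i2).
    - exact: (integrableZl measurableT 2^-1 i1).
    by apply: eq_Rintegral => w _; rewrite E.
  under eq_fun do rewrite E//.
  rewrite (E _ _ mu id)//.
  by apply: cvgD; apply: cvgM => //; exact: cvg_cst.
Qed.

(** The recursion multiplies by u and 1 - u, which are affine in sin(c x) for u = (1 + sin(c x)) /
    2. *)
Lemma cvg_against_cos_bernstein N phi c :
  cvg_against_cos (fun x => bernstein N phi ((1 + sin (c * x)) / 2)).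
Proof.
elim: N phi => [|N IH] phi /=.
  rewrite (_ : (fun=> _) = (fun x => phi 0%N * 1)); last by apply/funext => x; rewrite mulr1.
  apply: cvg_against_cosZ; split => //; first by exists 1 => x; rewrite normr1.
  move=> t psi.
  under eq_fun do under eq_Rintegral do rewrite mul1r.
  by under eq_Rintegral do rewrite mul1r; exact: cvg_cos.
set B1 := bernstein N (phi \o S); set B2 := bernstein N phi.
rewrite (_ : (fun x => _) = fun x =>
    (2^-1 * (B1 ((1 + sin (c * x)) / 2)) + 2^-1 * (sin (c * x) * (B1 ((1 + sin (c * x)) / 2)))) +
    (2^-1 * (B2 ((1 + sin (c * x)) / 2)) + (- 2^-1) * (sin (c * x) * (B2 ((1 + sin (c * x)) / 2))))).
  by do !apply: cvg_against_cosD; apply: cvg_against_cosZ;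
    [exact: IH|exact/cvg_against_cos_sin/IH|exact: IH|exact/cvg_against_cos_sin/IH].
by apply/funext => x; field.
Qed.

Lemma trig_approx (g : R -> R) (M K e : R) :
  continuous g -> (forall x, `|g x| <= M) -> 0 < e ->
  exists h, [/\ cvg_against_cos h, forall x, `|h x| <= M &
    forall x, `|x| <= K -> `|g x - h x| <= e].
Proof.
move=> cg gM e0; have e20 : 0 < e / 2 by rewrite divr_gt0.
have [r r0 gr] := unif_continuous_itv (- K) K cg e20.
(* Chosen so that |x - sin(c x) / c| <= c^2 |x|^3 <= c |K|^3 < r for |x| <= K; the bound c <= 1
   absorbs one factor c. *)
pose c := Num.min 1 (r / (2 * (1 + `|K| ^+ 3))).
have c0 : 0 < c by rewrite lt_min ltr01 divr_gt0.
(* At u = (1 + sin(c x)) / 2 the approximated function takes the value g(sin(c x) / c). *)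
have [N BN] := @bernstein_approx R (fun u => g ((2 * u - 1) / c)) M _
  ltac:(move=> u; apply: continuous_comp; [|exact: cg];
        apply: cvgM; [apply: cvgB; [apply: cvgM; [exact: cvg_cst|exact: cvg_id]|
        exact: cvg_cst]|exact: cvg_cst]) (fun u => gM _) e20.
have u01 (x : R) : 0 <= (1 + sin (c * x)) / 2 <= 1.
  by have := sin_geN1 (c * x); have := sin_le1 (c * x); lra.
exists (fun x => bernstein N (fun k => g ((2 * (k%:R / N%:R) - 1) / c))
  ((1 + sin (c * x)) / 2)); split.
- exact: cvg_against_cos_bernstein.
- move=> x; have /andP[u0 u1] := u01 x.
  (* Bernstein sums reproduce constants, so by monotonicity they inherit the bound [M] of [g]. *)
  have cstE b : bernstein N (fun=> b) ((1 + sin (c * x)) / 2) = b.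
    rewrite (_ : (fun=> b) = fun k => b + 0 * (k%:R - 0) ^+ 2).
      by rewrite bernstein_quadratic mul0r addr0.
    by apply/funext => k; rewrite mul0r addr0.
  rewrite ler_norml -[X in X <= _](cstE (- M)) -[X in _ && (_ <= X)](cstE M);
    apply/andP; split;
    by apply: le_bernstein => // k _; have := gM ((2 * (k%:R / N%:R) - 1) / c);
      rewrite ler_norml => /andP[].
- move=> x xK; have /andP[u0 u1] := u01 x.
  have := BN _ u0 u1; rewrite [2 * _]mulrC divfK ?pnatr_eq0// [1 + _]addrC addrK.
  set B := bernstein _ _ _ => gB.
  rewrite -[_ - _](subrKA (g (sin (c * x) / c))) (le_trans (ler_normD _ _))//.
  rewrite [leRHS]splitr lerD//; apply/ltW/gr; first by rewrite -ler_norml.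
  have -> : x - sin (c * x) / c = - (sin (c * x) - c * x) / c by field; rewrite gt_eqF.
  rewrite normrM normrN normfV (gtr0_norm c0) ltr_pdivrMr//.
  rewrite (le_lt_trans (sin_taylor1 _))// normrM (gtr0_norm c0) exprMn.
  rewrite (@le_lt_trans _ _ (c * (c * `|K| ^+ 3)))//.
    rewrite exprS expr2 -!mulrA ler_wpM2l ?(ltW c0)// ler_wpM2l ?(ltW c0)//.
    rewrite (@le_trans _ _ (1 * `|x| ^+ 3))//.
      by rewrite ler_wpM2r ?exprn_ge0// ge_min lexx.
    by rewrite mul1r lerXn2r ?nnegrE// (le_trans xK)// ler_norm.
  rewrite [ltRHS]mulrC ltr_pM2l//.
  rewrite (@le_lt_trans _ _ (c * (1 + `|K| ^+ 3)))//.
    by rewrite ler_wpM2l ?(ltW c0)// lerDr.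
  rewrite (@le_lt_trans _ _ (r / 2))//; last by rewrite ltr_pdivrMr// ltr_pMr// ltr1n.
  rewrite -ler_pdivlMr ?ltr_pwDl ?exprn_ge0//.
  by rewrite ge_min; apply/orP; right; rewrite invfM mulrA.
Qed.

(** Continuity from above along the events n < |Z|, whose intersection is empty. *)
Lemma tight_probability d' (T : measurableType d') (P : probability T R) (Z : T -> R) e :
  measurable_fun setT Z -> 0 < e ->
  exists2 K, 0 <= K & fine (P [set w | K < `|Z w|]) <= e.
Proof.
move=> mZ e0; pose F n := [set w | n%:R < `|Z w|].
have mF n : measurable (F n).
  rewrite -[F n]setTI; apply: (measurable_fun_ltr (f := fun=> n%:R)) => //.
  exact: measurableT_comp.
have F0 : \bigcap_n F n = set0.
  rewrite -subset0 => w Fw; have : `|Z w| < (Num.truncn `|Z w|).+1%:R.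
    by have /andP[_] := truncn_itv (normr_ge0 (Z w)).
  by move=> /(lt_trans (Fw (Num.truncn `|Z w|).+1 I)); rewrite ltxx.
have := @nonincreasing_cvg_mu _ _ _ P F.
rewrite F0 measure0 => /(_ _ mF measurable0) cF.
have {}cF : (P \o F) n @[n --> \oo] --> 0%E.
  apply: cF.
    by rewrite (le_lt_trans (probability_le1 _ (mF 0%N)))// ltry.
  move=> m n mn; apply/subsetPset => w /=; apply: le_lt_trans.
  by rewrite ler_nat.
have /fine_cvgP[_ /cvgr0_norm_le/(_ _ e0)[n _ Hn]] := cF.
exists n%:R => //; rewrite (le_trans (ler_norm _))//; exact: (Hn n (leqnn n)).
Qed.

Theorem cos_cvg_in_distribution : cvg_in_distribution Pr Y mu.
Proof.
split=> // g cg [M gM].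
have M0 : 0 <= M by rewrite (le_trans _ (gM 0)).
have mg : measurable_fun setT g by exact: continuous_measurable_fun.
have mgZ d' (T : measurableType d') (Z : T -> R) (h : R -> R) :
  measurable_fun setT Z -> measurable_fun setT h -> measurable_fun setT (h \o Z).
  by move=> mZ mh; exact: measurableT_comp.
have ig d' (T : measurableType d') (P : probability T R) (Z : T -> R) (h : R -> R) :
    measurable_fun setT Z -> measurable_fun setT h -> (forall x, `|h x| <= M) ->
    P.-integrable setT (EFin \o (h \o Z)).
  by move=> mZ mh hM; apply: (@bounded_integrable _ _ _ P _ M) => [|w]; [exact: mgZ|exact: hM].
suff : \int[Pr]_w g (Y n w) @[n --> \oo] --> \int[mu]_x g x.
  have E d' (T : measurableType d') (P : probability T R) (Z : T -> R) :
      measurable_fun setT Z ->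
      (\int[P]_w (g (Z w))%:E)%E = (\int[P]_w g (Z w))%:E.
    move=> mZ; rewrite /Rintegral fineK//.
    by apply: integrable_fin_num => //; exact: (ig _ _ _ _ g).
  move=> cvg_g; under eq_fun do rewrite E//.
  by rewrite (E _ _ mu id)//; apply: cvg_EFin; [exact: nearW|exact: cvg_g].
apply/cvgrPdist_le => e e0.
(* Two truncation errors e1 + 2 M e1 and one error e1 for the means of [h] add up to (3 + 4 M)
   e1. *)
pose e1 := e / (5 + 4 * M).
have e10 : 0 < e1 by rewrite divr_gt0// ltr_pwDl// mulr_ge0.
have [K1 tK1] := tightY e10.
have [K2 _ tK2] := tight_probability mu (@measurable_id _ _ setT) e10.
have [h [[mh _ ch] hM gh]] := trig_approx (Num.max K1 K2) cg gM e10.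
have approx d' (T : measurableType d') (P : probability T R) (Z : T -> R) K :
    measurable_fun setT Z -> K <= Num.max K1 K2 -> fine (P [set w | K < `|Z w|]) <= e1 ->
    `|\int[P]_w g (Z w) - \int[P]_w h (Z w)| <= e1 + 2 * M * e1.
  move=> mZ KK PK.
  have mA : measurable [set w | K < `|Z w|].
    rewrite -[X in measurable X]setTI; apply: (measurable_fun_ltr (f := fun=> K)) => //.
    exact: measurableT_comp.
  rewrite -RintegralB//; [|exact: (ig _ _ _ _ g)|exact: (ig _ _ _ _ h)].
  apply: le_trans (@norm_Rintegral_le _ _ _ P _ _ e1 (2 * M) _ mA _ _) _ => //.
  - by apply: measurable_funB; [exact: (mgZ _ _ _ g)|exact: (mgZ _ _ _ h)].
  - by rewrite mulr_ge0.
  - move=> w; rewrite indicE; case: (boolP (w \in _)) => wA.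
      rewrite mulr1 (@le_trans _ _ (2 * M))//; last by rewrite lerDr ltW.
      by rewrite (le_trans (ler_normB _ _))// (_ : 2 * M = M + M) ?lerD//; ring.
    rewrite mulr0 addr0 gh// (le_trans _ KK)// leNgt.
    by apply: contra wA => ?; rewrite inE.
  - by rewrite lerD2l ler_wpM2l// mulr_ge0.
have /cvgrPdist_le/(_ _ e10) := ch 0 0.
have E d' (T : measurableType d') (P : probability T R) (Z : T -> R) :
    \int[P]_w (h (Z w) * cos (0 * Z w + 0)) = \int[P]_w h (Z w).
  by apply: eq_Rintegral => w _; rewrite mul0r addr0 cos0 mulr1.
move=> ch0; near=> n.
have A1 := approx _ _ mu id K2 (@measurable_id _ _ setT) _ tK2.
have A2 := approx _ _ Pr (Y n) K1 (mY n) _ _.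
have A3 : `|\int[mu]_x h x - \int[Pr]_w h (Y n w)| <= e1.
  by rewrite -(E _ _ Pr (Y n)) -(E _ _ mu id); near: n.
rewrite (_ : _ - _ = (\int[mu]_x g x - \int[mu]_x h x) +
   (\int[mu]_x h x - \int[Pr]_w h (Y n w)) -
   (\int[Pr]_w g (Y n w) - \int[Pr]_w h (Y n w))); last by ring.
rewrite (le_trans (ler_normB _ _))// (le_trans (lerD (ler_normD _ _) (lexx _)))//.
rewrite (@le_trans _ _ ((e1 + 2 * M * e1) + e1 + (e1 + 2 * M * e1)))//.
  apply: lerD; [apply: lerD => //; apply: A1|apply: A2]; rewrite ?le_max ?lexx ?orbT//.
  by near: n.
have -> : e = e1 * (5 + 4 * M).
  by rewrite /e1 divfK// gt_eqF// ltr_pwDl// mulr_ge0.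
nra.
Unshelve. all: by end_near. Qed.

End levy_continuity.

(** * Disintegration of a joint law along a kernel *)

Section graph_kernel.
Context d d' (T : measurableType d) (X : measurableType d') (R : realType).
Variable K : R.-pker T ~> X.

(* The kernel [(_, w) |-> delta_w \x K w]; the unused first argument is imposed
   by the library's composition of kernels. *)
Definition graph_kernel (uw : unit * T) (A : set (T * X)) : \bar R :=
  K uw.2 (xsection A uw.2).

Let gk0 uw : graph_kernel uw set0 = 0%E.
Proof. by rewrite /graph_kernel xsection0 measure0. Qed.

Let gk_ge0 uw A : (0 <= graph_kernel uw A)%E.
Proof. exact: measure_ge0. Qed.

Let gk_sigma uw : semi_sigma_additive (graph_kernel uw).
Proof.
move=> F mF tF mUF; rewrite /graph_kernel xsection_bigcup.
apply: measure_semi_sigma_additive.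
- by move=> n; exact: measurable_xsection.
- exact: trivIset_xsection.
- by apply: bigcup_measurable => n _; exact: measurable_xsection.
Qed.

HB.instance Definition _ uw := isMeasure.Build _ _ _ (graph_kernel uw)
  (gk0 uw) (gk_ge0 uw) (@gk_sigma uw).

Definition mgraph_kernel : unit * T -> {measure set (T * X) -> \bar R} := graph_kernel.

Let mgk A : measurable A -> measurable_fun setT (mgraph_kernel ^~ A).
Proof.
move=> mA; apply: (measurableT_comp (f := fun w => K w (xsection A w))) => //.
by apply: measurable_fun_xsection_finite_kernel; rewrite inE.
Qed.

HB.instance Definition _ := isKernel.Build _ _ _ _ _ mgraph_kernel mgk.

Let gk_prob uw : mgraph_kernel uw setT = 1%E.
Proof.
rewrite /mgraph_kernel/= /graph_kernel xsectionE.
by rewrite (_ : _ @^-1` setT = setT)// prob_kernel.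
Qed.

HB.instance Definition _ := Kernel_isProbability.Build _ _ _ _ _ mgraph_kernel gk_prob.

End graph_kernel.

Lemma kernel_bounded_integrable d d' (T : measurableType d) (X : measurableType d')
    (R : realType) (K : R.-fker T ~> X) w (h : X -> R) M :
  measurable_fun setT h -> (forall x, `|h x| <= M) ->
  (K w).-integrable setT (EFin \o h).
Proof.
move=> mh hM; apply: measurable_bounded_integrable => //.
  exact/fin_num_fun_lty/finite_kernel_measure.
exists M; split; first exact: num_real.
by move=> N MN x _; apply: le_trans (hM x) _; exact: ltW.
Qed.

Lemma measurable_Rintegral_kernel d d' (T : measurableType d) (X : measurableType d')
    (R : realType) (K : R.-fker T ~> X) (G : T * X -> R) :
  measurable_fun setT G -> measurable_fun setT (fun w => \int[K w]_y G (w, y)).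
Proof.
move=> mG; apply: (measurableT_comp (f := fine) (g := fun w => \int[K w]_y (G (w, y))%:E)%E) => //.
rewrite (_ : (fun w => _) = fun w => (\int[K w]_y (EFin \o G)^\+ (w, y) -
    \int[K w]_y (EFin \o G)^\- (w, y))%E); last first.
  apply/funext => w; rewrite (integralE _ _ (fun y => (G (w, y))%:E)).
  by congr (_ - _)%E; apply: eq_integral => y _; rewrite ?funeposE ?funenegE.
have mG' : measurable_fun setT (EFin \o G) by exact/measurable_EFinP.
apply: emeasurable_funB.
- exact: (measurable_fun_integral_finite_kernel _ K (fun=> funepos_ge0 _ _)
    (measurable_funepos mG')).
- exact: (measurable_fun_integral_finite_kernel _ K (fun=> funeneg_ge0 _ _)
    (measurable_funeneg mG')).
Qed.

Section disintegration.
Context dO dT dX (Omega : measurableType dO) (T : measurableType dT)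
  (X : measurableType dX) (R : realType) (Pr : probability Omega R).
Variables (I : Omega -> T) (Z : Omega -> X) (K : R.-pker T ~> X).
Hypotheses (mI : measurable_fun setT I) (mZ : measurable_fun setT Z).
Hypothesis rectangles : forall A B, measurable A -> measurable B ->
  (Pr (I @^-1` A `&` Z @^-1` B) = \int[Pr]_(w in I @^-1` A) K (I w) B)%E.

Let mI_mixin := isMeasurableFun.Build _ _ _ _ _ mI.
Let I_pack : {mfun Omega >-> T} := HB.pack I mI_mixin.

Let PI : pprobability T R := distribution Pr I_pack.

Let mIZ : measurable_fun setT (fun w => (I w, Z w)).
Proof. exact: measurable_fun_pair. Qed.
Let mIZ_mixin := isMeasurableFun.Build _ _ _ _ _ mIZ.
Let IZ : {mfun Omega >-> (T * X)%type} := HB.pack (fun w => (I w, Z w)) mIZ_mixin.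

(** The candidate for the joint law: the law of [I], seen as a constant kernel on [unit], followed
    by the graph kernel of [K]. *)
Let l := kprobability (@measurable_cst _ _ unit _ setT PI).
Let m2 := mkcomp l (mgraph_kernel K) tt.

Let integral_l (h : T -> \bar R) : measurable_fun setT h -> (forall w, 0 <= h w)%E ->
  (\int[l tt]_w h w = \int[Pr]_w h (I w))%E.
Proof.
move=> mh h0.
rewrite [LHS](_ : _ = \int[pushforward Pr I_pack]_w h w)%E//.
by rewrite ge0_integral_pushforward.
Qed.

Let m2E A : measurable A -> (m2 A = \int[Pr]_w K (I w) (xsection A (I w)))%E.
Proof.
move=> mA; rewrite /m2 /= /kcomp.
apply: (integral_l (h := fun w => mgraph_kernel K (tt, w) A)) => //.
have := measurable_kernel (mgraph_kernel K) A mA => mk.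
exact: (measurableT_comp mk).
Qed.

(** Both measures agree on measurable rectangles, a pi-system that generates the product
    sigma-algebra. *)
Let distributionE A : measurable A -> distribution Pr IZ A = m2 A.
Proof.
apply: (measure_unique [set A `*` B | A in measurable & B in measurable] (fun=> setT)).
- by rewrite measurable_prod_measurableType.
- move=> _ _ [X1 mX1 [X2 mX2 <-]] [Y1 mY1 [Y2 mY2 <-]].
  exists (X1 `&` Y1); first exact: measurableI.
  by exists (X2 `&` Y2); [exact: measurableI|rewrite setXI].
- by move=> n; exists setT => //; exists setT => //; rewrite setXTT.
- by rewrite bigcup_const.
- move=> _ [A' mA' [B mB <-]]; rewrite m2E; last exact: measurableX.
  rewrite -[LHS]/(Pr (I @^-1` A' `&` Z @^-1` B)) rectangles//.
  rewrite integral_mkcond; apply: eq_integral => w _.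
  rewrite patchE; case: ifPn => wA; rewrite ?inE in wA.
    by rewrite in_xsectionX// inE.
  by rewrite notin_xsectionX ?measure0//; apply: contra wA; rewrite !inE.
- by move=> n; rewrite (le_lt_trans (probability_le1 _ measurableT))// ltry.
Qed.

(** The tower property for functions of the pair. For nonnegative [G] no integrability is required,
    which allows second moments to be computed before they are known to be finite. *)
Lemma ge0_integral_disintegration (G : T * X -> \bar R) :
  measurable_fun setT G -> (forall z, 0 <= G z)%E ->
  (\int[Pr]_w G (I w, Z w) = \int[Pr]_w \int[K (I w)]_y G (I w, y))%E.
Proof.
move=> mG G0.
transitivity (\int[pushforward Pr IZ]_z G z)%E.
  by rewrite ge0_integral_pushforward.
transitivity (\int[m2]_z G z)%E.
  by apply: eq_measure_integral => A mA _; exact: distributionE.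
rewrite integral_kcomp//.
have GE w : (\int[mgraph_kernel K (tt, w)]_z G z = \int[K w]_y G (w, y))%E.
  have mp : measurable_fun setT (fun y : X => (w, y)) by exact: measurable_pair1.
  pose p_mixin := isMeasurableFun.Build _ _ _ _ _ mp.
  pose p : {mfun X >-> (T * X)%type} := HB.pack (fun y : X => (w, y)) p_mixin.
  transitivity (\int[pushforward (K w) p]_z G z)%E.
    apply: eq_measure_integral => A mA _.
    by rewrite /= /mgraph_kernel /graph_kernel /pushforward xsectionE.
  by rewrite ge0_integral_pushforward.
under eq_integral do rewrite GE.
apply: integral_l => [|w]; last by apply: integral_ge0.
exact: measurable_fun_integral_finite_kernel.
Qed.

(** Adding [M] reduces to the nonnegative case, and all integrals are finite when [M] is taken off
    again. *)
Lemma Rintegral_disintegration (G : T * X -> R) M :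
  measurable_fun setT G -> (forall z, `|G z| <= M) ->
  \int[Pr]_w G (I w, Z w) = \int[Pr]_w \int[K (I w)]_y G (I w, y).
Proof.
move=> mG GM; pose H z := G z + M.
have mH : measurable_fun setT H by exact: measurable_funD.
have H0 z : 0 <= H z by have := GM z; rewrite ler_norml /H => /andP[]; lra.
have iG w : (K w).-integrable setT (EFin \o (fun y => G (w, y))).
  apply: (@kernel_bounded_integrable _ _ _ _ _ K w _ M) => //.
  by apply: (measurableT_comp mG); exact: measurable_pair1.
have HE w : (\int[K w]_y (H (w, y))%:E)%E = (\int[K w]_y G (w, y) + M)%:E.
  rewrite /H; under eq_integral do rewrite EFinD.
  rewrite integralD//; last by apply: (@kernel_bounded_integrable _ _ _ _ _ K w (cst M) `|M|).
  rewrite integral_cst// prob_kernel mule1 EFinD /Rintegral fineK//.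
  exact: integrable_fin_num.
have GIZ : Pr.-integrable setT (EFin \o (fun w => G (I w, Z w))).
  by apply: (@bounded_integrable _ _ _ Pr _ M) => //; exact: (measurableT_comp mG).
have GIK : Pr.-integrable setT (EFin \o (fun w => \int[K (I w)]_y G (I w, y))).
  apply: (@bounded_integrable _ _ _ Pr _ M).
    by apply: (measurableT_comp (f := fun w => \int[K w]_y G (w, y))) => //; exact: measurable_Rintegral_kernel.
  move=> w; rewrite (le_trans (le_normr_Rintegral _ (iG _)))//.
  have K1 : fine (K (I w) setT) = 1 by rewrite prob_kernel.
  rewrite -[leRHS]mulr1 -K1 -Rintegral_cst//.
  apply: le_Rintegral => //; first exact: integrable_norm.
  by apply: (@kernel_bounded_integrable _ _ _ _ _ K _ (cst M) `|M|).
have iM : Pr.-integrable setT (EFin \o (fun=> M)).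
  by apply: (@bounded_integrable _ _ _ Pr (cst M) `|M|).
have : \int[Pr]_w H (I w, Z w) = \int[Pr]_w (\int[K (I w)]_y G (I w, y) + M).
  congr fine; rewrite (ge0_integral_disintegration (G := EFin \o H))//.
  - by apply: eq_integral => w _; exact: HE.
  - exact/measurable_EFinP.
by rewrite !RintegralD// => /addIr.
Qed.

End disintegration.

(** * Real-valued probabilities and events of vanishing probability *)

Section fine_probability.
Context d (T : measurableType d) (R : realType) (Pr : probability T R).
Implicit Types (A B : set T).

Lemma fine_probability_le A B : measurable A -> measurable B -> A `<=` B ->
  fine (Pr A) <= fine (Pr B).
Proof.
move=> mA mB AB; apply: fine_le; rewrite ?fin_num_measure//.
by apply: le_measure => //; rewrite inE.
Qed.

Lemma fine_probabilityU_le A B : measurable A -> measurable B ->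
  fine (Pr (A `|` B)) <= fine (Pr A) + fine (Pr B).
Proof.
move=> mA mB; rewrite -fineD ?fin_num_measure//.
apply: fine_le; rewrite ?fin_numD ?fin_num_measure//; first exact: measurableU.
exact: measureU2.
Qed.

Lemma cvg0_probability_near (A : nat -> set T) (e : R) :
  Pr (A n) @[n --> \oo] --> 0%E -> 0 < e -> \forall n \near \oo, fine (Pr (A n)) <= e.
Proof.
move=> /fine_cvgP[_ /cvgr0_norm_le/[apply]] A0.
by near do rewrite (le_trans (ler_norm _))//.
Unshelve. all: by end_near. Qed.

Lemma near_cvg0_probability (A : nat -> set T) : (forall n, measurable (A n)) ->
  (forall e : R, 0 < e -> \forall n \near \oo, fine (Pr (A n)) <= e) ->
  Pr (A n) @[n --> \oo] --> 0%E.
Proof.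
move=> mA A0; apply: cvg_EFin.
  by apply: nearW => n; rewrite fin_num_measure.
apply/cvgr0Pnorm_le => e /A0; apply: filterS => n.
by rewrite /= ger0_norm// fine_ge0.
Qed.

Lemma cvg0_probability_subset (A B : nat -> set T) :
  (forall n, measurable (A n)) -> (forall n, measurable (B n)) ->
  (\forall n \near \oo, A n `<=` B n) ->
  Pr (B n) @[n --> \oo] --> 0%E -> Pr (A n) @[n --> \oo] --> 0%E.
Proof.
move=> mA mB AB B0; apply: near_cvg0_probability => // e e0.
have Be := cvg0_probability_near B0 e0.
near=> n; rewrite (@le_trans _ _ (fine (Pr (B n))))//; last by near: n.
by apply: fine_probability_le => //; near: n.
Unshelve. all: by end_near. Qed.

Lemma cvg0_probabilityU (A B : nat -> set T) :
  (forall n, measurable (A n)) -> (forall n, measurable (B n)) ->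
  Pr (A n) @[n --> \oo] --> 0%E -> Pr (B n) @[n --> \oo] --> 0%E ->
  Pr (A n `|` B n) @[n --> \oo] --> 0%E.
Proof.
move=> mA mB A0 B0; apply: near_cvg0_probability => [n|e e0]; first exact: measurableU.
have e20 : 0 < e / 2 by rewrite divr_gt0.
have Ae := cvg0_probability_near A0 e20; have Be := cvg0_probability_near B0 e20.
near=> n; rewrite (le_trans (fine_probabilityU_le _ _))// [leRHS]splitr.
by apply: lerD; near: n.
Unshelve. all: by end_near. Qed.

Lemma measurable_ge_norm (h : T -> R) (e : R) :
  measurable_fun setT h -> measurable [set w | e <= `|h w|].
Proof.
move=> mh; rewrite -[X in measurable X]setTI.
by apply: (measurable_fun_ler (f := fun=> e)) => //; exact: measurableT_comp.
Qed.

Lemma chebyshev_sqr (h : T -> R) (s L : R) : measurable_fun setT h -> 0 < L ->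
  (\int[Pr]_w (h w ^+ 2)%:E <= s%:E)%E -> fine (Pr [set w | L <= `|h w|]) <= s / L ^+ 2.
Proof.
move=> mh L0 hs; have mA := measurable_ge_norm L mh.
rewrite ler_pdivlMr ?exprn_gt0// -lee_fin EFinM fineK ?fin_num_measure//.
apply: le_trans hs; rewrite muleC -[A in Pr A]setIT -integral_indic//.
rewrite -ge0_integralZl//; last 2 first.
- exact/measurable_EFinP.
- by rewrite lee_fin sqr_ge0.
apply: ge0_le_integral => //.
- by move=> w _; rewrite -EFinM lee_fin mulr_ge0 ?sqr_ge0.
- by apply/measurable_EFinP/measurable_funM.
- exact/measurable_EFinP/measurable_funX.
- move=> w _; rewrite -EFinM lee_fin indicE; case: (boolP (w \in _)) => [|_].
    rewrite inE/= => Lh; rewrite mulr1 -[h w ^+ 2]real_normK ?num_real//.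
    by rewrite lerXn2r ?nnegrE// ltW.
  by rewrite mulr0 sqr_ge0.
Qed.

End fine_probability.

(** * Adaptedness as measurability on a copy of the sample space *)

Section filtration_measurability.
Context dO (Omega : measurableType dO) (F : nat -> set (set Omega)).
Hypothesis hF : is_filtration F.

(** [F k] is already a sigma-algebra, so generating from it adds nothing. This lets the
    measurability lemmas for functions and kernels apply to adapted processes. *)
Lemma filtration_measurableE k (A : set Omega) :
  (F k).-sigma.-measurable A = F k A.
Proof. by case: hF => sF _ _; rewrite measurable_g_measurableTypeE. Qed.

Lemma filtration_measurable_fun_le d (Y : measurableType d) j k (h : Omega -> Y) :
  (j <= k)%N -> measurable_fun setT (h : g_sigma_algebraType (F j) -> Y) ->
  measurable_fun setT (h : g_sigma_algebraType (F k) -> Y).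
Proof.
move=> jk mh _ B mB; rewrite filtration_measurableE.
case: hF => _ _ /(_ _ _ jk); apply.
by rewrite -filtration_measurableE; exact: mh.
Qed.

Lemma filtration_measurable_fun d (Y : measurableType d) k (h : Omega -> Y) :
  measurable_fun setT (h : g_sigma_algebraType (F k) -> Y) -> measurable_fun setT h.
Proof.
move=> mh _ B mB; case: hF => _ + _ => /(_ k); apply.
by rewrite -filtration_measurableE; exact: mh.
Qed.

Lemma filtration_measurable_id k :
  measurable_fun setT (id : Omega -> g_sigma_algebraType (F k)).
Proof. exact: (@filtration_measurable_fun _ _ k). Qed.

End filtration_measurability.

(** * Central limit theorem for martingales with kernel conditional laws *)

Section martingale_array_row.
Context dO dX (Omega : measurableType dO) (X : measurableType dX) (R : realType)
  (Pr : probability Omega R) (F : nat -> set (set Omega)).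
Hypothesis hF : is_filtration F.
Local Notation T k := (g_sigma_algebraType (F k)).
Local Notation adapted k h := (@measurable_fun _ _ (T k) R setT h).
Variables (Z : nat -> Omega -> X) (K : forall k, R.-pker (T k) ~> X).
Hypothesis mZ : forall k, measurable_fun setT (Z k : T k.+1 -> X).
Hypothesis kernelK : forall k A B, F k A -> measurable B ->
  (Pr (A `&` Z k @^-1` B) = \int[Pr]_(w in A) K k w B)%E.

Arguments mZ : clear implicits.

Section increments.
Variable psi : forall k, T k * X -> R.
Arguments psi : clear implicits.
Hypothesis mpsi : forall k, measurable_fun setT (psi k).
Hypothesis psi2_int : forall k w,
  (K k w).-integrable setT (EFin \o (fun y => psi k (w, y) ^+ 2)).
Hypothesis psi_centered : forall k w, \int[K k w]_y psi k (w, y) = 0.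
Arguments mpsi : clear implicits.
Arguments psi2_int : clear implicits.
Arguments psi_centered : clear implicits.

Definition cond_var k (w : Omega) : R := \int[K k w]_y (psi k (w, y) ^+ 2).

Definition cond_lindeberg (e : R) k (w : Omega) : R :=
  \int[K k w]_y (if e < `|psi k (w, y)| then psi k (w, y) ^+ 2 else 0).

Definition mart_sum k (w : Omega) : R := \sum_(0 <= j < k) psi j (w, Z j w).

Definition quad_var k (w : Omega) : R := \sum_(0 <= j < k) cond_var j w.

Let mpsi2 k : measurable_fun setT (fun z => psi k z ^+ 2).
Proof. exact: measurable_funX. Qed.

Let mtrunc e k :
  measurable_fun setT (fun z => if e < `|psi k z| then psi k z ^+ 2 else 0).
Proof.
apply: measurable_fun_ifT => //; apply: measurable_fun_ltr => //.
exact: measurableT_comp.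
Qed.

Lemma measurable_cond_var k : adapted k (cond_var k).
Proof. exact: (measurable_Rintegral_kernel (K k) (@mpsi2 k)). Qed.

Lemma measurable_cond_lindeberg e k :
  adapted k (cond_lindeberg e k).
Proof. exact: (measurable_Rintegral_kernel (K k) (@mtrunc e k)). Qed.

Lemma measurable_mart_sum k : adapted k (mart_sum k).
Proof.
elim: k => [|k IH].
  rewrite (_ : mart_sum 0 = cst 0)//.
  by apply/funext => w; rewrite /mart_sum big_nil.
rewrite (_ : mart_sum k.+1 = fun w => mart_sum k w + psi k (w, Z k w)); last first.
  by apply/funext => w; rewrite /mart_sum big_nat_recr.
apply: measurable_funD; first exact: filtration_measurable_fun_le IH.
apply: (measurableT_comp (mpsi k) (g := fun w : T k.+1 => (w : T k, Z k w))).
apply: measurable_fun_pair => //.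
exact: (@filtration_measurable_fun_le _ _ _ hF _ (T k) k).
Qed.

(** Predictability: the sum up to index k inclusive is known at time k. Hence the weight of step k +
    1 can be taken out of the kernel integral, and a truncation of increment k may depend on it. *)
Lemma measurable_quad_var k : adapted k (quad_var k.+1).
Proof.
elim: k => [|k IH].
  rewrite (_ : quad_var 1 = cond_var 0); first exact: measurable_cond_var.
  by apply/funext => w; rewrite /quad_var big_nat1.
rewrite (_ : quad_var k.+2 = fun w => quad_var k.+1 w + cond_var k.+1 w); last first.
  by apply/funext => w; rewrite /quad_var big_nat_recr.
apply: measurable_funD; first exact: filtration_measurable_fun_le IH.
exact: measurable_cond_var.
Qed.

Lemma cond_var_ge0 k w : 0 <= cond_var k w.
Proof. by apply: Rintegral_ge0 => y _; exact: sqr_ge0. Qed.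

Lemma cond_lindeberg_ge0 e k w : 0 <= cond_lindeberg e k w.
Proof. by apply: Rintegral_ge0 => y _; case: ifPn => // _; exact: sqr_ge0. Qed.

Lemma quad_var_ge0 k w : 0 <= quad_var k w.
Proof. by apply: sumr_ge0 => j _; exact: cond_var_ge0. Qed.

Lemma lindeberg_integrable e k w : (K k w).-integrable setT
  (EFin \o (fun y => if e < `|psi k (w, y)| then psi k (w, y) ^+ 2 else 0)).
Proof.
apply: (@le_integrable _ _ _ _ setT measurableT _ _ _ _ (psi2_int k w)) => //.
- apply/measurable_EFinP; apply: (measurableT_comp (@mtrunc e k)).
  exact: measurable_pair1.
- move=> y _; rewrite lee_fin; case: ifPn => // _.
  by rewrite normr0.
Qed.

Lemma psi_int k w : (K k w).-integrable setT (EFin \o (fun y => psi k (w, y))).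
Proof.
have i1 : (K k w).-integrable setT (EFin \o (fun y : X => 1 : R)).
  by apply: (@kernel_bounded_integrable _ _ _ _ _ (K k) w (cst 1) 1) => // x; rewrite normr1.
apply: (@le_integrable _ _ _ _ setT measurableT _ _ _ _ (integrableD measurableT i1 (psi2_int k w))) => //.
- apply/measurable_EFinP; apply: (measurableT_comp (mpsi k)).
  exact: measurable_pair1.
- move=> y _; rewrite lee_fin [leRHS]ger0_norm ?addr_ge0 ?sqr_ge0//.
  rewrite -[psi k (w, y) ^+ 2]real_normK ?num_real//.
  by have := sqr_ge0 (`|psi k (w, y)| - 1); have := normr_ge0 (psi k (w, y)); nra.
Qed.

(** An increment is at most e in absolute value or is counted in the Lindeberg term. This makes each
    single conditional variance small, hence also the sum of their squares. *)
Lemma cond_var_le e k w : 0 <= e -> cond_var k w <= e ^+ 2 + cond_lindeberg e k w.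
Proof.
move=> e0.
have i1 : (K k w).-integrable setT (EFin \o (fun y : X => e ^+ 2)).
  by apply: (@kernel_bounded_integrable _ _ _ _ _ (K k) w (cst (e ^+ 2)) `|e ^+ 2|).
have -> : e ^+ 2 + cond_lindeberg e k w = \int[K k w]_y (e ^+ 2 +
    (if e < `|psi k (w, y)| then psi k (w, y) ^+ 2 else 0)).
  rewrite RintegralD//; last exact: lindeberg_integrable.
  rewrite Rintegral_cst//.
  have -> : fine (K k w setT) = 1 by rewrite prob_kernel.
  by rewrite mulr1.
apply: le_Rintegral => //.
  exact: (integrableD measurableT i1 (@lindeberg_integrable e k w)).
move=> y _; case: ltP => [_|ey]; first by rewrite lerDr sqr_ge0.
by rewrite addr0 -real_normK ?num_real// lerXn2r ?nnegrE.
Qed.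

Let mZO k : measurable_fun setT (Z k).
Proof. exact: (filtration_measurable_fun hF (mZ k)). Qed.

Let mid k : measurable_fun setT (id : Omega -> T k).
Proof. exact: filtration_measurable_id. Qed.

Let rect k (A : set (T k)) B : measurable A -> measurable B ->
  (Pr ((id : Omega -> T k) @^-1` A `&` Z k @^-1` B) =
   \int[Pr]_(w in (id : Omega -> T k) @^-1` A) K k (id w) B)%E.
Proof. by rewrite filtration_measurableE// => mA mB; exact: kernelK. Qed.

Lemma psi_int_shift k w (a t : R) :
  (K k w).-integrable setT (EFin \o (fun y => (a + t * psi k (w, y)) ^+ 2)) /\
  \int[K k w]_y ((a + t * psi k (w, y)) ^+ 2) = a ^+ 2 + t ^+ 2 * cond_var k w.
Proof.
have i1 : (K k w).-integrable setT (EFin \o (fun y : X => a ^+ 2)).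
  by apply: (@kernel_bounded_integrable _ _ _ _ _ (K k) w (cst (a ^+ 2)) `|a ^+ 2|).
have i2 := integrableZl measurableT (2 * a * t) (@psi_int k w).
have i3 := integrableZl measurableT (t ^+ 2) (psi2_int k w).
have i23 := integrableD measurableT i2 i3.
have E y : (a + t * psi k (w, y)) ^+ 2 =
  a ^+ 2 + ((2 * a * t) * psi k (w, y) + t ^+ 2 * psi k (w, y) ^+ 2) by ring.
split.
  rewrite [X in _.-integrable _ (EFin \o X)](_ : _ = fun y => a ^+ 2 +
    ((2 * a * t) * psi k (w, y) + t ^+ 2 * psi k (w, y) ^+ 2)); last exact/funext.
  exact: (integrableD measurableT i1 i23).
under eq_Rintegral do rewrite E.
rewrite RintegralD// RintegralD// Rintegral_cst//.
have -> : fine (K k w setT) = 1 by rewrite prob_kernel.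
rewrite !RintegralZl//; last exact: psi_int.
by rewrite psi_centered mulr1 mulr0 add0r.
Qed.

Lemma measurable_cond_varO k : measurable_fun setT (cond_var k).
Proof. exact: (filtration_measurable_fun hF (@measurable_cond_var k)). Qed.

Lemma measurable_cond_lindebergO e k : measurable_fun setT (cond_lindeberg e k).
Proof. exact: (filtration_measurable_fun hF (@measurable_cond_lindeberg e k)). Qed.

Lemma measurable_mart_sumO k : measurable_fun setT (mart_sum k).
Proof. exact: (filtration_measurable_fun hF (@measurable_mart_sum k)). Qed.

Lemma measurable_quad_varO k : measurable_fun setT (quad_var k).
Proof. by apply: measurable_sum => j; exact: measurable_cond_varO. Qed.

(** Orthogonality of the increments: the cross term vanishes because the kernel integral of [psi k]
    is 0. The identity lives in the extended reals, so it assumes no second moments. *)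
Lemma integral_mart_sum_sqr k :
  (\int[Pr]_w (mart_sum k w ^+ 2)%:E = \int[Pr]_w (quad_var k w)%:E)%E.
Proof.
elim: k => [|k IH].
  by apply: eq_integral => w _; rewrite /mart_sum /quad_var !big_nil expr0n.
pose G (z : T k * X) := ((mart_sum k z.1 + psi k z) ^+ 2)%:E.
have mG : measurable_fun setT G.
  apply/measurable_EFinP/measurable_funX/measurable_funD => //.
  exact: (measurableT_comp (@measurable_mart_sum k)).
transitivity (\int[Pr]_w G (id w, Z k w))%E.
  by apply: eq_integral => w _; rewrite /G /mart_sum big_nat_recr.
rewrite (ge0_integral_disintegration (@mid k) (@mZO k) (@rect k) mG); last first.
  by move=> z; rewrite lee_fin sqr_ge0.
transitivity (\int[Pr]_w ((mart_sum k w ^+ 2)%:E + (cond_var k w)%:E))%E.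
  apply: eq_integral => w _.
  have [] := @psi_int_shift k w (mart_sum k w) 1.
  rewrite expr1n mul1r => i1 E; rewrite -EFinD -E /Rintegral fineK.
    by apply: eq_integral => y _; rewrite mul1r.
  exact: integrable_fin_num i1.
rewrite ge0_integralD//.
- rewrite IH -ge0_integralD//.
  + by apply: eq_integral => w _; rewrite /quad_var big_nat_recr.
  + by move=> w _; rewrite lee_fin quad_var_ge0.
  + exact/measurable_EFinP/measurable_quad_varO.
  + by move=> w _; rewrite lee_fin cond_var_ge0.
  + exact/measurable_EFinP/measurable_cond_varO.
- by move=> w _; rewrite lee_fin sqr_ge0.
- exact/measurable_EFinP/measurable_funX/measurable_mart_sumO.
- by move=> w _; rewrite lee_fin cond_var_ge0.
- exact/measurable_EFinP/measurable_cond_varO.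
Qed.

(** [cos_taylor2] integrated against [K k w]: centring removes the linear term. The remainder is at
    most |t|^3 e psi^2 where |psi| <= e, and 2 t^2 psi^2 elsewhere. *)
Lemma cond_cos_approx e k w (A t : R) : 0 <= e ->
  `|\int[K k w]_y cos (A + t * psi k (w, y)) - cos A * (1 - t ^+ 2 / 2 * cond_var k w)|
    <= `|t| ^+ 3 * e * cond_var k w + 2 * t ^+ 2 * cond_lindeberg e k w.
Proof.
move=> e0.
have mpsiw : measurable_fun setT (fun y => psi k (w, y)).
  by apply: (measurableT_comp (mpsi k)); exact: measurable_pair1.
have icos : (K k w).-integrable setT (EFin \o (fun y => cos (A + t * psi k (w, y)))).
  apply: (@kernel_bounded_integrable _ _ _ _ _ (K k) w _ 1); last by move=> y; exact: cos_max.
  apply: (@measurableT_comp _ _ _ _ _ _ (@cos R)).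
    exact: continuous_measurable_fun (@continuous_cos R).
  by apply: measurable_funD => //; exact: measurable_funM.
have icst : (K k w).-integrable setT (EFin \o (fun y : X => - cos A)).
  by apply: (@kernel_bounded_integrable _ _ _ _ _ (K k) w (cst (- cos A)) `|- cos A|).
have i1 := integrableZl measurableT (t * sin A) (@psi_int k w).
have i2 := integrableZl measurableT (t ^+ 2 / 2 * cos A) (psi2_int k w).
have i12 := integrableD measurableT i1 i2.
have i012 := integrableD measurableT icst i12.
have iall := integrableD measurableT icos i012.
have j1 := integrableZl measurableT (`|t| ^+ 3 * e) (psi2_int k w).
have j2 := integrableZl measurableT (2 * t ^+ 2) (@lindeberg_integrable e k w).
have j12 := integrableD measurableT j1 j2.
have -> : \int[K k w]_y cos (A + t * psi k (w, y)) - cos A * (1 - t ^+ 2 / 2 * cond_var k w)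
    = \int[K k w]_y (cos (A + t * psi k (w, y)) + (- cos A +
       (t * sin A * psi k (w, y) + t ^+ 2 / 2 * cos A * psi k (w, y) ^+ 2))).
  rewrite RintegralD// RintegralD// RintegralD// !RintegralZl//; last exact: psi_int.
  rewrite Rintegral_cst// psi_centered /cond_var.
  have -> : fine (K k w setT) = 1 by rewrite prob_kernel.
  by ring.
have -> : `|t| ^+ 3 * e * cond_var k w + 2 * t ^+ 2 * cond_lindeberg e k w =
    \int[K k w]_y (`|t| ^+ 3 * e * psi k (w, y) ^+ 2 +
      2 * t ^+ 2 * (if e < `|psi k (w, y)| then psi k (w, y) ^+ 2 else 0)).
  by rewrite RintegralD// !RintegralZl//; exact: lindeberg_integrable.
rewrite (le_trans (le_normr_Rintegral _ iall))//.
apply: le_Rintegral => //; first exact: integrable_norm.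
move=> y _; set x := psi k (w, y).
have := cos_taylor2 A (t * x).
rewrite (_ : cos _ - _ + _ + _ = cos (A + t * x) +
  (- cos A + (t * sin A * x + t ^+ 2 / 2 * cos A * x ^+ 2))); last by ring.
move=> /le_trans; apply.
have q0 : 0 <= t ^+ 2 * x ^+ 2 by rewrite -exprMn sqr_ge0.
rewrite exprMn; case: ltP => xe.
  rewrite (@le_trans _ _ (2 * (t ^+ 2 * x ^+ 2)))//.
    by rewrite ler_wpM2r// ge_min lexx.
  by rewrite mulrA lerDr mulr_ge0 ?sqr_ge0// mulr_ge0// exprn_ge0.
rewrite mulr0 addr0 (@le_trans _ _ (`|t * x| * (t ^+ 2 * x ^+ 2)))//.
  by rewrite ler_wpM2r// ge_min lexx orbT.
rewrite normrM mulrACA -[t ^+ 2]real_normK ?num_real// -exprS -mulrA.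
by rewrite ler_wpM2l ?exprn_ge0// ler_wpM2r ?sqr_ge0.
Qed.

Section bounded_row.
Variables (N : nat) (s e eta t phi : R).
Hypotheses (e0 : 0 <= e) (quad_var_le : forall w, quad_var N w <= s).
Hypothesis lindeberg_le : forall w, \sum_(0 <= j < N) cond_lindeberg e j w <= eta.

Let a := t ^+ 2 / 2.
Let a0 : 0 <= a. Proof. by rewrite divr_ge0// sqr_ge0. Qed.
Let Y k w := expR (a * quad_var k w) * cos (t * mart_sum k w + phi).
(** Error of one step: the square comes from [expR_taylor1], the rest from [cond_cos_approx]. *)
Let err j w := (a * cond_var j w) ^+ 2 +
  (`|t| ^+ 3 * e * cond_var j w + 2 * t ^+ 2 * cond_lindeberg e j w).

Let quad_var_leN k w : (k <= N)%N -> quad_var k w <= s.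
Proof.
move=> kN; rewrite (le_trans _ (quad_var_le w))// /quad_var.
rewrite (big_cat_nat (n := k) (p := N))//= lerDl.
by apply: sumr_ge0 => j _; exact: cond_var_ge0.
Qed.

Let expa k w : (k <= N)%N -> expR (a * quad_var k w) <= expR (a * s).
Proof. by move=> kN; rewrite ler_expR ler_wpM2l// quad_var_leN. Qed.

Let err_ge0 j w : 0 <= err j w.
Proof.
rewrite /err addr_ge0 ?sqr_ge0// addr_ge0//.
- by rewrite mulr_ge0 ?cond_var_ge0// mulr_ge0// exprn_ge0.
- by rewrite mulr_ge0 ?cond_lindeberg_ge0// mulr_ge0// sqr_ge0.
Qed.

Let mcosf d (T' : measurableType d) (h : T' -> R) :
  measurable_fun setT h -> measurable_fun setT (fun x => cos (h x)).
Proof.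
apply: (@measurableT_comp _ _ _ _ _ _ (@cos R)).
exact: continuous_measurable_fun (@continuous_cos R).
Qed.

Let mY k : measurable_fun setT (Y k).
Proof.
apply: measurable_funM.
  apply: (@measurableT_comp _ _ _ _ _ _ (@expR R)) => //.
  by apply: measurable_funM => //; exact: measurable_quad_varO.
apply/mcosf/measurable_funD => //; apply: measurable_funM => //.
exact: measurable_mart_sumO.
Qed.

Let YM k w : (k <= N)%N -> `|Y k w| <= expR (a * s).
Proof.
move=> kN; rewrite normrM ger0_norm ?expR_ge0// -[leRHS]mulr1.
by rewrite ler_pM// ?expR_ge0 ?expa// cos_max.
Qed.

Let merr j : measurable_fun setT (err j).
Proof.
have mv := @measurable_cond_varO j.
have ml := @measurable_cond_lindebergO e j.
apply: measurable_funD.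
  by apply: measurable_funX; exact: measurable_funM.
by apply: measurable_funD; exact: measurable_funM.
Qed.

(** A sum of squared conditional variances is at most their maximum times their sum, that is (e^2 +
    eta) times s. *)
Let sum_err w : \sum_(0 <= j < N) err j w <=
  a ^+ 2 * s * (e ^+ 2 + eta) + (`|t| ^+ 3 * e * s + 2 * t ^+ 2 * eta).
Proof.
have le_eta j : (j < N)%N -> cond_lindeberg e j w <= eta.
  move=> jN; rewrite (le_trans _ (lindeberg_le w))//.
  rewrite (big_cat_nat (n := j.+1) (p := N))//= big_nat_recr//= -addrA addrCA lerDl.
  by rewrite addr_ge0//; apply: sumr_ge0 => i _; exact: cond_lindeberg_ge0.
rewrite /err !big_split/= -!mulr_sumr; apply: lerD; last first.
  apply: lerD; first by rewrite ler_wpM2l ?quad_var_le ?mulr_ge0 ?exprn_ge0.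
  by rewrite ler_wpM2l ?lindeberg_le// mulr_ge0// sqr_ge0.
apply: (@le_trans _ _ (\sum_(0 <= j < N) a ^+ 2 * (e ^+ 2 + eta) * cond_var j w)).
  rewrite !big_nat; apply: ler_sum => j /andP[_ jN].
  rewrite exprMn -mulrA ler_wpM2l ?sqr_ge0// expr2 ler_wpM2r ?cond_var_ge0//.
  by rewrite (le_trans (cond_var_le j w e0))// lerD2l le_eta.
have eta0 : 0 <= eta.
  by rewrite (le_trans _ (lindeberg_le w))// sumr_ge0// => j _; exact: cond_lindeberg_ge0.
rewrite -mulr_sumr [leRHS]mulrAC ler_wpM2l ?quad_var_le//.
by rewrite mulr_ge0 ?sqr_ge0// addr_ge0 ?sqr_ge0.
Qed.

Let Pr_int (h : Omega -> R) M : measurable_fun setT h -> (forall w, `|h w| <= M) ->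
  Pr.-integrable setT (EFin \o h).
Proof. exact: bounded_integrable. Qed.

Let err_int k : (k <= N)%N ->
  Pr.-integrable setT (EFin \o (fun w => \sum_(0 <= j < k) err j w)).
Proof.
move=> kN; apply: (@Pr_int _
  (a ^+ 2 * s * (e ^+ 2 + eta) + (`|t| ^+ 3 * e * s + 2 * t ^+ 2 * eta))).
  by apply: measurable_sum => j; exact: merr.
move=> w; rewrite ger0_norm; last by apply: sumr_ge0.
rewrite (le_trans _ (sum_err w))// [leRHS](big_cat_nat (n := k) (p := N))//= lerDl.
by apply: sumr_ge0.
Qed.

Let err1_int k : (k < N)%N -> Pr.-integrable setT (EFin \o err k).
Proof.
move=> kN; apply: (@Pr_int _
  (a ^+ 2 * s * (e ^+ 2 + eta) + (`|t| ^+ 3 * e * s + 2 * t ^+ 2 * eta))).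
  exact: merr.
move=> w; rewrite ger0_norm// (le_trans _ (sum_err w))//.
rewrite (big_cat_nat (n := k.+1) (p := N))//= big_nat_recr//= -addrA addrCA lerDl.
by rewrite addr_ge0//; apply: sumr_ge0.
Qed.

(** Conditioning on F_k replaces the last cosine by its integral against [K k w]. With v the
    conditional variance, exp(a v) times that integral is compared with cos A through exp(a v) (1 -
    a v) cos A, where A is the argument of the cosine in [Y k]. *)
Let step k : (k < N)%N ->
  `|\int[Pr]_w Y k.+1 w - \int[Pr]_w Y k w| <= expR (a * s) * \int[Pr]_w err k w.
Proof.
move=> kN.
pose G (z : T k * X) := expR (a * quad_var k.+1 z.1) *
  cos ((t * mart_sum k z.1 + phi) + t * psi k z).
have mG : measurable_fun setT G.
  apply: measurable_funM.
    apply: (@measurableT_comp _ _ _ _ _ _ (@expR R)) => //.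
    apply: measurable_funM => //.
    exact: (measurableT_comp (@measurable_quad_var k)).
  apply/mcosf/measurable_funD => //; last exact: measurable_funM.
  apply: measurable_funD => //; apply: measurable_funM => //.
  exact: (measurableT_comp (@measurable_mart_sum k)).
have GM z : `|G z| <= expR (a * s).
  rewrite normrM ger0_norm ?expR_ge0// -[leRHS]mulr1.
  by rewrite ler_pM// ?expR_ge0 ?expa// cos_max.
have YG : \int[Pr]_w Y k.+1 w = \int[Pr]_w G (id w, Z k w).
  apply: eq_Rintegral => w _; rewrite /Y /G /mart_sum big_nat_recr//=.
  by congr (_ * cos _); ring.
rewrite YG (Rintegral_disintegration (@mid k) (@mZO k) (@rect k) mG GM).
pose H (w : Omega) := \int[K k w]_y G (w, y).
have HE w : H w = expR (a * quad_var k.+1 w) *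
    \int[K k w]_y cos ((t * mart_sum k w + phi) + t * psi k (w, y)).
  rewrite /H /G/= RintegralZl//.
  apply: (@kernel_bounded_integrable _ _ _ _ _ (K k) w _ 1); last by move=> y; exact: cos_max.
  apply/mcosf/measurable_funD => //; apply: measurable_funM => //.
  by apply: (measurableT_comp (mpsi k)); exact: measurable_pair1.
have mH : measurable_fun setT H.
  exact: (filtration_measurable_fun hF (measurable_Rintegral_kernel (K k) mG)).
have main w : `|H w - Y k w| <= expR (a * s) * err k w.
  rewrite HE; set c := \int[K k w]_y _.
  have := @cond_cos_approx e k w (t * mart_sum k w + phi) t e0.
  rewrite -/a -/c; set A := t * mart_sum k w + phi; set v := cond_var k w => cA.
  have v0 : 0 <= v by exact: cond_var_ge0.
  have -> : quad_var k.+1 w = quad_var k w + v by rewrite /quad_var big_nat_recr.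
  have eV := expa w kN.
  rewrite (_ : quad_var k.+1 w = quad_var k w + v) in eV; last by rewrite /quad_var big_nat_recr.
  rewrite (_ : _ - Y k w = expR (a * quad_var k w) * ((expR (a * v) * (1 - a * v) - 1) * cos A +
      expR (a * v) * (c - cos A * (1 - a * v)))); last first.
    by rewrite /Y -/A mulrDr expRD; ring.
  rewrite normrM (ger0_norm (expR_ge0 _)).
  (* The two exponentials recombine into the weight of step k + 1, which is at most exp(a s). *)
  rewrite (@le_trans _ _ (expR (a * quad_var k w) * (expR (a * v) * err k w)))//; last first.
    by rewrite mulrA -expRD -mulrDr ler_wpM2r.
  rewrite ler_wpM2l ?expR_ge0// (le_trans (ler_normD _ _))// /err [leRHS]mulrDr lerD//.
    rewrite normrM -[leRHS]mulr1 ler_pM// ?cos_max//.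
    by rewrite [leRHS]mulrC expR_taylor1// mulr_ge0.
  by rewrite normrM (ger0_norm (expR_ge0 _)) ler_wpM2l ?expR_ge0.
have HM w : `|H w| <= expR (a * s) + expR (a * s) *
    (a ^+ 2 * s * (e ^+ 2 + eta) + (`|t| ^+ 3 * e * s + 2 * t ^+ 2 * eta)).
  rewrite -[H w](subrK (Y k w)) addrC (le_trans (ler_normD _ _))// lerD ?YM 1?ltnW//.
  rewrite (le_trans (main w))// ler_wpM2l ?expR_ge0//.
  rewrite (le_trans _ (sum_err w))// (big_cat_nat (n := k.+1) (p := N))//= big_nat_recr//=.
  by rewrite -addrA addrCA lerDl addr_ge0//; apply: sumr_ge0.
have iH := Pr_int mH HM.
have iY := Pr_int (@mY k) (fun w => YM w (ltnW kN)).
rewrite -RintegralB// -RintegralZl//; last exact: err1_int.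
have iHY := integrableB measurableT iH iY.
rewrite (le_trans (le_normr_Rintegral _ iHY))//.
apply: le_Rintegral => //; first exact: integrable_norm.
exact: (integrableZl measurableT (expR (a * s)) (err1_int kN)).
Qed.

(** The step errors telescope down to k = 0, where the sums are empty and the expectation is cos
    phi. *)
Lemma bounded_row_cos :
  `|\int[Pr]_w (expR (t ^+ 2 / 2 * quad_var N w) * cos (t * mart_sum N w + phi)) - cos phi|
  <= expR (t ^+ 2 / 2 * s) * ((t ^+ 2 / 2) ^+ 2 * s * (e ^+ 2 + eta) +
       (`|t| ^+ 3 * e * s + 2 * t ^+ 2 * eta)).
Proof.
have P1 : fine (Pr setT) = 1 by have -> := @probability_setT _ _ _ Pr.
have main k : (k <= N)%N -> `|\int[Pr]_w Y k w - cos phi|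
    <= expR (a * s) * \int[Pr]_w \sum_(0 <= j < k) err j w.
  elim: k => [_|k IH kN].
    under eq_Rintegral do rewrite /Y /quad_var /mart_sum !big_nil !mulr0 expR0 mul1r add0r.
    rewrite Rintegral_cst// P1 mulr1 subrr normr0 mulr_ge0 ?expR_ge0//.
    by apply: Rintegral_ge0 => w _; rewrite big_nil.
  rewrite -[_ - _](subrKA (\int[Pr]_w Y k w)) (le_trans (ler_normD _ _))//.
  under [in leRHS]eq_Rintegral do rewrite big_nat_recr//=.
  rewrite RintegralD//; [|exact/err_int/ltnW|exact: err1_int].
  by rewrite mulrDr addrC lerD ?IH ?step// ltnW.
rewrite (le_trans (main N _))// ler_wpM2l ?expR_ge0//.
rewrite -/a; set B := (B in _ <= B).
have -> : B = \int[Pr]_w B by rewrite Rintegral_cst// P1 mulr1.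
apply: le_Rintegral => //; first exact: err_int.
by apply: (@Pr_int (cst B) `|B|).
Qed.

End bounded_row.

End increments.

(** * Predictable truncation of a row *)

Section truncation.
Variable psi : forall k, T k * X -> R.
Arguments psi : clear implicits.
Hypothesis mpsi : forall k, measurable_fun setT (psi k).
Hypothesis psi2_int : forall k w,
  (K k w).-integrable setT (EFin \o (fun y => psi k (w, y) ^+ 2)).
Hypothesis psi_centered : forall k w, \int[K k w]_y psi k (w, y) = 0.
Arguments mpsi : clear implicits.
Arguments psi2_int : clear implicits.
Arguments psi_centered : clear implicits.

Variables (n : nat) (s e eta : R).
Hypotheses (n_gt0 : (0 < n)%N) (s_ge0 : 0 <= s) (e_ge0 : 0 <= e) (eta_ge0 : 0 <= eta).

Let r : R := (Num.sqrt n%:R)^-1.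
Let r0 : 0 < r. Proof. by rewrite invr_gt0 sqrtr_gt0 ltr0n. Qed.
(** The threshold is raised to e / r because these increments are not yet multiplied by r =
    n^(-1/2). *)
Definition lindeberg_sum k (w : Omega) : R :=
  \sum_(0 <= j < k) cond_lindeberg psi (e / r) j w.

(** Both sums run up to index k inclusive and are F_k-measurable, so multiplying increment k by this
    indicator keeps it centred under [K k w]. *)
Let chi k (w : Omega) : bool :=
  (r ^+ 2 * quad_var psi k.+1 w <= s) && (r ^+ 2 * lindeberg_sum k.+1 w <= eta).

Let psi' k (z : T k * X) : R := if chi k z.1 then r * psi k z else 0.

Let mlind k : adapted k (lindeberg_sum k.+1).
Proof.
elim: k => [|k IH].
  rewrite (_ : lindeberg_sum 1 = cond_lindeberg psi (e / r) 0).
    exact: measurable_cond_lindeberg.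
  by apply/funext => w; rewrite /lindeberg_sum big_nat1.
rewrite (_ : lindeberg_sum k.+2 = fun w => lindeberg_sum k.+1 w +
    cond_lindeberg psi (e / r) k.+1 w); last first.
  by apply/funext => w; rewrite /lindeberg_sum big_nat_recr.
apply: measurable_funD; first exact: filtration_measurable_fun_le IH.
exact: measurable_cond_lindeberg.
Qed.

Let mchi k : measurable_fun setT (chi k : T k -> bool).
Proof.
apply: measurable_and; apply: measurable_fun_ler => //; apply: measurable_funM => //.
exact: measurable_quad_var.
Qed.

Let mpsi' k : measurable_fun setT (@psi' k).
Proof.
apply: measurable_fun_ifT => //; last exact: measurable_funM.
exact: (measurableT_comp (@mchi k)).
Qed.

Let psi'2_int k w :
  (K k w).-integrable setT (EFin \o (fun y => @psi' k (w, y) ^+ 2)).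
Proof.
rewrite /psi'/=; case: (chi k w).
  under eq_fun do rewrite exprMn.
  exact: (integrableZl measurableT (r ^+ 2) (psi2_int k w)).
by rewrite expr0n; exact: integrable0.
Qed.

Let psi'_centered k w : \int[K k w]_y @psi' k (w, y) = 0.
Proof.
rewrite /psi'/=; case: (chi k w); last by rewrite Rintegral_cst// mul0r.
by rewrite RintegralZl ?psi_centered ?mulr0//; exact: psi_int.
Qed.

Let cond_var' k w :
  cond_var psi' k w = if chi k w then r ^+ 2 * cond_var psi k w else 0.
Proof.
rewrite /cond_var /psi'/=; case: (chi k w).
  by under eq_Rintegral do rewrite exprMn; rewrite RintegralZl//; exact: psi2_int.
by rewrite expr0n Rintegral_cst// mul0r.
Qed.

Let cond_lindeberg' k w : cond_lindeberg psi' e k w =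
  if chi k w then r ^+ 2 * cond_lindeberg psi (e / r) k w else 0.
Proof.
rewrite /cond_lindeberg /psi'/=; case: (chi k w).
  rewrite -RintegralZl//; last exact: lindeberg_integrable.
  apply: eq_Rintegral => y _.
  rewrite normrM (gtr0_norm r0) ltr_pdivrMr// mulrC.
  by case: ifPn; rewrite ?mulr0// exprMn.
by rewrite normr0 expr0n if_same Rintegral_cst// mul0r.
Qed.

(** The last index where [b] holds bounds everything: later terms are zero, and earlier ones are
    dominated by the full partial sum at that index. *)
Let stopped_sum (u : nat -> R) (b : nat -> bool) (M : R) N : 0 <= M ->
  (forall k, b k -> \sum_(0 <= j < k.+1) u j <= M) -> (forall k, 0 <= u k) ->
  \sum_(0 <= k < N) (if b k then u k else 0) <= M.
Proof.
move=> M0 bM u0; elim: N => [|N IH]; first by rewrite big_nil.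
have [bN|bN] := boolP (b N).
  rewrite (le_trans _ (bM _ bN))//; apply: ler_sum => j _.
  by case: ifP.
by rewrite big_nat_recr//= (negbTE bN) addr0.
Qed.

(** What the limit theorem retains of the truncation: a pair with deterministic bounds that
    coincides with the normalised martingale and its quadratic variation whenever both bounds hold
    at time n. *)
Lemma truncated_row : exists S V : Omega -> R, [/\
  measurable_fun setT S /\ measurable_fun setT V,
  forall w, 0 <= V w <= s,
  (\int[Pr]_w (S w ^+ 2)%:E <= s%:E)%E,
  forall t phi,
    `|\int[Pr]_w (expR (t ^+ 2 / 2 * V w) * cos (t * S w + phi)) - cos phi|
    <= expR (t ^+ 2 / 2 * s) * ((t ^+ 2 / 2) ^+ 2 * s * (e ^+ 2 + eta) +
         (`|t| ^+ 3 * e * s + 2 * t ^+ 2 * eta)) &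
  forall w, r ^+ 2 * quad_var psi n w <= s -> r ^+ 2 * lindeberg_sum n w <= eta ->
    S w = r * mart_sum psi n w /\ V w = r ^+ 2 * quad_var psi n w].
Proof.
have qle w : quad_var psi' n w <= s.
  rewrite /quad_var; under eq_bigr do rewrite cond_var'.
  apply: stopped_sum => // k; last by rewrite mulr_ge0 ?sqr_ge0// cond_var_ge0.
  by move=> /andP[+ _]; rewrite /quad_var mulr_sumr.
have lle w : \sum_(0 <= j < n) cond_lindeberg psi' e j w <= eta.
  under eq_bigr do rewrite cond_lindeberg'.
  apply: stopped_sum => // k; last by rewrite mulr_ge0 ?sqr_ge0// cond_lindeberg_ge0.
  by move=> /andP[_]; rewrite /lindeberg_sum mulr_sumr.
have mq : measurable_fun setT (quad_var psi' n) by exact: measurable_quad_varO.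
exists (mart_sum psi' n), (quad_var psi' n); split.
- split; last exact: measurable_quad_varO.
  exact: measurable_mart_sumO.
- by move=> w; rewrite quad_var_ge0 qle.
- rewrite integral_mart_sum_sqr//.
  rewrite (@le_trans _ _ (\int[Pr]_w s%:E)%E)//.
    apply: ge0_le_integral => //.
    + by move=> w _; rewrite lee_fin quad_var_ge0.
    + exact/measurable_EFinP.
    + by move=> w _; rewrite lee_fin.
  rewrite integral_cst//.
  by rewrite [X in (_ * X)%E](_ : _ = 1%E) ?mule1//; exact: probability_setT.
- by move=> t phi; exact: bounded_row_cos.
- move=> w qn ln.
  (* The partial sums are nondecreasing, so bounds at time n imply them at all earlier times. *)
  have chiT k : (k < n)%N -> chi k w.
    move=> kn; apply/andP; split.
      rewrite (le_trans _ qn)// ler_wpM2l ?sqr_ge0// /quad_var.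
      rewrite [leRHS](big_cat_nat (n := k.+1))//= lerDl.
      by apply: sumr_ge0 => j _; exact: cond_var_ge0.
    rewrite (le_trans _ ln)// ler_wpM2l ?sqr_ge0// /lindeberg_sum.
    rewrite [leRHS](big_cat_nat (n := k.+1))//= lerDl.
    by apply: sumr_ge0 => j _; exact: cond_lindeberg_ge0.
  rewrite /mart_sum /quad_var !mulr_sumr; split; apply: eq_big_nat => k /andP[_ kn].
    by rewrite /psi'/= chiT.
  by rewrite cond_var' chiT.
Qed.

End truncation.

(** * Passage to the limit *)

Section central_limit.
Variable psi : forall k, T k * X -> R.
Arguments psi : clear implicits.
Hypothesis mpsi : forall k, measurable_fun setT (psi k).
Hypothesis psi2_int : forall k w,
  (K k w).-integrable setT (EFin \o (fun y => psi k (w, y) ^+ 2)).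
Hypothesis psi_centered : forall k w, \int[K k w]_y psi k (w, y) = 0.
Variables (sigma2 : R) (Y : nat -> Omega -> R).
Hypothesis sigma2_ge0 : 0 <= sigma2.
Hypothesis mY : forall n, measurable_fun setT (Y n).

Let dev n w := n%:R^-1 * quad_var psi n w - sigma2.
Let lind e n w := n%:R^-1 *
  \sum_(0 <= j < n) cond_lindeberg psi (e / (Num.sqrt n%:R)^-1) j w.
Let rem n w := Y n w - (Num.sqrt n%:R)^-1 * mart_sum psi n w.

Hypothesis cvg_dev : forall eta, 0 < eta ->
  Pr [set w | eta <= `|dev n w|] @[n --> \oo] --> 0%E.
Hypothesis cvg_lind : forall e eta, 0 < e -> 0 < eta ->
  Pr [set w | eta <= `|lind e n w|] @[n --> \oo] --> 0%E.
Hypothesis cvg_rem : forall eta, 0 < eta ->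
  Pr [set w | eta <= `|rem n w|] @[n --> \oo] --> 0%E.

Let mdev n : measurable_fun setT (dev n).
Proof.
by apply: measurable_funB => //; apply: measurable_funM => //; exact: measurable_quad_varO.
Qed.

Let mlindO e n : measurable_fun setT (lind e n).
Proof.
apply: measurable_funM => //; apply: measurable_sum => j.
exact: measurable_cond_lindebergO.
Qed.

Let mrem n : measurable_fun setT (rem n).
Proof.
apply: measurable_funB => //; apply: measurable_funM => //.
exact: measurable_mart_sumO.
Qed.

Let bad eta n := [set w | eta <= `|dev n w|] `|`
  ([set w | eta <= `|lind eta n w|] `|` [set w | eta <= `|rem n w|]).

Let mbad eta n : measurable (bad eta n).
Proof. by do !apply: measurableU; exact: measurable_ge_norm. Qed.

Let bad_small eta e : 0 < eta -> 0 < e ->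
  \forall n \near \oo, fine (Pr (bad eta n)) <= e.
Proof.
move=> eta0 e0; have e30 : 0 < e / 3 by rewrite divr_gt0.
have H1 := cvg0_probability_near (cvg_dev eta0) e30.
have H2 := cvg0_probability_near (cvg_lind eta0 eta0) e30.
have H3 := cvg0_probability_near (cvg_rem eta0) e30.
near=> n.
rewrite (le_trans (fine_probabilityU_le _ _ _))//; [exact: measurable_ge_norm|..].
  by apply: measurableU; exact: measurable_ge_norm.
rewrite (_ : e = e / 3 + (e / 3 + e / 3)); last by field.
apply: lerD; first by near: n.
rewrite (le_trans (fine_probabilityU_le _ _ _))//; [exact: measurable_ge_norm..|].
by apply: lerD; near: n.
Unshelve. all: by end_near. Qed.

Let good eta n w : ~ bad eta n w ->
  [/\ `|dev n w| < eta, `|lind eta n w| < eta & `|rem n w| < eta].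
Proof.
by move=> /not_orP[/negP + /not_orP[/negP + /negP]]; rewrite -!ltNge.
Qed.

(** [truncated_row] at level sigma2 + eta, with [eta] serving as Lindeberg threshold, as bound on
    the Lindeberg sum and as accuracy. Off [bad eta n] neither truncation bound is exceeded. *)
Let row eta n : (0 < n)%N -> 0 < eta -> exists S V : Omega -> R, [/\
  measurable_fun setT S /\ measurable_fun setT V,
  forall w, 0 <= V w <= sigma2 + eta,
  (\int[Pr]_w (S w ^+ 2)%:E <= (sigma2 + eta)%:E)%E,
  forall t phi,
    `|\int[Pr]_w (expR (t ^+ 2 / 2 * V w) * cos (t * S w + phi)) - cos phi|
    <= expR (t ^+ 2 / 2 * (sigma2 + eta)) *
       ((t ^+ 2 / 2) ^+ 2 * (sigma2 + eta) * (eta ^+ 2 + eta) +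
         (`|t| ^+ 3 * eta * (sigma2 + eta) + 2 * t ^+ 2 * eta)) &
  forall w, ~ bad eta n w -> `|Y n w - S w| <= eta /\ `|V w - sigma2| <= eta].
Proof.
move=> n0 eta0.
have s0 : 0 <= sigma2 + eta by rewrite addr_ge0// ltW.
have [S [V [mSV V01 S2 SV good_SV]]] :=
  truncated_row mpsi psi2_int psi_centered n0 s0 (ltW eta0) (ltW eta0).
exists S, V; split=> // w /good[hdev hlind hrem].
have rE : (Num.sqrt n%:R)^-1 ^+ 2 = n%:R^-1 :> R by rewrite exprVn sqr_sqrtr.
move: good_SV; rewrite rE => /(_ w) [].
- have := ltW (le_lt_trans (ler_norm _) hdev); rewrite /dev; lra.
- exact: ltW (le_lt_trans (ler_norm _) hlind).
- by move=> -> ->; split; apply: ltW.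
Qed.

(** Off the bad event [V] is close to the constant sigma2 and [S] to [Y n], so exp(a sigma2) times
    the cosine mean of [Y n] is close to the compensated mean of the truncated row, hence to cos
    phi. *)
Let cos_cvg t phi : \int[Pr]_w cos (t * Y n w + phi) @[n --> \oo]
  --> expR (- (t ^+ 2 / 2 * sigma2)) * cos phi.
Proof.
set a := t ^+ 2 / 2.
have a0 : 0 <= a by rewrite divr_ge0// sqr_ge0.
pose E1 := expR (a * (sigma2 + 1)).
have E10 : 0 < E1 by exact: expR_gt0.
(* First line: replacing S by Y and V by sigma2 costs |t| + a, the bad event 2. Second line: the row
   error for eta <= 1, where eta^2 + eta <= 2 eta. *)
pose Cst := E1 * (`|t| + a + 2) +
  E1 * (a ^+ 2 * (sigma2 + 1) * 2 + (`|t| ^+ 3 * (sigma2 + 1) + 2 * t ^+ 2)).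
have s1_ge0 : 0 <= sigma2 + 1 by rewrite addr_ge0.
have Cst0 : 0 <= Cst.
  rewrite addr_ge0// mulr_ge0 ?(ltW E10)//; first by rewrite addr_ge0// addr_ge0.
  rewrite addr_ge0//; first by rewrite mulr_ge0// mulr_ge0// sqr_ge0.
  rewrite addr_ge0//; last by rewrite mulr_ge0// sqr_ge0.
  by rewrite mulr_ge0// exprn_ge0.
apply/cvgrPdist_le => e e_gt0.
pose eta := Num.min 1 (e / (Cst + 1)).
have Cst1 : 0 < Cst + 1 by rewrite ltr_wpDl.
have eta0 : 0 < eta by rewrite lt_min ltr01 divr_gt0.
have eta1 : eta <= 1 by rewrite ge_min lexx.
have etaC : eta * Cst <= e.
  rewrite (@le_trans _ _ (e / (Cst + 1) * Cst))//.
    by rewrite ler_wpM2r// ge_min lexx orbT.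
  by rewrite mulrAC ler_pdivrMr// ler_wpM2l ?(ltW e_gt0)// lerDl.
near=> n.
have n0 : (0 < n)%N by near: n; exact: nbhs_infty_gt.
have [S [V [[mS mV] V01 _ SV good_SV]]] := row n0 eta0.
have Es : expR (a * (sigma2 + eta)) <= E1 by rewrite ler_expR ler_wpM2l// lerD2l.
have Ea : expR (a * sigma2) <= E1 by rewrite ler_expR ler_wpM2l// lerDl.
have EV w : expR (a * V w) <= E1.
  rewrite (le_trans _ Es)// ler_expR ler_wpM2l//.
  by have /andP[] := V01 w.
have mcosf (h : Omega -> R) :
    measurable_fun setT h -> measurable_fun setT (fun x => cos (t * h x + phi)).
  move=> mh; apply: (@measurableT_comp _ _ _ _ _ _ (@cos R)).
    exact: continuous_measurable_fun (@continuous_cos R).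
  by apply: measurable_funD => //; exact: measurable_funM.
pose h1 w := expR (a * sigma2) * cos (t * Y n w + phi).
pose h2 w := expR (a * V w) * cos (t * S w + phi).
have mh1 : measurable_fun setT h1 by apply: measurable_funM => //; exact: mcosf.
have mh2 : measurable_fun setT h2.
  apply: measurable_funM; last exact: mcosf.
  apply: (@measurableT_comp _ _ _ _ _ _ (@expR R)) => //.
  exact: measurable_funM.
have h1M w : `|h1 w| <= E1.
  rewrite normrM ger0_norm ?expR_ge0// -[leRHS]mulr1.
  by rewrite ler_pM ?expR_ge0// cos_max.
have h2M w : `|h2 w| <= E1.
  rewrite normrM ger0_norm ?expR_ge0// -[leRHS]mulr1.
  by rewrite ler_pM ?expR_ge0// cos_max.
have i1 := bounded_integrable Pr mh1 h1M.
have i2 := bounded_integrable Pr mh2 h2M.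
have icos : Pr.-integrable setT (EFin \o (fun w => cos (t * Y n w + phi))).
  apply: (@bounded_integrable _ _ _ Pr _ 1); first exact: mcosf.
  by move=> w; exact: cos_max.
have diff : `|\int[Pr]_w h1 w - \int[Pr]_w h2 w| <=
    E1 * (`|t| + a) * eta + 2 * E1 * fine (Pr (bad eta n)).
  rewrite -RintegralB//; apply: norm_Rintegral_le => //.
  - exact: measurable_funB.
  - by rewrite mulr_ge0// ltW.
  - move=> w; rewrite indicE; case: (boolP (w \in _)) => wB.
      rewrite mulr1 (@le_trans _ _ (2 * E1))//.
        by rewrite (le_trans (ler_normB _ _))// (_ : 2 * E1 = E1 + E1) ?lerD//; ring.
      by rewrite lerDr mulr_ge0 ?(ltW eta0)// mulr_ge0 ?(ltW E10)// addr_ge0.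
    have [YS Vs] : `|Y n w - S w| <= eta /\ `|V w - sigma2| <= eta.
      by apply: good_SV => wB'; move: wB; rewrite notin_setE.
    rewrite mulr0 addr0.
    rewrite (_ : h1 w - h2 w = expR (a * sigma2) *
      (cos (t * Y n w + phi) - cos (t * S w + phi)) +
      (expR (a * sigma2) - expR (a * V w)) * cos (t * S w + phi)); last first.
      by rewrite /h1 /h2; ring.
    rewrite (le_trans (ler_normD _ _))//.
    rewrite [leRHS](_ : _ = E1 * `|t| * eta + E1 * a * eta); last by ring.
    apply: lerD.
      rewrite normrM ger0_norm ?expR_ge0// -mulrA ler_pM ?expR_ge0//.
      rewrite (le_trans (norm_cosB_le _ _))// (_ : _ - _ = t * (Y n w - S w)); last by ring.
      by rewrite normrM ler_wpM2l.
    rewrite normrM -[leRHS]mulr1 ler_pM ?cos_max//.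
    rewrite (le_trans (@norm_expRB_le _ _ _ (a * (sigma2 + 1)) _ _))//.
    + by rewrite ler_wpM2l// lerDl.
    + rewrite ler_wpM2l//; have /andP[_ /le_trans] := V01 w; apply.
      by rewrite lerD2l.
    + rewrite -/E1 -mulrBr normrM (ger0_norm a0) mulrA distrC.
      by rewrite ler_wpM2l// mulr_ge0// ltW.
have int1 : \int[Pr]_w h1 w = expR (a * sigma2) * \int[Pr]_w cos (t * Y n w + phi).
  by rewrite RintegralZl.
have -> : \int[Pr]_w cos (t * Y n w + phi) = expR (- (a * sigma2)) * \int[Pr]_w h1 w.
  by rewrite int1 mulrA -expRD addNr expR0 mul1r.
(* Removing the weight multiplies the error by exp(-a sigma2) <= 1. *)
rewrite -mulrBr normrM ger0_norm ?expR_ge0//.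
rewrite (@le_trans _ _ (1 * `|cos phi - \int[Pr]_w h1 w|))//.
  by rewrite ler_wpM2r// -expR0 ler_expR oppr_le0 mulr_ge0.
rewrite mul1r -(subrKA (\int[Pr]_w h2 w)) (le_trans (ler_normD _ _))//.
rewrite (le_trans _ etaC)// addrC [`|_ - \int[Pr]_w h1 w|]distrC [`|cos phi - _|]distrC.
have bn : fine (Pr (bad eta n)) <= eta by near: n; exact: bad_small.
rewrite /Cst mulrDr; apply: lerD.
  rewrite (le_trans diff)// (_ : eta * _ = E1 * (`|t| + a) * eta + 2 * E1 * eta); last by ring.
  by rewrite lerD2l ler_wpM2l// mulr_ge0// ltW.
rewrite (le_trans (SV t phi))// -/a.
rewrite (_ : eta * _ = E1 * (eta * (a ^+ 2 * (sigma2 + 1) * 2 + (`|t| ^+ 3 * (sigma2 + 1) + 2 * t ^+ 2)))); last by ring.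
have eta_ge0 := ltW eta0.
have seta : sigma2 + eta <= sigma2 + 1 by rewrite lerD2l.
have ee : eta ^+ 2 + eta <= 2 * eta by nra.
apply: ler_pM => //; rewrite ?expR_ge0//.
  rewrite addr_ge0// ?addr_ge0//.
  - by rewrite mulr_ge0// ?addr_ge0 ?sqr_ge0// mulr_ge0 ?sqr_ge0// addr_ge0.
  - by rewrite mulr_ge0 ?addr_ge0// mulr_ge0.
  - by rewrite mulr_ge0// mulr_ge0// sqr_ge0.
rewrite [leRHS]mulrDr; apply: lerD.
  rewrite -mulrA [leRHS](_ : _ = a ^+ 2 * ((sigma2 + 1) * (2 * eta))); last by ring.
  rewrite ler_wpM2l ?sqr_ge0//; apply: ler_pM => //; first by rewrite addr_ge0.
  by rewrite addr_ge0 ?sqr_ge0.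
rewrite [leRHS]mulrDr; apply: lerD; last by rewrite mulrC.
rewrite [leRHS](_ : _ = `|t| ^+ 3 * eta * (sigma2 + 1)); last by ring.
by rewrite ler_wpM2l// mulr_ge0.
Unshelve. all: by end_near. Qed.

Theorem martingale_clt : cvg_in_distribution Pr Y (centered_normal sigma2).
Proof.
apply: cos_cvg_in_distribution => //.
  move=> t phi; rewrite Rintegral_cos_centered_normal//.
  by rewrite mulrAC; exact: cos_cvg.
move=> e e0; have e20 : 0 < e / 2 by rewrite divr_gt0.
(* Tightness by Chebyshev for [S], whose second moment is at most sigma2 + 1: as L >= 1, (e/2) L^2
   >= (e/2) L >= sigma2 + 1. The threshold L + 1 below leaves room for |Y - S| <= 1. *)
pose L := 1 + 2 * (sigma2 + 1) / e.
have L1 : 1 <= L by rewrite lerDl divr_ge0 ?(ltW e0)// mulr_ge0// addr_ge0.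
have L0 : 0 < L by rewrite (lt_le_trans ltr01).
exists (L + 1); near=> n.
have n0 : (0 < n)%N by near: n; exact: nbhs_infty_gt.
have [S [V [[mS mV] V01 S2 _ good_SV]]] := row n0 ltr01.
have mA : measurable [set w | L + 1 < `|Y n w|].
  rewrite -[X in measurable X]setTI; apply: (measurable_fun_ltr (f := fun=> L + 1)) => //.
  exact: measurableT_comp.
have mSL := measurable_ge_norm L mS.
rewrite (@le_trans _ _ (fine (Pr (bad 1 n `|` [set w | L <= `|S w|]))))//.
  apply: fine_probability_le => //; first exact: measurableU.
  move=> w /= Yw; have [|/good_SV[YS _]] := pselect (bad 1 n w); first by left.
  right => /=; rewrite -(lerD2r 1) (le_trans (ltW Yw))//.
  by rewrite -[Y n w](subrK (S w)) addrC (le_trans (ler_normD _ _))// lerD2l.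
rewrite (le_trans (fine_probabilityU_le _ _ _))// [leRHS]splitr; apply: lerD.
  by near: n; exact: bad_small.
rewrite (le_trans (chebyshev_sqr mS L0 S2))//.
rewrite ler_pdivrMr ?exprn_gt0// (@le_trans _ _ (e / 2 * L))//.
  rewrite /L mulrDr mulr1 (_ : e / 2 * _ = sigma2 + 1); last by field; rewrite gt_eqF.
  by rewrite lerDr ltW.
by rewrite ler_wpM2l ?(ltW e20)// expr2 ler_peMr// ltW.
Unshelve. all: by end_near. Qed.

End central_limit.

End martingale_array_row.

(** * Consequences of a finite weighted distance *)

Section weighted_distance.
Context d (X : measurableType d) (R : realType).
Variables (W : X -> R) (K1 K2 : X -> {measure set X -> \bar R}) (c : R).
Hypothesis W_gt0 : forall x, 0 < W x.
Hypothesis wdist_le : (wdist_kernel W K1 K2 <= c%:E)%E.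

Lemma wdist_kernel_le x (h : X -> R) : measurable_fun setT h ->
  (forall y, `|h y| <= W y) ->
  (`| \int[K1 x]_y (h y)%:E - \int[K2 x]_y (h y)%:E | <= (c * W x)%:E)%E.
Proof.
move=> mh hW.
have h1 : (wnorm W h <= 1)%E.
  apply: ge_ereal_sup => _ [y _ <-].
  by rewrite lee_fin ler_pdivrMr// mul1r.
have d1 : (`| \int[K1 x]_y (h y)%:E - \int[K2 x]_y (h y)%:E |
    <= wdist_measure W (K1 x) (K2 x))%E.
  by apply: ereal_sup_ubound; exists h.
apply: (le_trans d1).
have : ((W x)^-1%:E * wdist_measure W (K1 x) (K2 x) <= c%:E)%E.
  by apply: le_trans wdist_le; apply: ereal_sup_ubound; exists x.
by rewrite muleC EFinM lee_pdivrMr.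
Qed.

(** [W] is itself a test function, and an infinite integral on one side against a finite one on the
    other would make the distance infinite. *)
Lemma wdist_kernel_integrable x (mW : measurable_fun setT W) :
  (K2 x).-integrable setT (EFin \o W) -> (K1 x).-integrable setT (EFin \o W).
Proof.
move=> i2; have W0 y : `|W y| = W y by rewrite gtr0_norm.
have W1 y : `|W y| <= W y by rewrite W0.
apply/integrableP; split; first exact/measurable_EFinP.
under eq_integral do rewrite /= W0.
have := wdist_kernel_le x mW W1.
have /fineK <- := integrable_fin_num measurableT i2.
case: (\int[K1 x]_y (W y)%:E)%E => [a|//|//].
by rewrite ltry.
Qed.

Lemma wdist_kernel_integrable_r x (mW : measurable_fun setT W) :
  (K1 x).-integrable setT (EFin \o W) -> (K2 x).-integrable setT (EFin \o W).
Proof.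
move=> i1; have W0 y : `|W y| = W y by rewrite gtr0_norm.
have W1 y : `|W y| <= W y by rewrite W0.
apply/integrableP; split; first exact/measurable_EFinP.
under eq_integral do rewrite /= W0.
have := wdist_kernel_le x mW W1.
have /fineK <- := integrable_fin_num measurableT i1.
case: (\int[K2 x]_y (W y)%:E)%E => [a|//|//].
by rewrite ltry.
Qed.

Lemma wdist_kernel_Rintegral x (h : X -> R) A : measurable_fun setT W ->
  measurable_fun setT h -> 0 < A -> (forall y, `|h y| <= A * W y) ->
  (K2 x).-integrable setT (EFin \o W) ->
  `|\int[K1 x]_y h y - \int[K2 x]_y h y| <= A * c * W x.
Proof.
move=> mW mh A0 hA i2; have i1 := wdist_kernel_integrable mW i2.
have hW y : `|A^-1 * h y| <= W y.
  by rewrite normrM gtr0_norm ?invr_gt0// mulrC ler_pdivrMr// mulrC.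
have mh' : measurable_fun setT (fun y => A^-1 * h y) by exact: measurable_funM.
have ih (m : {measure set X -> \bar R}) :
    m.-integrable setT (EFin \o W) -> m.-integrable setT (EFin \o (fun y => A^-1 * h y)).
  move=> iW; apply: (@le_integrable _ _ _ _ setT measurableT _ _ _ _ iW).
    exact/measurable_EFinP.
  by move=> y _; rewrite lee_fin (le_trans (hW y))// ler_norm.
have ih' (m : {measure set X -> \bar R}) :
    m.-integrable setT (EFin \o W) -> m.-integrable setT (EFin \o h).
  move=> iW; have := integrableZl measurableT A (ih m iW).
  by apply: eq_integrable => // y _; rewrite /= -EFinM mulVKf// gt_eqF.
have := wdist_kernel_le x mh' hW.
rewrite -[X in (`|X - _|)%E]fineK; last by apply: integrable_fin_num => //; exact: ih.
rewrite -[X in (`|_ - X|)%E]fineK; last by apply: integrable_fin_num => //; exact: ih.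
rewrite -EFinB lee_fin -!/(Rintegral _ _ (fun y => A^-1 * h y)) !RintegralZl ?ih'//.
rewrite -mulrBr normrM gtr0_norm ?invr_gt0// mulrC ler_pdivrMr//.
by rewrite -mulrA mulrC.
Qed.

End weighted_distance.

Section kernel_iterates.
Context d (X : measurableType d) (R : realType) (K : R.-pker X ~> X).

Lemma ge0_integral_kiterS n x (h : X -> \bar R) : measurable_fun setT h ->
  (forall y, 0 <= h y)%E ->
  (\int[kiter K n.+1 x]_y h y = \int[K x]_y \int[kiter K n y]_z h z)%E.
Proof.
move=> mh h0.
have <- := @integral_kcomp _ _ _ _ _ _ R K (kernel.kernel_snd (kiter K n)) x h h0 mh.
by apply: eq_measure_integral.
Qed.

End kernel_iterates.

(** * The Poisson equation for a single kernel, with moment bounds *)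

Section poisson_equation.
Context d (X : measurableType d) (R : realType) (K : R.-pker X ~> X)
  (m : probability X R).
Variables (V : X -> R) (alpha c rho : R).
Hypotheses (mV : measurable_fun setT V) (V_ge1 : forall x, 1 <= V x).
Hypotheses (alpha_gt0 : 0 < alpha) (alpha_le : 2 * alpha <= 1).
Hypotheses (rho_gt0 : 0 < rho) (rho_lt1 : rho < 1).
Hypothesis V_int : forall x, (K x).-integrable setT (EFin \o V).
Local Notation W := (fun x => V x `^ alpha).
Hypothesis ergodic : forall n,
  (wdist_kernel W (kiter K n) (fun=> m) <= (c * rho ^+ n)%:E)%E.
Variables (f : X -> R) (A : R).
Hypotheses (mf : measurable_fun setT f) (A_gt0 : 0 < A)
  (f_le : forall x, `|f x| <= A * W x).

Let V_gt0 x : 0 < V x. Proof. exact: lt_le_trans (V_ge1 x). Qed.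

Let W_gt0 x : 0 < W x. Proof. by rewrite powR_gt0. Qed.

Let W_ge1 x : 1 <= W x. Proof. by rewrite -(powRr0 (V x)) ler_powR// ltW. Qed.

Let mW : measurable_fun setT W.
Proof. exact: (measurableT_comp (measurable_powR alpha)). Qed.

Let W_le_V x : W x <= V x.
Proof. by rewrite ler1_powR//; move: alpha_gt0 alpha_le; lra. Qed.

Let W_int_K x : (K x).-integrable setT (EFin \o W).
Proof.
apply: (@le_integrable _ _ _ _ setT measurableT _ _ _ _ (V_int x)).
  exact/measurable_EFinP.
by move=> y _; rewrite lee_fin !gtr0_norm.
Qed.

(** The iterate of order 0 is a Dirac mass, for which [W] is integrable; its finite distance to [m]
    transfers this. *)
Lemma invariant_integrable : m.-integrable setT (EFin \o W).
Proof.
apply: (@wdist_kernel_integrable_r _ _ _ W (kiter K 0) (fun=> m) _ W_gt0 (ergodic 0) point mW).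
apply/integrableP; split; first exact/measurable_EFinP.
rewrite /= /kdirac integral_dirac//; last first.
  by apply/measurable_EFinP; exact: measurableT_comp.
by rewrite diracT mul1e ltry.
Qed.

Let W_int n x : (kiter K n x).-integrable setT (EFin \o W).
Proof. exact: (wdist_kernel_integrable W_gt0 (ergodic n) mW invariant_integrable). Qed.

Let le_W_int (k : {measure set X -> \bar R}) (h : X -> R) B :
  k.-integrable setT (EFin \o W) -> measurable_fun setT h ->
  (forall x, `|h x| <= B * W x) -> k.-integrable setT (EFin \o h).
Proof.
move=> iW mh hB.
apply: (@le_integrable _ _ _ _ setT measurableT _ _ _ _ (integrableZl measurableT B iW)).
  exact/measurable_EFinP.
by move=> y _; rewrite lee_fin (le_trans (hB y))// ler_norm.
Qed.

Lemma ergodic_bound n x (h : X -> R) B : measurable_fun setT h -> 0 < B ->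
  (forall y, `|h y| <= B * W y) ->
  `|markov_op (kiter K n) h x - \int[m]_y h y| <= B * (c * rho ^+ n) * W x.
Proof.
move=> mh B0 hB.
exact: (wdist_kernel_Rintegral W_gt0 (ergodic n) mW mh B0 hB invariant_integrable).
Qed.

(** The bound for n = 0 and the zero function already forces the sign. *)
Lemma ergodic_constant_ge0 : 0 <= c.
Proof.
have := @ergodic_bound 0 point (cst 0) 1 (measurable_cst _) ltr01.
rewrite expr0 mulr1 mul1r => /(_ _)/(le_trans (normr_ge0 _)).
rewrite pmulr_lge0//; apply=> y.
by rewrite normr0 mul1r ltW.
Qed.
Let c_ge0 := ergodic_constant_ge0.

Let mkiter n (h : X -> R) : measurable_fun setT h ->
  measurable_fun setT (markov_op (kiter K n) h).
Proof.
move=> mh; apply: (measurable_Rintegral_kernel (kiter K n) (G := h \o snd)).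
exact: measurableT_comp.
Qed.

Let kiter_le n (h : X -> R) B : measurable_fun setT h -> 0 < B ->
  (forall y, `|h y| <= B * W y) ->
  forall x, `|markov_op (kiter K n) h x| <= (B * (c * rho ^+ n) + `|\int[m]_y h y|) * W x.
Proof.
move=> mh B0 hB x; rewrite -[markov_op _ _ _](subrK (\int[m]_y h y)).
rewrite (le_trans (ler_normD _ _))// mulrDl lerD// ?ergodic_bound//.
by rewrite ler_peMr.
Qed.

(** The nonnegative identity is applied to f + A W and to W, then subtracted; the ergodic bound
    makes all the integrals finite. *)
Lemma markov_op_kiterS n x :
  markov_op (kiter K n.+1) f x = markov_op K (markov_op (kiter K n) f) x.
Proof.
have WW y : `|W y| <= 1 * W y by rewrite gtr0_norm// mul1r.
have W0 y : (0 <= (W y)%:E)%E by rewrite lee_fin ltW.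
have mEW : measurable_fun setT (EFin \o W) by exact/measurable_EFinP.
have iphi := le_W_int (W_int_K x) (mkiter n mf) (@kiter_le n f A mf A_gt0 f_le).
have ipsi := le_W_int (W_int_K x) (mkiter n mW) (@kiter_le n W 1 mW ltr01 WW).
have EW : markov_op (kiter K n.+1) W x = markov_op K (markov_op (kiter K n) W) x.
  rewrite /markov_op /Rintegral ge0_integral_kiterS//; congr fine.
  by apply: eq_integral => y _; rewrite fineK//; apply: integrable_fin_num => //.
pose F y := f y + A * W y.
have F0 y : (0 <= (F y)%:E)%E.
  by rewrite lee_fin /F; have := f_le y; rewrite ler_norml => /andP[]; lra.
have mF : measurable_fun setT F by apply: measurable_funD => //; exact: measurable_funM.
have iA k y : (kiter K k y).-integrable setT (EFin \o (fun y => A * W y)).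
  exact: (integrableZl measurableT A (W_int k y)).
have if_ k y := le_W_int (W_int k y) mf f_le.
have EF k y : (\int[kiter K k y]_z (F z)%:E)%E =
    (markov_op (kiter K k) f y + A * markov_op (kiter K k) W y)%:E.
  rewrite /markov_op -RintegralZl// -RintegralD// /Rintegral fineK//.
  apply: integrable_fin_num => //; exact: (integrableD measurableT (if_ k y) (iA k y)).
have := ge0_integral_kiterS K n x (proj2 (measurable_EFinP _ _) mF) F0.
rewrite EF; under eq_integral do rewrite EF.
move=> /(congr1 fine) /=; rewrite -/(Rintegral _ _ _) RintegralD//; last first.
  exact: (integrableZl measurableT A ipsi).
by rewrite RintegralZl// => E; apply: (@addIr _ (A * markov_op (kiter K n.+1) W x)); rewrite E EW.
Qed.

Let g := poisson_sol K m f.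
Let u x n := markov_op (kiter K n) f x - \int[m]_y f y.

Let u_le x n : `|u x n| <= A * c * W x * rho ^+ n.
Proof. by have := ergodic_bound n x mf A_gt0 f_le; rewrite /u; nra. Qed.

Let B := A * c / (1 - rho).
Let B_ge0 : 0 <= B.
Proof. by rewrite divr_ge0 ?subr_ge0 ?(ltW rho_lt1)// mulr_ge0// ltW. Qed.

Let ACW_ge0 x : 0 <= A * c * W x.
Proof. by rewrite mulr_ge0 ?(ltW (W_gt0 x))// mulr_ge0// ltW. Qed.

Lemma poisson_series_cvg x : series (u x) n @[n --> \oo] --> g x.
Proof.
apply: normed_cvg; apply: (@series_le_cvg _ _ (geometric (A * c * W x) rho)).
- by move=> n; exact: normr_ge0.
- by move=> n; rewrite geometric_ge0// ltW.
- by move=> n; exact: u_le.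
- by apply: is_cvg_geometric_series; rewrite gtr0_norm.
Qed.

Let series_le x n : `|series (u x) n| <= B * W x.
Proof.
rewrite (le_trans (ler_norm_sum _ _ _))//.
rewrite (@le_trans _ _ (series (geometric (A * c * W x) rho) n))//.
  by apply: ler_sum => k _; exact: u_le.
rewrite (le_trans (geometric_le_lim n _ _ _))// ?gtr0_norm//.
by rewrite /B mulrAC.
Qed.

Lemma poisson_sol_le x : `|g x| <= B * W x.
Proof.
have /cvg_norm gx := @poisson_series_cvg x.
rewrite -(cvg_lim _ gx)//; apply: limr_le; first exact: cvgP gx.
by apply: nearW => n; exact: series_le.
Qed.

Let mseries n : measurable_fun setT (fun x => series (u x) n).
Proof. by apply: measurable_sum => k; apply: measurable_funB => //; exact: mkiter. Qed.

Lemma measurable_poisson_sol : measurable_fun setT g.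
Proof. by apply: (measurable_fun_cvg (h := fun n x => series (u x) n)) => // x _; exact: poisson_series_cvg. Qed.
Let mg := measurable_poisson_sol.

Lemma poisson_sol_integrable x : (K x).-integrable setT (EFin \o g).
Proof. exact: le_W_int (W_int_K x) mg poisson_sol_le. Qed.

(** Applying [K] to the n-th partial sum gives the next one minus the initial term f - m(f).
    Dominated convergence passes to the limit, since all partial sums are at most B W. *)
Lemma poisson_equation x : markov_op K g x = g x - f x + \int[m]_y f y.
Proof.
have mu k : measurable_fun setT (fun y => u y k) by apply: measurable_funB => //; exact: mkiter.
have iu k : (K x).-integrable setT (EFin \o (fun y => u y k)).
  apply: (le_W_int (B := A * c) (W_int_K x) (mu k)) => y.
  by rewrite (le_trans (u_le y k))// ler_piMr// exprn_ile1// ltW.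
have is_ n : (K x).-integrable setT (EFin \o (fun y => series (u y) n)).
  by apply: le_W_int (W_int_K x) (mseries n) _ => y; exact: series_le.
have E n : \int[K x]_y series (u y) n = series (u x) n.+1 - u x 0%N.
  elim: n => [|n IH].
    rewrite /series/= big_nat1 subrr.
    by under eq_Rintegral do rewrite big_geq//; rewrite Rintegral_cst// mul0r.
  rewrite [in RHS]seriesS -addrA -IH.
  under eq_Rintegral do rewrite seriesS.
  rewrite RintegralD//; congr (_ + _).
  rewrite /u markov_op_kiterS RintegralB//; last first.
  + by apply: (@kernel_bounded_integrable _ _ _ _ _ K x (cst (\int[m]_y f y)) `|\int[m]_y f y|).
  + by apply: le_W_int (W_int_K x) (mkiter n mf) _ => y; exact: (kiter_le n mf A_gt0 f_le).
  rewrite Rintegral_cst//.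
  have -> : fine (K x setT) = 1 by rewrite prob_kernel.
  by rewrite mulr1.
have u0 : u x 0%N = f x - \int[m]_y f y.
  rewrite /u /markov_op/= /kdirac /Rintegral integral_dirac ?diracT ?mul1e//.
  exact/measurable_EFinP.
have cvgK : \int[K x]_y series (u y) n @[n --> \oo] --> markov_op K g x.
  apply: fine_cvg; rewrite /markov_op /Rintegral fineK; last first.
    by apply: integrable_fin_num => //; exact: poisson_sol_integrable.
  apply: (@dominated_cvg _ _ _ (K x) setT measurableT _ _ (fun y => (B * W y)%:E)) => //.
  - by move=> n; exact/measurable_EFinP.
  - by move=> y _; apply: cvg_EFin; [exact: nearW|exact: (@poisson_series_cvg y)].
  - exact: (integrableZl measurableT B (W_int_K x)).
  - by move=> n y _; rewrite lee_fin series_le.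
rewrite -(cvg_lim _ cvgK)//; apply/cvg_lim => //.
under eq_fun do rewrite E u0.
rewrite (_ : g x - f x + _ = g x - (f x - \int[m]_y f y)); last by ring.
apply: cvgB; last exact: cvg_cst.
by rewrite (cvg_shiftS (series (u x))); exact: poisson_series_cvg.
Qed.

Local Notation p := (alpha^-1).
Local Notation T := (markov_op K V).
Local Notation L := (Num.max c (1 - rho)^-1).

Let p_ge2 : 2 <= p.
Proof. by rewrite -[leRHS]mul1r ler_pdivlMr. Qed.

Let p_ge0 : 0 <= p. Proof. by rewrite invr_ge0 ltW. Qed.

Let int1 x (b : R) : (K x).-integrable setT (EFin \o (fun=> b)).
Proof. by apply: (@kernel_bounded_integrable _ _ _ _ _ K x (cst b) `|b|). Qed.

Let K1 x (b : R) : \int[K x]_y b = b.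
Proof.
rewrite Rintegral_cst//; have -> : fine (K x setT) = 1 by rewrite prob_kernel.
by rewrite mulr1.
Qed.

Lemma markov_op_V_ge1 x : 1 <= T x.
Proof. by rewrite -[leLHS](K1 x) /markov_op; apply: le_Rintegral => //; exact: int1. Qed.
Let T_gt0 x : 0 < T x. Proof. exact: lt_le_trans (markov_op_V_ge1 x). Qed.

Let powRV z : 0 <= z -> (z `^ alpha) `^ p = z.
Proof. by move=> z0; rewrite -powRrM mulfV ?gt_eqF// powRr1. Qed.

(* Jensen's inequality up to the factor 2. *)
Lemma markov_op_W_le x : markov_op K W x <= 2 * T x `^ alpha.
Proof.
have T0 := T_gt0 x.
have le y : W y <= T x `^ alpha * (1 + (T x)^-1 * V y).
  have u0 : 0 < (T x)^-1 * V y by rewrite mulr_gt0// invr_gt0.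
  have -> : V y = T x * ((T x)^-1 * V y) by rewrite mulrA divff ?mul1r ?gt_eqF.
  rewrite powRM ?(ltW T0) ?(ltW u0)// ler_wpM2l ?powR_ge0// mulKf ?gt_eqF//.
  set v := _ * V y in u0 *.
  have [v1|v1] := leP v 1.
    rewrite (@le_trans _ _ 1)//; last by rewrite lerDl ltW.
    by rewrite -[leRHS](powRr0 v) ger_powR ?u0// ltW.
  rewrite (@le_trans _ _ v)//; last by rewrite lerDr.
  by rewrite ler1_powR// ltW//; move: alpha_gt0 alpha_le; lra.
have iV := integrableZl measurableT (T x)^-1 (V_int x).
have i2 := integrableZl measurableT (T x `^ alpha) (integrableD measurableT (int1 x 1) iV).
rewrite (@le_trans _ _ (\int[K x]_y (T x `^ alpha * (1 + (T x)^-1 * V y))))//.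
  exact: le_Rintegral.
rewrite RintegralZl//; last exact: (integrableD measurableT (int1 x 1) iV).
rewrite RintegralD// K1 RintegralZl// -/(T x) mulVf ?gt_eqF//.
by rewrite mulrC.
Qed.

Let Kg_leW x : `|markov_op K g x| <= B * (2 * T x `^ alpha).
Proof.
have ig := @poisson_sol_integrable x.
rewrite (le_trans (le_normr_Rintegral _ ig))//.
rewrite (@le_trans _ _ (B * markov_op K W x))//; last first.
  by rewrite ler_wpM2l// markov_op_W_le.
rewrite /markov_op -RintegralZl//; apply: le_Rintegral => //.
- exact: integrable_norm.
- exact: (integrableZl measurableT B (W_int_K x)).
- by move=> y _; exact: poisson_sol_le.
Qed.

Let L_ge0 : 0 <= L. Proof. by rewrite le_max c_ge0. Qed.

(** Both c and 1 / (1 - rho) are at most L. The square becomes the exponent 2/alpha of (A3b) after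
    raising to the power p. *)
Let B_le : B <= A * L ^+ 2.
Proof.
rewrite /B -mulrA ler_wpM2l ?(ltW A_gt0)// expr2; apply: ler_pM => //.
- by rewrite invr_ge0 subr_ge0 ltW.
- by rewrite le_max lexx.
- by rewrite le_max lexx orbT.
Qed.

Let powRB k : 0 <= k -> (k * B) `^ p <= (k * A) `^ p * L `^ (2 / alpha).
Proof.
move=> k0.
have -> : L `^ (2 / alpha) = (L ^+ 2) `^ p by rewrite powRrM powR_mulrn.
rewrite -powRM ?sqr_ge0//; last by rewrite mulr_ge0// ltW.
rewrite ge0_ler_powR//.
- by rewrite nnegrE mulr_ge0.
- by rewrite nnegrE mulr_ge0 ?sqr_ge0// mulr_ge0// ltW.
- by rewrite -mulrA ler_wpM2l.
Qed.

(** Serves for the boundary terms: the p-th power undoes the exponent alpha on P V, and the result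
    is a constant times a term of the sum in (A3b). *)
Lemma markov_op_poisson_sol_powR x :
  `|markov_op K g x| `^ p <= (2 * A) `^ p * (L `^ (2 / alpha) * T x).
Proof.
rewrite (@le_trans _ _ ((2 * B * T x `^ alpha) `^ p))//.
  rewrite ge0_ler_powR// ?nnegrE//; first by rewrite mulr_ge0 ?powR_ge0// mulr_ge0.
  by rewrite (le_trans (Kg_leW x))// mulrCA mulrA.
rewrite powRM ?powR_ge0//; last by rewrite mulr_ge0.
by rewrite powRV ?(ltW (T_gt0 x))// mulrA ler_wpM2r ?powRB// ltW.
Qed.

(** The condition 2 alpha <= 1 enters here: W^2 = V^(2 alpha) <= V. *)
Lemma poisson_sol_sqr_integrable x :
  (K x).-integrable setT (EFin \o (fun y => g y ^+ 2)).
Proof.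
have iV := integrableZl measurableT (B ^+ 2) (V_int x).
apply: (@le_integrable _ _ _ _ setT measurableT _ _ _ _ iV).
  by apply/measurable_EFinP; exact: measurable_funX.
move=> y _; rewrite lee_fin [leRHS]ger0_norm; last first.
  by rewrite mulr_ge0 ?sqr_ge0// ltW.
rewrite normrX (@le_trans _ _ ((B * W y) ^+ 2))//.
  by rewrite lerXn2r ?nnegrE// ?poisson_sol_le// mulr_ge0// ltW.
rewrite exprMn ler_wpM2l ?sqr_ge0// -powR_mulrn ?powR_ge0// -powRrM.
by rewrite ler1_powR// mulrC.
Qed.

Definition poisson_increment x y := g y - markov_op K g x.

Lemma poisson_increment_sqr_integrable x :
  (K x).-integrable setT (EFin \o (fun y => poisson_increment x y ^+ 2)).
Proof.
have i1 := integrableZl measurableT (2 * markov_op K g x) (@poisson_sol_integrable x).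
have := integrableD measurableT (integrableB measurableT (@poisson_sol_sqr_integrable x) i1)
  (int1 x (markov_op K g x ^+ 2)).
apply: eq_integrable => // y _; rewrite /= -EFinB -EFinD; congr EFin.
by rewrite /poisson_increment; ring.
Qed.

Lemma poisson_increment_centered x : \int[K x]_y poisson_increment x y = 0.
Proof.
rewrite /poisson_increment RintegralB ?K1 ?subrr//.
exact: poisson_sol_integrable.
Qed.

Lemma poisson_increment_var x : \int[K x]_y (poisson_increment x y ^+ 2) =
  markov_op K (fun y => g y ^+ 2) x - markov_op K g x ^+ 2.
Proof.
have i1 := integrableZl measurableT (2 * markov_op K g x) (@poisson_sol_integrable x).
have i2 := @poisson_sol_sqr_integrable x.
transitivity (\int[K x]_y (g y ^+ 2 - 2 * markov_op K g x * g y + markov_op K g x ^+ 2)).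
  by apply: eq_Rintegral => y _; rewrite /poisson_increment; ring.
rewrite RintegralD//; last exact: (integrableB measurableT i2 i1).
rewrite RintegralB// K1 RintegralZl//; last exact: poisson_sol_integrable.
by rewrite /markov_op; ring.
Qed.

(** Where |z| > e, z^2 <= e^(2 - p) |z|^p because p >= 2, and |z|^p is at most a constant times V(y)
    + P V(x). Integrating in y turns this sum into 2 P V(x). *)
Lemma poisson_increment_lindeberg e x : 0 < e ->
  \int[K x]_y (if e < `|poisson_increment x y| then poisson_increment x y ^+ 2 else 0)
  <= e `^ (2 - p) * (2 * (3 * A) `^ p * (L `^ (2 / alpha) * T x)).
Proof.
move=> e0; set q := 3 * B.
have q0 : 0 <= q by rewrite mulr_ge0.
have T0 := ltW (T_gt0 x).
have iVT : (K x).-integrable setT (EFin \o (fun y => V y + T x)).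
  exact: (integrableD measurableT (V_int x) (int1 x (T x))).
have iR : (K x).-integrable setT
    (EFin \o (fun y => e `^ (2 - p) * q `^ p * (V y + T x))).
  exact: (integrableZl measurableT _ iVT).
rewrite (@le_trans _ _ (\int[K x]_y (e `^ (2 - p) * q `^ p * (V y + T x))))//; last first.
  rewrite RintegralZl// RintegralD// K1 -/(T x) -mulrA ler_wpM2l ?powR_ge0//.
  rewrite [leRHS](_ : _ = (3 * A) `^ p * L `^ (2 / alpha) * (T x + T x)); last by ring.
  by rewrite ler_wpM2r ?addr_ge0// powRB.
(* Both V(y) and P V(x) are replaced by their maximum M. The solution contributes B M^alpha and its
   image under [K] contributes 2 B M^alpha, whence q = 3 B. *)
have bound y : `|poisson_increment x y| `^ p <= q `^ p * (V y + T x).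
  set M := Num.max (V y) (T x).
  have M0 : 0 <= M by rewrite le_max T0 orbT.
  rewrite (@le_trans _ _ ((q * M `^ alpha) `^ p))//; last first.
    rewrite powRM ?powR_ge0// powRV// ler_wpM2l ?powR_ge0// ge_max.
    by rewrite lerDl T0 lerDr (ltW (V_gt0 y)).
  rewrite ge0_ler_powR// ?nnegrE//; first by rewrite mulr_ge0 ?powR_ge0.
  rewrite (le_trans (ler_normB _ _))//.
  rewrite (_ : q * M `^ alpha = B * M `^ alpha + B * (2 * M `^ alpha)); last by rewrite /q; ring.
  apply: lerD.
    rewrite (le_trans (@poisson_sol_le y))// ler_wpM2l// ge0_ler_powR ?nnegrE ?(ltW alpha_gt0) ?(ltW (V_gt0 y))//.
    by rewrite le_max lexx.
  rewrite (le_trans (Kg_leW x))// ler_wpM2l// ler_wpM2l//.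
  rewrite ge0_ler_powR ?nnegrE ?(ltW alpha_gt0)//.
  by rewrite le_max lexx orbT.
apply: le_Rintegral => //.
  apply: (@le_integrable _ _ _ _ setT measurableT _ _ _ _ (@poisson_increment_sqr_integrable x)).
    apply/measurable_EFinP; apply: measurable_fun_ifT => //.
      apply: measurable_fun_ltr => //; apply: measurableT_comp => //.
      exact: measurable_funB.
    by apply: measurable_funX; exact: measurable_funB.
  by move=> y _; rewrite lee_fin; case: ifP => // _; rewrite normr0.
move=> y _; set z := poisson_increment x y.
case: ltP => [ez|_]; last first.
  by rewrite mulr_ge0 ?mulr_ge0 ?powR_ge0// addr_ge0// ltW.
have z0 : 0 < `|z| by rewrite (lt_trans e0).
rewrite -mulrA (@le_trans _ _ (e `^ (2 - p) * `|z| `^ p))//; last first.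
  by rewrite ler_wpM2l ?powR_ge0 ?bound.
rewrite -real_normK ?num_real// -powR_mulrn//.
have -> : `|z| `^ 2%:R = `|z| `^ (2 - p) * `|z| `^ p.
  by rewrite -powRD ?subrK// (gt_eqF z0) implybT.
rewrite ler_wpM2r ?powR_ge0//.
rewrite -[2 - p]opprB !powRN lef_pV2 ?posrE ?powR_gt0//.
by rewrite ge0_ler_powR ?nnegrE ?subr_ge0 ?(ltW e0)// ltW.
Qed.

End poisson_equation.

Section kernel_precomposition.
Context d1 d2 d3 (T : measurableType d1) (Y : measurableType d2) (Z : measurableType d3)
  (R : realType) (k : R.-pker Y ~> Z) (h : T -> Y).

Definition kprecomp (mh : measurable_fun setT h) : T -> {measure set Z -> \bar R} := k \o h.

Hypothesis mh : measurable_fun setT h.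

Let mkprecomp U : measurable U -> measurable_fun setT (kprecomp mh ^~ U).
Proof. by move=> mU; exact: (measurableT_comp (measurable_kernel k _ mU)). Qed.

HB.instance Definition _ := isKernel.Build _ _ _ _ _ (kprecomp mh) mkprecomp.

Let kprecomp_prob x : kprecomp mh x setT = 1%E.
Proof. exact: prob_kernel. Qed.

HB.instance Definition _ := Kernel_isProbability.Build _ _ _ _ _ (kprecomp mh) kprecomp_prob.

End kernel_precomposition.

(** * Joint measurability in the state and the parameter *)

Section parametric_kernel.
Context dX dT (X : measurableType dX) (Theta : measurableType dT) (R : realType).
Variable P : Theta -> R.-pker X ~> X.

Definition joint_kernel (hP : forall A, measurable A ->
    measurable_fun setT (fun z : X * Theta => P z.2 z.1 A)) :
  X * Theta -> {measure set X -> \bar R} := fun z => P z.2 z.1.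

Hypothesis hP : forall A, measurable A ->
  measurable_fun setT (fun z : X * Theta => P z.2 z.1 A).

HB.instance Definition _ := isKernel.Build _ _ _ _ _ (joint_kernel hP) hP.

Let joint_kernel_prob z : joint_kernel hP z setT = 1%E.
Proof. exact: prob_kernel. Qed.

HB.instance Definition _ := Kernel_isProbability.Build _ _ _ _ _ (joint_kernel hP)
  joint_kernel_prob.

Lemma measurable_markov_op (H : X * Theta -> R) : measurable_fun setT H ->
  measurable_fun setT (fun z : X * Theta => markov_op (P z.2) (fun y => H (y, z.2)) z.1).
Proof.
move=> mH.
apply: (measurable_Rintegral_kernel (joint_kernel hP)
  (G := fun zy : (X * Theta) * X => H (zy.2, zy.1.2))).
apply: (measurableT_comp mH); apply: measurable_fun_pair => //.
exact: measurableT_comp.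
Qed.

Variables (pi : Theta -> probability X R) (V : X -> R) (alpha : R) (C rho : Theta -> R).
Hypotheses (mV : measurable_fun setT V) (V_ge1 : forall x, 1 <= V x).
Hypotheses (alpha_gt0 : 0 < alpha) (alpha_le : 2 * alpha <= 1).
Hypotheses (rho_gt0 : forall th, 0 < rho th) (rho_lt1 : forall th, rho th < 1).
Hypothesis V_int : forall th x, (P th x).-integrable setT (EFin \o V).
Hypothesis ergodic : forall th n,
  (wdist_kernel (fun x => (V x `^ alpha)%R) (kiter (P th) n) (fun=> pi th)
     <= (C th * rho th ^+ n)%:E)%E.
Variables (f : X -> R) (A : R).
Hypotheses (mf : measurable_fun setT f) (A_gt0 : 0 < A)
  (f_le : forall x, `|f x| <= A * V x `^ alpha).

(** Iterates are formed for each parameter separately; joint measurability is recovered by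
    induction, writing the next iterate as P_theta applied to the previous function. *)
Lemma measurable_markov_op_kiter n :
  measurable_fun setT (fun z : X * Theta => markov_op (kiter (P z.2) n) f z.1).
Proof.
elim: n => [|n IH].
  rewrite (_ : (fun z => _) = f \o fst); first exact: measurableT_comp.
  apply/funext => z /=; rewrite /markov_op/= /kdirac /Rintegral integral_dirac ?diracT ?mul1e//.
  exact/measurable_EFinP.
rewrite (_ : (fun z => _) = fun z => markov_op (P z.2) (markov_op (kiter (P z.2) n) f) z.1).
  exact: (measurable_markov_op IH).
apply/funext => z.
exact: (markov_op_kiterS mV V_ge1 alpha_gt0 alpha_le (V_int z.2) (ergodic z.2) mf A_gt0 f_le).
Qed.

(** Measurability in theta of the invariant laws is derived, not assumed: the integral is the limit
    of P_theta^n f at a fixed state. *)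
Lemma measurable_invariant_integral :
  measurable_fun setT (fun th => \int[pi th]_y f y).
Proof.
apply: (measurable_fun_cvg (h := fun n th => markov_op (kiter (P th) n) f point)).
  move=> n; apply: (measurableT_comp (@measurable_markov_op_kiter n)
    (g := fun th : Theta => (point : X, th))).
  exact: measurable_pair1.
move=> th _; apply/subr_cvg0; apply: norm_cvg0.
have bound n := ergodic_bound mV V_ge1 (ergodic th) n point mf A_gt0 f_le.
apply: (@squeeze_cvgr _ _ _ _ (cst 0)
  (fun n => A * (C th * rho th ^+ n) * V point `^ alpha)).
- by apply: nearW => n /=; rewrite normr_ge0 bound.
- exact: cvg_cst.
- rewrite -(mul0r (V point `^ alpha)); apply: cvgM; last exact: cvg_cst.
  rewrite -(mulr0 A); apply: cvgM; first exact: cvg_cst.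
  rewrite -(mulr0 (C th)); apply: cvgM; first exact: cvg_cst.
  by apply: cvg_expr; rewrite gtr0_norm.
Qed.

Lemma measurable_joint_poisson_sol :
  measurable_fun setT (fun z : X * Theta => poisson_sol (P z.2) (pi z.2) f z.1).
Proof.
apply: (measurable_fun_cvg (h := fun n (z : X * Theta) =>
  series (fun n => markov_op (kiter (P z.2) n) f z.1 - \int[pi z.2]_y f y) n)).
  move=> n; apply: measurable_sum => k; apply: measurable_funB.
    exact: measurable_markov_op_kiter.
  exact: (measurableT_comp measurable_invariant_integral).
move=> z _.
exact: (poisson_series_cvg mV V_ge1 (rho_gt0 z.2) (rho_lt1 z.2) (ergodic z.2) mf A_gt0 f_le).
Qed.

End parametric_kernel.

Section weighted_norm.
Context d (X : measurableType d) (R : realType).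
Variables (W : X -> R) (W_gt0 : forall x, 0 < W x).

Lemma wnorm_le (h : X -> R) B : (forall x, `|h x| <= B * W x) -> (wnorm W h <= B%:E)%E.
Proof.
by move=> hB; apply: ge_ereal_sup => _ [x _ <-]; rewrite lee_fin ler_pdivrMr.
Qed.

Lemma norm_le_wnorm (h : X -> R) x : (wnorm W h < +oo)%E ->
  `|h x| <= fine (wnorm W h) * W x.
Proof.
have : ((`|h x| / W x)%:E <= wnorm W h)%E by apply: ereal_sup_ubound; exists x.
by case: (wnorm W h) => [b||]//; rewrite lee_fin ler_pdivrMr.
Qed.

End weighted_norm.

(** * The adaptive chain and its martingale decomposition *)

Section adaptive_chain.
Context dX dT dO (X : measurableType dX) (Theta : measurableType dT)
  (Omega : measurableType dO) (R : realType) (Pr : probability Omega R).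
Variables (F : nat -> set (set Omega)) (hF : is_filtration F).
Variables (P : Theta -> R.-pker X ~> X)
  (hP : forall A, measurable A ->
     measurable_fun setT (fun z : X * Theta => P z.2 z.1 A)).
Variables (Xn : nat -> Omega -> X) (theta : nat -> Omega -> Theta).
Hypothesis A1_adapted : forall n, submeasurable (F n) (fun w => (Xn n w, theta n w)).
Hypothesis A1_markov : forall (h : X -> R) (n : nat),
  measurable_fun setT h -> (exists M : R, forall x, `|h x| <= M) ->
  is_cond_exp Pr (F n) (fun w => h (Xn n.+1 w))
    (fun w => markov_op (P (theta n w)) h (Xn n w)).
Variables (pi : Theta -> probability X R) (V : X -> R) (alpha : R) (C rho : Theta -> R).
Hypotheses (mV : measurable_fun setT V) (V_ge1 : forall x, 1 <= V x).
Hypotheses (alpha_gt0 : 0 < alpha) (alpha_le : 2 * alpha <= 1).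
Hypotheses (rho_gt0 : forall th, 0 < rho th) (rho_lt1 : forall th, rho th < 1).
Hypothesis V_int : forall th x, (P th x).-integrable setT (EFin \o V).
Hypothesis ergodic : forall th n,
  (wdist_kernel (fun x => (V x `^ alpha)%R) (kiter (P th) n) (fun=> pi th)
     <= (C th * rho th ^+ n)%:E)%E.
Variables (f : X -> R) (A : R).
Hypotheses (mf : measurable_fun setT f) (A_gt0 : 0 < A)
  (f_le : forall x, `|f x| <= A * V x `^ alpha).

Variable sigma2 : R.

Local Notation T k := (g_sigma_algebraType (F k)).
Local Notation g th := (poisson_sol (P th) (pi th) f).
Local Notation Pg th := (markov_op (P th) (g th)).
Local Notation L th := (Num.max (C th) (1 - rho th)^-1).
Local Notation W := (fun x => V x `^ alpha).
Local Notation root n := (Num.sqrt n%:R)^-1.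
Local Notation p := (alpha^-1).
Local Notation q := ((2 * alpha)^-1).

Hypothesis A3a : cvg_in_probability Pr (fun n w => root n *
  \sum_(1 <= k < n.+1)
    fine (wnorm W (fun x => Pg (theta k w) x - Pg (theta k.-1 w) x)) * W (Xn k w)) 0.
Hypothesis A3b : cvg_in_probability Pr (fun n w => n%:R `^ (- q) *
  \sum_(0 <= k < n) L (theta k w) `^ (2 / alpha) * markov_op (P (theta k w)) V (Xn k w)) 0.
Hypothesis A4 : cvg_in_probability Pr (fun n w => n%:R^-1 *
  \sum_(0 <= k < n) (markov_op (P (theta k w)) (fun y => g (theta k w) y ^+ 2) (Xn k w)
    - Pg (theta k w) (Xn k w) ^+ 2)) sigma2.

Let h k (w : T k) := (Xn k w, theta k w).
Arguments h : clear implicits.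

Let mh k : measurable_fun setT (h k).
Proof. by move=> _ B mB; rewrite setTI filtration_measurableE//; exact: A1_adapted. Qed.
Arguments mh : clear implicits.

Let K k : R.-pker (T k) ~> X := kprecomp (joint_kernel hP) (mh k).
Arguments K : clear implicits.

Let Z k := Xn k.+1.

Let mZ k : measurable_fun setT (Z k : T k.+1 -> X).
Proof. exact: (measurableT_comp (f := fst) (g := h k.+1) measurable_fst (mh k.+1)). Qed.

Let psi k (z : T k * X) : R :=
  poisson_increment (P (theta k z.1)) (pi (theta k z.1)) f (Xn k z.1) z.2.
Arguments psi : clear implicits.

(** (A1) is used only for indicators of measurable sets. *)
Let kernelK k B D : F k B -> measurable D ->
  (Pr (B `&` Z k @^-1` D) = \int[Pr]_(w in B) K k w D)%E.
Proof.
move=> FB mD.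
have mB : measurable B by case: hF => _ + _ => /(_ k); exact.
have mXO : measurable_fun setT (Z k) by exact: (filtration_measurable_fun hF (mZ (k := k))).
have [] := @A1_markov (\1_D) k (measurable_indic mD).
  by exists 1 => x; rewrite ger0_norm// indicE lern1 leq_b1.
move=> _ _ _ /(_ B FB) E.
have mZD : measurable (Z k @^-1` D) by rewrite -[X in measurable X]setTI; exact: mXO.
rewrite setIC -(integral_indic Pr mB mZD).
transitivity (\int[Pr]_(w in B) (\1_D (Z k w))%:E)%E.
  by apply: eq_integral => w _; rewrite !indicE.
rewrite -E; apply: eq_integral => w _.
rewrite /markov_op /Rintegral integral_indic// setIT.
have -> : K k w D = P (theta k w) (Xn k w) D by [].
rewrite fineK// ge0_fin_numE//; apply: (@le_lt_trans _ _ (P (theta k w) (Xn k w) setT)).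
  by apply: le_measure; rewrite ?inE.
by rewrite prob_kernel ltry.
Qed.

Let mg := measurable_joint_poisson_sol hP mV V_ge1 alpha_gt0 alpha_le rho_gt0 rho_lt1
  V_int ergodic mf A_gt0 f_le.
Let mPg : measurable_fun setT (fun z : X * Theta => Pg z.2 z.1) := measurable_markov_op hP mg.
Let mpi := measurable_invariant_integral hP mV V_ge1 alpha_gt0 alpha_le rho_gt0 rho_lt1
  V_int ergodic mf A_gt0 f_le.

Let mpsi k : measurable_fun setT (psi k).
Proof.
have mh1 : measurable_fun setT (fun z : T k * X => h k z.1) by exact: measurableT_comp (mh k) _.
apply: measurable_funB; last exact: (measurableT_comp mPg mh1).
apply: (measurableT_comp mg (g := fun z : T k * X => (z.2, theta k z.1))).
apply: measurable_fun_pair => //.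
exact: (measurableT_comp measurable_snd mh1).
Qed.

Let psi2_int k w : (K k w).-integrable setT (EFin \o (fun y => psi k (w, y) ^+ 2)).
Proof.
exact: (poisson_increment_sqr_integrable mV V_ge1 alpha_gt0 alpha_le (rho_gt0 _) (rho_lt1 _)
  (V_int _) (ergodic _) mf A_gt0 f_le).
Qed.

Let psi_centered k w : \int[K k w]_y psi k (w, y) = 0.
Proof.
exact: (poisson_increment_centered mV V_ge1 alpha_gt0 alpha_le (rho_gt0 _) (rho_lt1 _)
  (V_int _) (ergodic _) mf A_gt0 f_le).
Qed.

Let W_gt0 x : 0 < W x.
Proof. by rewrite powR_gt0// (lt_le_trans ltr01). Qed.

Let W_ge1 x : 1 <= W x.
Proof. by rewrite -(powRr0 (V x)) ler_powR// ltW. Qed.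

Let p_gt0 : 0 < p. Proof. by rewrite invr_gt0. Qed.

(** Hence n^(-q) is the p-th power of n^(-1/2), which links p-th powers of normalised terms to
    (A3b). *)
Let q_half : q = 2^-1 * p. Proof. by rewrite invfM. Qed.

Let q_gt0 : 0 < q. Proof. by rewrite invr_gt0 mulr_gt0. Qed.

Let rootE n : root n = n%:R `^ (- 2^-1) :> R.
Proof. by rewrite powRN powR12_sqrt. Qed.

Let hO k (w : Omega) := (Xn k w, theta k w).

Let mhO k : measurable_fun setT (hO k).
Proof. exact: (filtration_measurable_fun hF (mh k)). Qed.

Let mX k : measurable_fun setT (Xn k).
Proof. exact: (measurableT_comp (f := fst) (g := hO k) measurable_fst (@mhO k)). Qed.

Let mtheta k : measurable_fun setT (theta k).
Proof. exact: (measurableT_comp (f := snd) (g := hO k) measurable_snd (@mhO k)). Qed.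

Let Y n w := root n *
  \sum_(1 <= k < n.+1) (f (Xn k w) - \int[pi (theta k.-1 w)]_x f x).

Let mY n : measurable_fun setT (Y n).
Proof.
apply: measurable_funM => //; apply: measurable_sum => k; apply: measurable_funB.
  exact: (measurableT_comp (f := f) (g := Xn k) mf (mX k)).
exact: (measurableT_comp (g := theta k.-1) mpi (mtheta k.-1)).
Qed.

Let B k w := L (theta k w) `^ (2 / alpha) * markov_op (P (theta k w)) V (Xn k w).

Let B_ge0 k w : 0 <= B k w.
Proof.
rewrite mulr_ge0 ?powR_ge0//; apply: le_trans ler01 _.
exact: (markov_op_V_ge1 V_ge1 (V_int _)).
Qed.

Let Q n w := n%:R `^ (- q) * \sum_(0 <= k < n) B k w.

Let Q_ge0 n w : 0 <= Q n w.
Proof. by rewrite mulr_ge0 ?powR_ge0// sumr_ge0. Qed.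

Let Q_cvg0 e : 0 < e -> Pr [set w | e <= `|Q n w|] @[n --> \oo] --> 0%E.
Proof.
by move=> e0; have [_ /(_ e e0)] := A3b; under eq_fun do under eq_set do rewrite subr0.
Qed.

Let mQ e n : measurable [set w | e <= `|Q n w|].
Proof. by apply: measurable_ge_norm; case: A3b => + _; exact. Qed.

Let cond_varE k w : cond_var K psi k w =
  markov_op (P (theta k w)) (fun y => g (theta k w) y ^+ 2) (Xn k w)
    - Pg (theta k w) (Xn k w) ^+ 2.
Proof.
exact: (poisson_increment_var mV V_ge1 alpha_gt0 alpha_le (rho_gt0 _) (rho_lt1 _)
  (V_int _) (ergodic _) mf A_gt0 f_le).
Qed.

Let cvg_quad_var e : 0 < e ->
  Pr [set w | e <= `|n%:R^-1 * quad_var K psi n w - sigma2|] @[n --> \oo] --> 0%E.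
Proof.
move=> e0; have [_ /(_ e e0)] := A4.
have E n w : quad_var K psi n w = \sum_(0 <= k < n)
    (markov_op (P (theta k w)) (fun y => g (theta k w) y ^+ 2) (Xn k w)
      - Pg (theta k w) (Xn k w) ^+ 2) by apply: eq_bigr => k _; exact: cond_varE.
by under [in X in _ -> X]eq_fun do under eq_set do rewrite E.
Qed.

(** If sigma2 were negative, nonnegative averages would always deviate from it by at least -sigma2,
    an event of probability 1. *)
Let sigma2_ge0 : 0 <= sigma2.
Proof.
rewrite leNgt; apply/negP => s0; have s1 : 0 < - sigma2 by rewrite oppr_gt0.
have h0 : 0 < 2^-1 :> R by rewrite invr_gt0.
have [N _ /(_ N (leqnn N))/=] := cvg0_probability_near (cvg_quad_var s1) h0.
rewrite (_ : [set w | _] = setT).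
  have -> : fine (Pr setT) = 1 by have -> := @probability_setT _ _ _ Pr.
  by rewrite leNgt invf_lt1// ltr1n.
apply/seteqP; split => // w _ /=; rewrite (le_trans _ (ler_norm _))// lerDr.
by rewrite mulr_ge0 ?invr_ge0// sumr_ge0// => j _; exact: cond_var_ge0.
Qed.

Let cond_lindeberg_le e k w : 0 < e ->
  cond_lindeberg K psi e k w <= e `^ (2 - p) * (2 * (3 * A) `^ p * B k w).
Proof.
exact: (poisson_increment_lindeberg mV V_ge1 alpha_gt0 alpha_le (rho_gt0 _) (rho_lt1 _)
  (V_int _) (ergodic _) mf A_gt0 f_le).
Qed.

(** Count of powers of n: (e n^(1/2))^(2 - p) / n = e^(2 - p) n^(-p/2), and p/2 is the exponent q of
    (A3b). *)
Let lindeberg_le e n w : 0 < e -> (0 < n)%N ->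
  n%:R^-1 * \sum_(0 <= j < n) cond_lindeberg K psi (e / root n) j w
    <= e `^ (2 - p) * (2 * (3 * A) `^ p) * Q n w.
Proof.
move=> e0 n0; have nR : 0 < n%:R :> R by rewrite ltr0n.
have r0 : 0 < e / root n by rewrite divr_gt0// invr_gt0 sqrtr_gt0.
rewrite (@le_trans _ _ (n%:R^-1 * \sum_(0 <= j < n)
    (e / root n) `^ (2 - p) * (2 * (3 * A) `^ p) * B j w))//.
  rewrite ler_wpM2l ?invr_ge0//; apply: ler_sum => j _.
  by rewrite -[in leRHS]mulrA; exact: cond_lindeberg_le.
have -> : (e / root n) `^ (2 - p) = e `^ (2 - p) * (n%:R * n%:R `^ (- q)).
  rewrite powRM ?(ltW e0) ?invrK ?sqrtr_ge0//; congr (_ * _).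
  rewrite -powR12_sqrt// -powRrM -[X in _ = X * _](powRr1 (ler0n R n)) -powRD.
    by rewrite q_half; congr (_ `^ _); lra.
  by apply/implyP => _; rewrite gt_eqF.
rewrite -mulr_sumr /Q; set S := \sum_(0 <= k < n) _.
by rewrite le_eqVlt; apply/orP; left; apply/eqP; field; rewrite gt_eqF.
Qed.

Let mcond_lindeberg e n : measurable_fun setT (fun w : Omega =>
  n%:R^-1 * \sum_(0 <= j < n) cond_lindeberg K psi e j w).
Proof.
apply: measurable_funM => //; apply: measurable_sum => k.
exact: (measurable_cond_lindebergO hF K (@mpsi) e k).
Qed.

Let cvg_lindeberg e eta : 0 < e -> 0 < eta ->
  Pr [set w | eta <= `|n%:R^-1 * \sum_(0 <= j < n) cond_lindeberg K psi (e / root n) j w|]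
    @[n --> \oo] --> 0%E.
Proof.
move=> e0 eta0; pose D := e `^ (2 - p) * (2 * (3 * A) `^ p).
have D0 : 0 < D by rewrite mulr_gt0 ?powR_gt0// mulr_gt0// powR_gt0// mulr_gt0.
apply: (@cvg0_probability_subset _ _ _ _ _ (fun n => [set w | eta / D <= `|Q n w|])).
- by move=> n; apply: measurable_ge_norm.
- by move=> n; exact: mQ.
- near=> n => w /=; have n0 : (0 < n)%N by near: n; exact: nbhs_infty_gt.
  rewrite ger0_norm; last first.
    rewrite mulr_ge0 ?invr_ge0// sumr_ge0// => j _; exact: cond_lindeberg_ge0.
  move=> /le_trans/(_ (lindeberg_le w e0 n0)).
  by rewrite ger0_norm// ler_pdivrMr// [in X in _ -> X]mulrC.
- by apply: Q_cvg0; rewrite divr_gt0.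
Unshelve. all: by end_near. Qed.

Let r k w := Pg (theta k w) (Xn k w).

Let mr k : measurable_fun setT (r k).
Proof.
exact: (measurableT_comp (f := fun z : X * Theta => Pg z.2 z.1) (g := hO k) mPg (@mhO k)).
Qed.

(** After raising to the power p, a large boundary term at index k forces the single term of index k
    in (A3b) to be large. *)
Let r_large eta n k w : 0 < eta -> (0 < n)%N -> eta <= `|root n * r k w| ->
  eta `^ p / (2 * A) `^ p <= n%:R `^ (- q) * B k w.
Proof.
move=> eta0 n0 le_eta; have A2 : 0 < (2 * A) `^ p by rewrite powR_gt0// mulr_gt0.
rewrite ler_pdivrMr//.
rewrite (@le_trans _ _ (`|root n * r k w| `^ p))//.
  by rewrite ge0_ler_powR// ?nnegrE ?(ltW eta0) ?(ltW p_gt0).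
rewrite normrM ger0_norm ?invr_ge0 ?sqrtr_ge0// [in leLHS]powRM ?invr_ge0 ?sqrtr_ge0//.
rewrite rootE -powRrM mulNr -q_half -mulrA ler_wpM2l ?powR_ge0//.
rewrite [leRHS]mulrC.
exact: (markov_op_poisson_sol_powR mV V_ge1 alpha_gt0 alpha_le (rho_gt0 _) (rho_lt1 _)
  (V_int _) (ergodic _) mf A_gt0 f_le).
Qed.

Let cvg_r0 eta : 0 < eta ->
  Pr [set w | eta <= `|root n * r 0 w|] @[n --> \oo] --> 0%E.
Proof.
move=> eta0; have A2 : 0 < (2 * A) `^ p by rewrite powR_gt0// mulr_gt0.
have D0 : 0 < eta `^ p / (2 * A) `^ p by rewrite divr_gt0// powR_gt0.
apply: (cvg0_probability_subset _ _ _ (Q_cvg0 D0)) => [n|n|].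
- by apply: measurable_ge_norm; apply: measurable_funM => //; exact: mr.
- exact: mQ.
- near=> n => w /=; have n0 : (0 < n)%N by near: n; exact: nbhs_infty_gt.
  move=> /(r_large eta0 n0)/le_trans; apply; rewrite ger0_norm// ler_wpM2l ?powR_ge0//.
  by rewrite big_ltn// lerDl sumr_ge0.
Unshelve. all: by end_near. Qed.

(** Index n is missing from the sum in [Q n], so [Q n.+1] is used; n + 1 <= 2 n gives 2^(-q) n^(-q)
    <= (n + 1)^(-q), the origin of the factor in [D0]. *)
Let cvg_r eta : 0 < eta ->
  Pr [set w | eta <= `|root n * r n w|] @[n --> \oo] --> 0%E.
Proof.
move=> eta0; have A2 : 0 < (2 * A) `^ p by rewrite powR_gt0// mulr_gt0.
have D0 : 0 < 2 `^ (- q) * (eta `^ p / (2 * A) `^ p).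
  by rewrite mulr_gt0 ?powR_gt0// divr_gt0// powR_gt0.
have := Q_cvg0 D0; rewrite -(cvg_shiftS (fun n => Pr [set w | _ <= `|Q n w|])).
apply: cvg0_probability_subset => [n|n|].
- by apply: measurable_ge_norm; apply: measurable_funM => //; exact: mr.
- exact: mQ.
- near=> n => w /=; have n0 : (0 < n)%N by near: n; exact: nbhs_infty_gt.
  move=> /(r_large eta0 n0) H; rewrite ger0_norm//.
  rewrite (@le_trans _ _ (n.+1%:R `^ (- q) * B n w))//; last first.
    by rewrite ler_wpM2l ?powR_ge0// big_nat_recr//= lerDr sumr_ge0.
  rewrite (@le_trans _ _ (2 `^ (- q) * (n%:R `^ (- q) * B n w)))//.
    by rewrite ler_wpM2l ?powR_ge0.
  rewrite mulrA ler_wpM2r// -powRM// !powRN lef_pV2 ?posrE ?powR_gt0// ?mulr_gt0 ?ltr0n//.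
  rewrite ge0_ler_powR ?nnegrE ?(ltW q_gt0)//.
  by rewrite -natrM ler_nat mul2n -addnn -addn1 leq_add2l.
Unshelve. all: by end_near. Qed.

Let Pg_le th : exists b, forall x, `|Pg th x| <= b * W x.
Proof.
have eqn := poisson_equation mV V_ge1 alpha_gt0 alpha_le (rho_gt0 th) (rho_lt1 th)
  (V_int th) (ergodic th) mf A_gt0 f_le.
have gle := poisson_sol_le mV V_ge1 (rho_gt0 th) (rho_lt1 th) (ergodic th) mf A_gt0 f_le.
exists (A * C th / (1 - rho th) + A + `|\int[pi th]_y f y|) => x.
rewrite eqn !mulrDl (le_trans (ler_normD _ _))// lerD//.
  by rewrite (le_trans (ler_normB _ _))// lerD.
by rewrite ler_peMr.
Qed.

(** The norm must be shown finite, since [fine] sends an infinite value to 0. Finiteness comes from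
    [Pg_le] at both parameters. *)
Let shift_le k w : `|Pg (theta k.+1 w) (Xn k.+1 w) - Pg (theta k w) (Xn k.+1 w)| <=
  fine (wnorm W (fun x => Pg (theta k.+1 w) x - Pg (theta k w) x)) * W (Xn k.+1 w).
Proof.
have [b1 Pg1] := Pg_le (theta k.+1 w); have [b2 Pg2] := Pg_le (theta k w).
apply: (norm_le_wnorm W_gt0 (h := fun x => Pg (theta k.+1 w) x - Pg (theta k w) x)).
apply: (@le_lt_trans _ _ (b1 + b2)%:E); last exact: ltry.
apply: (wnorm_le W_gt0) => x.
by rewrite mulrDl (le_trans (ler_normB _ _))// lerD.
Qed.

(** Induction on n; each step is the Poisson equation for theta_n at the point X_{n+1}. *)
Let sum_decomposition n w :
  \sum_(1 <= k < n.+1) (f (Xn k w) - \int[pi (theta k.-1 w)]_x f x) - mart_sum Z psi n w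
  = r 0 w - r n w + \sum_(0 <= k < n)
      (Pg (theta k.+1 w) (Xn k.+1 w) - Pg (theta k w) (Xn k.+1 w)).
Proof.
have eqn th := poisson_equation mV V_ge1 alpha_gt0 alpha_le (rho_gt0 th) (rho_lt1 th)
  (V_int th) (ergodic th) mf A_gt0 f_le.
rewrite big_add1/= /mart_sum; elim: n => [|n IH]; first by rewrite !big_geq// !subrr addr0.
rewrite !big_nat_recr//= [in LHS]opprD addrACA IH /psi/= /poisson_increment /r /Z.
rewrite (eqn (theta n w) (Xn n.+1 w)); ring.
Qed.

Let S n w := root n * \sum_(1 <= k < n.+1)
  fine (wnorm W (fun x => Pg (theta k w) x - Pg (theta k.-1 w) x)) * W (Xn k w).

Let mS n : measurable_fun setT (S n).
Proof. by case: A3a => + _; exact. Qed.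

Let S_cvg0 e : 0 < e -> Pr [set w | e <= `|S n w|] @[n --> \oo] --> 0%E.
Proof.
by move=> e0; have [_ /(_ e e0)] := A3a; under eq_fun do under eq_set do rewrite subr0.
Qed.

Let cvg_remainder eta : 0 < eta ->
  Pr [set w | eta <= `|Y n w - root n * mart_sum Z psi n w|] @[n --> \oo] --> 0%E.
Proof.
move=> eta0; have e3 : 0 < eta / 3 by rewrite divr_gt0.
have mE (u : nat -> Omega -> R) : (forall n, measurable_fun setT (u n)) ->
  forall n, measurable [set w | eta / 3 <= `|u n w|].
  by move=> mu n; exact: measurable_ge_norm.
have mrn k n : measurable_fun setT (fun w => root n * r k w).
  by apply: measurable_funM => //; exact: mr.
have m0 := mE (fun n w => root n * r 0 w) (mrn 0%N).
have mn := mE (fun n w => root n * r n w) (fun n => mrn n n).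
have mSn := mE S mS.
have m0n n := measurableU _ _ (m0 n) (mn n).
have U := cvg0_probabilityU m0n mSn (cvg0_probabilityU m0 mn (cvg_r0 e3) (cvg_r e3))
  (S_cvg0 e3).
apply: (cvg0_probability_subset _ _ _ U) => [n|n|].
- apply: measurable_ge_norm; apply: measurable_funB; first exact: mY.
  by apply: measurable_funM => //; exact: (measurable_mart_sumO hF (@mZ) (@mpsi)).
- by apply: measurableU; [exact: m0n|exact: mSn].
apply: nearW => n w /= le_eta; apply: contrapT => /not_orP[/not_orP[]].
move=> /negP; rewrite -ltNge => r0 /negP; rewrite -ltNge => rn /negP; rewrite -ltNge => Sn.
have : `|Y n w - root n * mart_sum Z psi n w| < eta / 3 + eta / 3 + eta / 3.
  rewrite -mulrBr sum_decomposition mulrDr (le_lt_trans (ler_normD _ _))// ltr_leD//.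
    by rewrite mulrBr (le_lt_trans (ler_normB _ _))// ltrD.
  rewrite (le_trans _ (ltW Sn))// (le_trans _ (ler_norm _))// normrM.
  rewrite ger0_norm ?invr_ge0 ?sqrtr_ge0// ler_wpM2l ?invr_ge0 ?sqrtr_ge0//.
  rewrite big_add1/= (le_trans (ler_norm_sum _ _ _))//.
  by apply: ler_sum => k _; exact: shift_le.
by apply/negP; rewrite -leNgt (le_trans _ le_eta)//; lra.
Qed.

Lemma adaptive_clt : cvg_in_distribution Pr Y (centered_normal sigma2).
Proof.
exact: (martingale_clt hF (@mZ) (@kernelK) (@mpsi) psi2_int psi_centered sigma2_ge0 mY
  cvg_quad_var cvg_lindeberg cvg_remainder).
Qed.

End adaptive_chain.

Theorem theorem2p2 (R : realType) (dX dT dO : measure_display)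
  (X : measurableType dX) (Theta : measurableType dT)
  (Omega : measurableType dO) (Pr : probability Omega R)
  (F : nat -> set (set Omega)) (hF : is_filtration F)
  (P : Theta -> R.-pker X ~> X)
  (hP : forall A, measurable A ->
     measurable_fun setT (fun z : X * Theta => P z.2 z.1 A))
  (Xn : nat -> Omega -> X) (theta : nat -> Omega -> Theta)
  (A1_adapted : forall n, submeasurable (F n) (fun w => (Xn n w, theta n w)))
  (A1_markov : forall (h : X -> R) (n : nat),
     measurable_fun setT h -> (exists M : R, forall x, `|h x| <= M) ->
     is_cond_exp Pr (F n) (fun w => h (Xn n.+1 w))
       (fun w => markov_op (P (theta n w)) h (Xn n w)))
  (V : X -> R) (mV : measurable_fun setT V) (V_ge1 : forall x, 1 <= V x)
  (A2_irreducible : forall th, phi_irreducible (P th))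
  (A2_aperiodic : forall th, aperiodic (P th))
  (A2_drift : forall th, exists b lambda : R,
     [/\ 1 < b, 0 < lambda, lambda < 1 &
       forall x, (\int[P th x]_y (V y)%:E <= (lambda * V x + b)%:E)%E])
  (A2_small : forall th (d : R), 1 <= d -> one_small (P th) [set x | V x <= d])
  (pi : Theta -> probability X R)
  (pi_invariant : forall th, invariant_measure (P th) (pi th))
  (alpha : R) (alpha_gt0 : 0 < alpha) (alpha_lt : alpha < 2^-1)
  (C rho : Theta -> R)
  (rho_gt0 : forall th, 0 < rho th) (rho_lt1 : forall th, rho th < 1)
  (P_alpha : forall th (n : nat) (gamma : R), alpha <= gamma -> gamma <= 1 ->
     (wdist_kernel (fun x => (V x `^ gamma)%R) (kiter (P th) n) (fun=> pi th)
        <= (C th * rho th ^+ n)%:E)%E)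
  (Mset : set (X -> R)) (hM : Mset `<=` wspace (fun x => V x `^ alpha))
  (A3a : forall f, Mset f ->
     let PLambda th := markov_op (P th) (poisson_sol (P th) (pi th) f) in
     cvg_in_probability Pr (fun n w => (Num.sqrt n%:R)^-1 *
       \sum_(1 <= k < n.+1)
         fine (wnorm (fun x => V x `^ alpha)
           (fun x => PLambda (theta k w) x - PLambda (theta k.-1 w) x))
         * V (Xn k w) `^ alpha) 0)
  (A3b : let L th := Num.max (C th) (1 - rho th)^-1 in
     cvg_in_probability Pr (fun n w => n%:R `^ (- (2 * alpha)^-1) *
       \sum_(0 <= k < n) L (theta k w) `^ (2 / alpha)
         * markov_op (P (theta k w)) V (Xn k w)) 0)
  (sigma2 : (X -> R) -> R)
  (A4 : forall f, Mset f ->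
     let Lambda th := poisson_sol (P th) (pi th) f in
     let Ff th x := markov_op (P th) (fun y => Lambda th y ^+ 2) x
                    - markov_op (P th) (Lambda th) x ^+ 2 in
     cvg_in_probability Pr (fun n w => n%:R^-1 *
       \sum_(0 <= k < n) Ff (theta k w) (Xn k w)) (sigma2 f)) :
  forall f, Mset f ->
    cvg_in_distribution Pr (fun n w => (Num.sqrt n%:R)^-1 *
      \sum_(1 <= k < n.+1)
        (f (Xn k w) - \int[pi (theta k.-1 w)]_x f x))
      (centered_normal (sigma2 f)).
Proof.
move=> f Mf; have [mf f_fin] := hM f Mf.
have W_gt0 x : 0 < V x `^ alpha by rewrite powR_gt0// (lt_le_trans ltr01).
have n_ge0 : 0 <= fine (wnorm (fun x => V x `^ alpha) f).
  rewrite -(pmulr_lge0 _ (W_gt0 point)).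
  exact: le_trans (normr_ge0 _) (norm_le_wnorm W_gt0 point f_fin).
(* The constant [A] is the weighted norm of f plus 1, so that it is positive even for f = 0. *)
apply: (adaptive_clt hF hP A1_adapted A1_markov mV V_ge1 alpha_gt0 _ rho_gt0 rho_lt1 _ _
  mf (ltr_pwDr ltr01 n_ge0) _ (A3a f Mf) A3b (A4 f Mf)).
- by move: alpha_lt; lra.
(* The drift inequality makes [V] integrable under every P_theta(x, .). *)
- move=> th x; have [b [lambda [_ _ _ drift]]] := A2_drift th.
  apply/integrableP; split; first exact/measurable_EFinP.
  apply: le_lt_trans (ltry (lambda * V x + b)); apply: le_trans (drift x).
  rewrite le_eqVlt; apply/orP; left; apply/eqP; apply: eq_integral => y _ /=.
  by rewrite ger0_norm// (le_trans ler01).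
- by move=> th n; apply: P_alpha => //; move: alpha_lt; lra.
- move=> x; rewrite (le_trans (norm_le_wnorm W_gt0 x f_fin))//.
  by rewrite ler_wpM2r ?lerDl// ltW.
Qed.
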